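(* There does not exist any $2$-dimensional translator $\Sigma^2\subseteq\mathbb{R}^3$ with finite entropy, contained in a vertical slab $\{a<x_1<a+\omega\}$ ($a\in\mathbb{R}$) of width $\omega>0$ and satisfying one of the following assumptions: (a) $\omega<\pi$, and $\Sigma$ is contained in an upper halfspace with respect to the translating direction, i.e. $\Sigma\subseteq\{x_3\ge c\}$ for some $c\in\mathbb{R}$; (b) $\omega=\pi$, and $\Sigma$ is contained in a slanted halfspace of the form $\{x_3+\beta x_2\ge c\}$ for some $c\in\mathbb{R}$ and some $\beta\in\mathbb{R}$ with $\beta\ne 0$.
   Context: Coordinates $(x_1,x_2,x_3)$ and standard orthonormal basis $(e_1,e_2,e_3)$ of Euclidean $\mathbb{R}^3$ are fixed. A translator $\Sigma^2\subseteq\mathbb{R}^3$ is a smooth, connected, (immersed) surface without boundary, complete in the induced metric, satisfying $\mathbf{H}=e_3^{\perp}$, where $\mathbf{H}$ is the mean curvature vector (the trace of the vector-valued second fundamental form, i.e. of the generalized Hessian of the immersion) and $(\cdot)^\perp$ is the projection onto the normal bundle of $\Sigma$. Entropy: $\lambda(\Sigma)=\sup_{x_0\in\mathbb{R}^3,\,t_0>0}\frac{1}{4\pi t_0}\int_\Sigma e^{-\|x-x_0\|^2/(4t_0)}\,d\mathrm{vol}_\Sigma$; finite entropy means $\lambda(\Sigma)<\infty$. *)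

(* Defs.v *)
From HB Require Import structures.
From mathcomp Require Import all_boot all_order all_algebra.
From mathcomp Require Import all_classical all_reals all_analysis.
Set Implicit Arguments.
Unset Strict Implicit.
Unset Printing Implicit Defensive.
Import Order.TTheory GRing.Theory Num.Theory numFieldNormedType.Exports.
Local Open Scope classical_set_scope.
Local Open Scope ring_scope.

(* Vectors of R^3 are row vectors.  The norm that the library puts on 'rV[R]_3
   is the sup norm; it is used only for limits and derivatives, and all metric
   notions below go through the Euclidean product [dot]. *)
Definition dot (R : realType) (v w : 'rV[R]_3) : R := \sum_i v 0 i * w 0 i.
Definition eucl (R : realType) (v : 'rV[R]_3) : R := Num.sqrt (dot v v).

Definition x1 (R : realType) (v : 'rV[R]_3) : R := v 0 0.
Definition x2 (R : realType) (v : 'rV[R]_3) : R := v 0 1.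
Definition x3 (R : realType) (v : 'rV[R]_3) : R := v 0 ord_max.
Definition e3 (R : realType) : 'rV[R]_3 := delta_mx 0 ord_max.

Definition axis (R : realType) (i : 'I_2) : R * R :=
  if i == 0 then (1, 0) else (0, 1).

Definition pder (R : realType) (V : normedModType R) (i : 'I_2)
  (f : R * R -> V) : R * R -> V := fun u => 'D_(axis R i) f u.

Fixpoint Ck_on (R : realType) (V : normedModType R) (k : nat)
    (U : set (R * R)) (f : R * R -> V) : Prop :=
  (forall u, U u -> {for u, continuous f}) /\
  if k is k'.+1 then
    forall i : 'I_2,
      (forall u, U u -> derivable f u (axis R i)) /\ Ck_on k' U (pder i f)
  else True.

(* Meaningful for open U: values of f outside U are then irrelevant. *)
Definition smooth_on (R : realType) (V : normedModType R)
  (U : set (R * R)) (f : R * R -> V) : Prop := forall k, Ck_on k U f.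

Definition jacobian (R : realType) (X : R * R -> 'rV[R]_3) (u : R * R)
  : 'M[R]_(2, 3) := \matrix_(i < 2) pder i X u.

(* A smooth surface without boundary with an immersion [imm] in R^3.  The
   atlas is given by local parametrizations [par n : dom n -> surf], which are
   homeomorphisms from open subsets of the plane onto open subsets of the
   surface, with inverses [coord n] (junk outside these sets).  The atlas is
   countable, which amounts to second countability of [surf]; a finite atlas
   is completed with charts of empty domain. *)
Record immersed_surface (R : realType) := ImmersedSurface {
  surf :> topologicalType ;
  dom : nat -> set (R * R) ;
  par : nat -> R * R -> surf ;
  coord : nat -> surf -> R * R ;
  imm : surf -> 'rV[R]_3 ;
  surf_hausdorff : hausdorff_space surf ;
  dom_open : forall n, open (dom n) ;
  img_open : forall n, open (par n @` dom n) ;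
  par_cover : forall p, exists n, (par n @` dom n) p ;
  coordK : forall n u, dom n u -> coord n (par n u) = u ;
  par_continuous : forall n u, dom n u -> {for u, continuous (par n)} ;
  coord_continuous : forall n p, (par n @` dom n) p ->
    {for p, continuous (coord n)} ;
  transition_smooth : forall m n,
    smooth_on (dom n `&` par n @^-1` (par m @` dom m)) (coord m \o par n) ;
  imm_smooth : forall n, smooth_on (dom n) (imm \o par n) ;
  imm_immersion : forall n u, dom n u ->
    \rank (jacobian (imm \o par n) u) = 2%N
}.

Arguments dom {R} _ _.
Arguments par {R} _ _ _.
Arguments coord {R} _ _ _.
Arguments imm {R _} _.

Section Geometry.
Variables (R : realType) (S : immersed_surface R).

Definition lpar (n : nat) : R * R -> 'rV[R]_3 := imm \o par S n.

Definition gram (n : nat) (u : R * R) : 'M[R]_2 :=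
  jacobian (lpar n) u *m (jacobian (lpar n) u)^T.

(* Orthogonal projections onto the tangent plane (the row space of the
   Jacobian J), v |-> v J^T (J J^T)^-1 J, and onto its orthogonal. *)
Definition tangent_proj (n : nat) (u : R * R) (v : 'rV[R]_3) : 'rV[R]_3 :=
  v *m (jacobian (lpar n) u)^T *m invmx (gram n u) *m jacobian (lpar n) u.
Definition normal_proj (n : nat) (u : R * R) (v : 'rV[R]_3) : 'rV[R]_3 :=
  v - tangent_proj n u v.

(* II(d_i, d_j) = (d_i d_j X)^perp for the local parametrization X. *)
Definition second_form (n : nat) (u : R * R) (i j : 'I_2) : 'rV[R]_3 :=
  normal_proj n u (pder i (pder j (lpar n)) u).

Definition mean_curvature (n : nat) (u : R * R) : 'rV[R]_3 :=
  \sum_i \sum_j invmx (gram n u) i j *: second_form n u i j.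

Definition C1_curve (g : R -> S) : Prop :=
  continuous g /\
  forall n t, (par S n @` dom S n) (g t) ->
    derivable (coord S n \o g) t 1 /\
    {for t, continuous (fun s : R => 'D_1 (coord S n \o g) s)}.

(* The length of a velocity in the induced metric is the Euclidean length of
   its image under the differential of the immersion. *)
Definition curve_length (g : R -> S) : \bar R :=
  (\int[@lebesgue_measure R]_(t in `[0%R, 1%R])
     (eucl ('D_1 (imm \o g) t))%:E)%E.

(* C^1 curves may stop, so concatenations of C^1 arcs can be reparametrized
   as C^1 curves and piecewise C^1 curves give the same infimum. *)
Definition induced_dist (p q : S) : \bar R :=
  ereal_inf [set curve_length g | g in
    [set g : R -> S | [/\ C1_curve g, g 0 = p & g 1 = q]]].

Definition complete_surface : Prop :=
  forall s : nat -> S,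
    (forall e : R, 0 < e -> exists N, forall m n : nat,
       (N <= m)%N -> (N <= n)%N -> (induced_dist (s m) (s n) < e%:E)%E) ->
    exists p : S, induced_dist (s n) p @[n --> \oo] --> 0%E.

Definition translator : Prop :=
  [/\ [set: S] !=set0, connected [set: S], complete_surface &
      forall n u, dom S n u ->
        mean_curvature n u = normal_proj n u (e3 R)].

(* The part of [dom n] whose image is not covered by the previous charts. *)
Definition fresh (n : nat) : set (R * R) :=
  dom S n `\` [set u | exists2 m : nat,
                 (m < n)%N & (par S m @` dom S m) (par S n u)].

(* Integral over S of f >= 0 with respect to the volume of the induced metric:
   the images of the sets [fresh n] partition S, and the volume element in the
   n-th chart is sqrt (det g) du. *)
Definition surface_integral (f : S -> R) : \bar R :=
  (\sum_(0 <= n <oo)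
     \int[(@lebesgue_measure R \x @lebesgue_measure R)%E]_(u in fresh n)
       (f (par S n u) * Num.sqrt (\det (gram n u)))%:E)%E.

Definition gaussian_area (y : 'rV[R]_3) (t : R) : \bar R :=
  ((4 * pi * t)^-1%:E *
   surface_integral
     (fun p => expR (- (eucl (imm p - y) ^+ 2 / (4 * t)))))%E.

Definition entropy : \bar R :=
  ereal_sup [set a | exists (y : 'rV[R]_3) (t : R), 0 < t /\ a = gaussian_area y t].

End Geometry.

(* Main.v *)
(* Let y be the signed distance to the middle of the slab, and consider the
   vector field U = (u(y), K, - g(y)) of R^3 and the weight
   e^(- kappa (x_3 + beta x_2)).  On a translator the mean curvature is the
   normal component of e_3, so the weighted divergence of the tangential part W
   of U is a quadratic form in the unit normal whose coefficients depend only
   on y.  When omega < pi, or omega = pi and beta <> 0, the profile g, the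
   constant K and a small kappa > 0 can be chosen such that this form is bounded
   below by some delta > 0.  As W is bounded and the surface is complete, W has
   a flow for all positive times, which expands the weighted area at an
   exponential rate.  But a bounded open set is within distance O(1 + T) of its
   image at time T, the weight is bounded in the upper halfspace, and finite
   entropy makes the area in a ball of radius r at most quadratic in r.

   The weighted area is only transported on open sets, by comparing the images
   of small dyadic squares with parallelograms. *)

From HB Require Import structures.
Require Import Defs.
From mathcomp Require Import all_boot all_order all_algebra.
From mathcomp Require Import all_classical all_reals all_analysis.
From mathcomp Require Import measurable_realfun ring lra.
Import Order.TTheory GRing.Theory Num.Theory numFieldNormedType.Exports.
Set Implicit Arguments.
Unset Strict Implicit.
Unset Printing Implicit Defensive.
Local Open Scope classical_set_scope.
Local Open Scope ring_scope.

(** * Calculus in the plane *)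

(** The vertical planes on which [x1] is constant are translators of finite entropy inside every
    slab, so the halfspace has to enter. Here they appear as a degeneracy. For [kappa = 0] and u = -
    g' the form is h n_2^2 + K n_2 n_3 + (h - g) n_3^2 with h = - g'', and it does not see the first
    component of the unit normal n. The weight adds kappa (g - beta K) n_1^2, and the halfspace is
    what keeps that weight bounded. Positivity thus asks for g > beta K, h > 0 and h (h - g) > K^2 /
    4. With K = 0 this means that g and - g'' - g are both uniformly positive; testing the second
    against the cosine that vanishes on the walls shows that this is possible only for width below
    pi. At width pi, a nonzero beta lets g become slightly negative near the walls. The flow
    replaces the differentiation of the area of intrinsic balls: neither cutoff functions nor a
    divergence theorem on the surface are used. All area estimates are one-sided, with a factor
    theta to spare; the invariance of the area under changes of chart follows by exchanging the
    charts and letting theta tend to 1. *)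

Section OneDim.
Variable R : realType.
Implicit Types f df : R -> R.

Lemma is_derive_within f df (a b : R) :
  (forall t, a <= t <= b -> is_derive t 1 f (df t)) ->
  {within `[a, b], continuous f}.
Proof.
move=> h; apply: derivable_within_continuous => t; rewrite in_itv /= => /h fd.
exact: ex_derive.
Qed.

Lemma mvt_eq f df (a b : R) : a <= b ->
  (forall t, a <= t <= b -> is_derive t 1 f (df t)) ->
  exists2 c, a <= c <= b & f b - f a = df c * (b - a).
Proof.
move=> ab h.
have [|c] := MVT_segment (f := f) (df := df) ab _ (is_derive_within h).
  by move=> x; rewrite in_itv /= => /andP[ax xb]; apply: h; rewrite !ltW.
by rewrite in_itv /=; exists c.
Qed.

Lemma mvt_bound f df (a b M s t : R) : a <= s <= b -> a <= t <= b ->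
  (forall t, a <= t <= b -> is_derive t 1 f (df t)) ->
  (forall t, a <= t <= b -> `|df t| <= M) ->
  `|f t - f s| <= M * `|t - s|.
Proof.
move=> /andP[as_ sb] /andP[at_ tb] h hM.
wlog st : s t as_ sb at_ tb / s <= t.
  move=> H; case: (leP s t) => [|/ltW] st; first exact: H.
  by rewrite distrC (distrC t) H.
have [|c /andP[sc ct] ->] := @mvt_eq f df s t st.
  move=> x /andP[sx xt]; apply: h.
  by rewrite (le_trans as_ sx) (le_trans xt tb).
rewrite normrM ler_wpM2r // hM //.
by rewrite (le_trans as_ sc) (le_trans ct tb).
Qed.

(** On so short an interval the exponential of Gronwall's inequality can be replaced by 2: if [|f|]
    is maximal at [c], the mean value bound makes [|f c - f s|] at most half of [|f c|]. *)
Lemma gronwall2 (f df : R -> R * R) (a b L s t : R) :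
  a <= s <= b -> a <= t <= b ->
  (forall t, a <= t <= b -> is_derive t 1 (fst \o f) (df t).1) ->
  (forall t, a <= t <= b -> is_derive t 1 (snd \o f) (df t).2) ->
  0 <= L -> L * (b - a) <= 2^-1 ->
  (forall t, a <= t <= b -> `|df t| <= L * `|f t|) ->
  `|f t| <= 2 * `|f s|.
Proof.
move=> sab tab h1 h2 L0 Lab hL.
have ab : a <= b by case/andP: sab => x y; exact: le_trans x y.
have cf : {within `[a, b], continuous (fun t => `|f t|)}.
  have c1 := is_derive_within h1; have c2 := is_derive_within h2.
  have -> : (fun t => `|f t|) = (fun t => Num.max `|(fst \o f) t| `|(snd \o f) t|).
    by apply/funext => x; rewrite prod_normE.
  move=> x; apply: (@continuous_max R (subspace `[a, b]) (fun x => `|(fst \o f) x|) (fun x => `|(snd \o f) x|)).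
    by apply: (@continuous_comp (subspace `[a, b]) _ _ (fst \o f) (fun z : R => `|z|)); [exact: c1|exact: norm_continuous].
  by apply: (@continuous_comp (subspace `[a, b]) _ _ (snd \o f) (fun z : R => `|z|)); [exact: c2|exact: norm_continuous].
have [c cab cM] := EVT_max ab cf.
rewrite in_itv /= in cab.
have cM' : forall t, a <= t <= b -> `|f t| <= `|f c| by move=> u uab; apply: cM; rewrite in_itv.
have dM u : a <= u <= b -> `|df u| <= L * `|f c|.
  by move=> uab; apply: le_trans (hL _ uab) _; rewrite ler_wpM2l // cM'.
have d1 u : a <= u <= b -> `|(df u).1| <= L * `|f c|.
  by move=> uab; apply: le_trans (dM _ uab); rewrite prod_normE le_max lexx.
have d2 u : a <= u <= b -> `|(df u).2| <= L * `|f c|.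
  by move=> uab; apply: le_trans (dM _ uab); rewrite prod_normE le_max lexx orbT.
have cs : `|c - s| <= b - a.
  rewrite ler_norml; move/andP: cab => [? ?]; move/andP: sab => [? ?].
  by apply/andP; split; lra.
have key : `|f c - f s| <= 2^-1 * `|f c|.
  have H : L * `|f c| * `|c - s| <= 2^-1 * `|f c|.
    rewrite mulrAC; apply: ler_wpM2r => //; apply: le_trans Lab.
    exact: ler_wpM2l.
  rewrite prod_normE ge_max /=; apply/andP; split; apply: le_trans H.
    exact: (mvt_bound sab cab h1 d1).
  exact: (mvt_bound sab cab h2 d2).
have := ler_normB (f c) (f c - f s); rewrite subKr => h.
have h3 : `|f c| <= 2 * `|f s|.
  have := ler_normD (f c - f s) (f s); rewrite subrK => h4.
  lra.
exact: le_trans (cM' _ tab) h3.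
Qed.

(* Real induction on a segment, in relational form. *)
Lemma chain (Q : R -> R -> Prop) (a b : R) : a <= b ->
  (forall s t u, Q s t -> Q t u -> Q s u) ->
  (forall t, a <= t <= b -> exists2 e, 0 < e &
     forall s u, a <= s -> s <= u -> u <= b -> t - e < s -> u < t + e -> Q s u) ->
  Q a b.
Proof.
move=> ab tr loc.
pose A := [set t | a <= t <= b /\ Q a t].
have Aa : A a.
  split; first by rewrite lexx ab.
  have [|e e0 h] := loc a; first by rewrite lexx.
  by apply: h => //; [rewrite ltrBlDr ltrDl|rewrite ltrDl].
have Ab : ubound A b by move=> t [/andP[]].
have supA : has_sup A by split; [exists a|exists b].
set c := sup A.
have ac : a <= c by exact: sup_upper_bound.
have cb : c <= b by apply: ge_sup => //; exists a.
have [|e e0 h] := loc c; first by rewrite ac cb.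
have [t [/andP[at_ tb] Qat] ct] := sup_adherent e0 supA.
have tc : t <= c by apply: sup_upper_bound => //; split=> //; rewrite at_ tb.
have Qac : Q a c by apply: tr Qat _; apply: h => //; rewrite ltrDl.
(* If the supremum [c] were below [b], the chain would continue to [u > c]; hence [u] can only be
   [b]. *)
pose u := Num.min b (c + e / 2).
have cu : c <= u by rewrite le_min cb lerDl divr_ge0 // ltW.
have Qau : Q a u.
  apply: tr Qac _; apply: h => //.
  - by rewrite ge_min lexx.
  - by rewrite ltrBlDr ltrDl.
  - by rewrite gt_min; apply/orP; right; lra.
have Au : A u by split=> //; rewrite (le_trans ac cu) ge_min lexx.
have uc : u <= c by exact: sup_upper_bound.
have : u = b.
  move: uc; rewrite /u; case: (leP b (c + e / 2)) => // _ uc; lra.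
by move=> <-.
Qed.

End OneDim.

Lemma cts_eps (R : realType) (V W : normedModType R) (f : V -> W) u :
  {for u, continuous f} <-> (forall e : R, 0 < e -> exists2 r : R, 0 < r &
    forall a, `|a - u| < r -> `|f a - f u| <= e).
Proof.
split=> [/cvgrPdist_le h e e0|h].
  have /nbhs_normP[r r0 hr] := h e e0; exists r => // a au.
  by rewrite distrC; apply: hr; rewrite /ball_ /= distrC.
apply/cvgrPdist_le => e e0; have [r r0 hr] := h e e0.
apply/nbhs_normP; exists r => // a /= ua; rewrite distrC hr //.
by rewrite distrC.
Qed.

(** * Strict differentiability and its calculus *)

Section StrictDiff.
Variable R : realType.
Implicit Types (f g : R * R -> R) (u a b : R * R).

(* Strict differentiability: [f] minus its linear part has arbitrarily small
   Lipschitz constant near [u].  Every C^1 function has this property. *)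
Definition sdiff f u (d : R * R) := forall e : R, 0 < e -> exists2 r, 0 < r &
  forall a b, `|a - u| < r -> `|b - u| < r ->
    `|f a - f b - (d.1 * (a.1 - b.1) + d.2 * (a.2 - b.2))| <= e * `|a - b|.

Definition sdiff1 (h : R -> R) (x d : R) := forall e : R, 0 < e ->
  exists2 r, 0 < r & forall a b : R, `|a - x| < r -> `|b - x| < r ->
    `|h a - h b - d * (a - b)| <= e * `|a - b|.

Lemma norm_fst (a : R * R) : `|a.1| <= `|a|.
Proof. by rewrite prod_normE le_max lexx. Qed.
Lemma norm_snd (a : R * R) : `|a.2| <= `|a|.
Proof. by rewrite prod_normE le_max lexx orbT. Qed.

Lemma sdiff_lip f u d : sdiff f u d -> exists2 r, 0 < r &
  forall a b, `|a - u| < r -> `|b - u| < r ->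
    `|f a - f b| <= (`|d.1| + `|d.2| + 1) * `|a - b|.
Proof.
move=> /(_ 1 ltr01)[r r0 h]; exists r => // a b ar br.
have {}h := h a b ar br.
have := ler_normD (f a - f b - (d.1 * (a.1 - b.1) + d.2 * (a.2 - b.2)))
  (d.1 * (a.1 - b.1) + d.2 * (a.2 - b.2)).
rewrite subrK => /le_trans; apply.
rewrite mulrDl addrC lerD //.
apply: le_trans (ler_normD _ _) _; rewrite !normrM mulrDl.
by rewrite lerD // ler_wpM2l //; [apply: (norm_fst (a - b))|apply: (norm_snd (a - b))].
Qed.

Lemma sdiff_cts f u d : sdiff f u d -> {for u, continuous f}.
Proof.
move=> /sdiff_lip[r r0 h]; apply/cts_eps => e e0.
set K := `|d.1| + `|d.2| + 1 in h.
have K0 : 0 < K by rewrite ltr_wpDl ?addr_ge0.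
exists (Num.min r (e / K)) => [|a]; first by rewrite lt_min r0 divr_gt0.
rewrite lt_min => /andP[ar ae]; apply: le_trans (h a u _ _) _ => //.
- by rewrite subrr normr0.
- by rewrite mulrC -ler_pdivlMr // ltW.
Qed.

Lemma sdiff_cst c u : sdiff (fun=> c) u (0, 0).
Proof.
move=> e e0; exists 1 => // a b _ _.
by rewrite /= !mul0r addr0 !subrr normr0 mulr_ge0 // ltW.
Qed.

Lemma sdiffD f g u d c : sdiff f u d -> sdiff g u c ->
  sdiff (fun x => f x + g x) u (d + c).
Proof.
move=> hf hg e e0; have e20 : 0 < e / 2 by rewrite divr_gt0.
have [r r0 {}hf] := hf _ e20; have [s s0 {}hg] := hg _ e20.
exists (Num.min r s) => [|a b]; first by rewrite lt_min r0.
rewrite !lt_min => /andP[ar as_] /andP[br bs].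
have := ler_normD (f a - f b - (d.1 * (a.1 - b.1) + d.2 * (a.2 - b.2)))
  (g a - g b - (c.1 * (a.1 - b.1) + c.2 * (a.2 - b.2))).
have -> : forall x y z w t t' s s' p q : R,
   x - y - (t * p + t' * q) + (z - w - (s * p + s' * q)) =
   (x + z) - (y + w) - ((t + s) * p + (t' + s') * q) by move=> *; ring.
move=> /le_trans; apply.
by rewrite (splitr e) mulrDl lerD // ?hf ?hg.
Qed.

Lemma sdiff_comp1 h f u d c : sdiff f u d -> sdiff1 h (f u) c ->
  sdiff (fun x => h (f x)) u (c * d.1, c * d.2).
Proof.
move=> hf hh e e0.
have [r r0 hL] := sdiff_lip hf.
set K := `|d.1| + `|d.2| + 1 in hL.
have K0 : 0 < K by rewrite ltr_wpDl ?addr_ge0.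
have e1 : 0 < e / (2 * K) by rewrite divr_gt0 // mulr_gt0.
have e2 : 0 < e / (2 * (`|c| + 1)) by rewrite divr_gt0 // mulr_gt0 // ltr_wpDl.
have [s s0 {}hh] := hh _ e1.
have [t t0 {}hf] := hf _ e2.
exists (Num.min (Num.min r t) (s / K)) => [|a b].
  by rewrite !lt_min r0 t0 divr_gt0.
rewrite !lt_min => /andP[/andP[ar at_] as_] /andP[/andP[br bt] bs].
have near x : `|x - u| < r -> `|x - u| < s / K -> `|f x - f u| < s.
  move=> xr xs; apply: le_lt_trans (hL x u xr _) _; first by rewrite subrr normr0.
  by rewrite mulrC -ltr_pdivlMr.
have h1 := hh _ _ (near a ar as_) (near b br bs).
have h2 := hf a b at_ bt.
have h3 := hL a b ar br.
have -> : h (f a) - h (f b) - (c * d.1 * (a.1 - b.1) + c * d.2 * (a.2 - b.2)) =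
  (h (f a) - h (f b) - c * (f a - f b)) +
  c * (f a - f b - (d.1 * (a.1 - b.1) + d.2 * (a.2 - b.2))) by ring.
apply: le_trans (ler_normD _ _) _; rewrite normrM.
rewrite (splitr e) mulrDl; apply: lerD.
  apply: le_trans h1 _; apply: le_trans (_ : e / (2 * K) * (K * `|a - b|) <= _).
    by rewrite ler_wpM2l // ltW.
  rewrite mulrA ler_wpM2r // le_eqVlt; apply/orP; left; apply/eqP.
  by field; rewrite gt_eqF.
apply: le_trans (_ : `|c| * (e / (2 * (`|c| + 1)) * `|a - b|) <= _).
  by rewrite ler_wpM2l.
rewrite mulrA ler_wpM2r //.
have -> : `|c| * (e / (2 * (`|c| + 1))) = (e / 2) * (`|c| / (`|c| + 1)).
  by field; rewrite gt_eqF // ltr_wpDl.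
rewrite ler_piMr ?divr_ge0 ?ltW //.
by rewrite ltr_pdivrMr ?mul1r ?ltrDl // ltr_wpDl.
Qed.

(** The mean value bound is applied to [h] minus the line of slope [dh x], whose derivative is small
    near [x]. *)
Lemma sdiff1_C1 (h dh : R -> R) (x r : R) : 0 < r ->
  (forall y : R, `|y - x| < r -> is_derive y 1 h (dh y)) ->
  {for x, continuous dh} -> sdiff1 h x (dh x).
Proof.
move=> r0 hd hc e e0.
have /nbhs_normP[s /= s0 hs] : \forall y \near x, `|dh x - dh y| <= e.
  exact: (@cvgr_dist_le _ _ _ (nbhs x) _ dh _ hc).
exists (Num.min r s) => [|a b]; first by rewrite lt_min r0.
rewrite !lt_min => /andP[ar as_] /andP[br bs].
have box (t : R) k : `|a - x| < k -> `|b - x| < k -> Num.min a b <= t <= Num.max a b ->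
    `|t - x| < k.
  rewrite !ltr_norml => /andP[a1 a2] /andP[b1 b2]; rewrite ge_min le_max.
  move=> /andP[t1 t2]; apply/andP; split.
    by case/orP: t1 => t1; [apply: lt_le_trans a1 _|apply: lt_le_trans b1 _]; rewrite lerD2r.
  by case/orP: t2 => t2; [apply: le_lt_trans a2|apply: le_lt_trans b2]; rewrite lerD2r.
have H := @mvt_bound R (fun y => h y - dh x * y) (fun y => dh y - dh x)
  (Num.min a b) (Num.max a b) e b a.
have -> : h a - h b - dh x * (a - b) = h a - dh x * a - (h b - dh x * b) by ring.
apply: H.
- by rewrite ge_min lexx orbT le_max lexx orbT.
- by rewrite ge_min lexx le_max lexx.
- move=> t /(box _ r ar br) tr; have := hd t tr => ht.
  apply: is_derive_eq; by rewrite scaler1.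
- move=> t /(box _ s as_ bs) ts; rewrite distrC; apply: hs.
  by rewrite /ball_ /= distrC.
Qed.

(** Polarisation, f g = ((f + g)^2 - (f - g)^2) / 4, reduces the product rule to sums and to
    compositions with functions of one variable. *)
Lemma sdiffM f g u d c : sdiff f u d -> sdiff g u c ->
  sdiff (fun x => f x * g x) u (f u * c.1 + g u * d.1, f u * c.2 + g u * d.2).
Proof.
move=> hf hg.
have sq (x : R) : sdiff1 (fun y => y * y) x (2 * x).
  apply: (@sdiff1_C1 (fun y : R => y * y) (fun y => 2 * y) x 1) => //.
    move=> y _; apply: is_derive_eq; rewrite /GRing.scale /=; ring.
  by apply: continuousM; [exact: cvg_cst|exact: cvg_id].
have opp (x : R) : sdiff1 (fun y => - y) x (- 1).
  apply: (@sdiff1_C1 (fun y : R => - y) (fun y => - 1) x 1 ltr01).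
  exact: cvg_cst.
have quarter (x : R) : sdiff1 (fun y => 4^-1 * y) x 4^-1.
  apply: (@sdiff1_C1 (fun y : R => 4^-1 * y) (fun y => 4^-1) x 1) => //; last exact: cvg_cst.
  by move=> y _; apply: is_derive_eq; rewrite scaler1.
have hp := sdiff_comp1 (sdiffD hf hg) (sq _).
have hm := sdiff_comp1 (sdiffD hf (sdiff_comp1 hg (opp _))) (sq _).
have H := sdiff_comp1 (sdiffD hp (sdiff_comp1 hm (opp _))) (quarter _).
move: H; set F := (fun x => _); set D := (_, _) => H.
have -> : (fun x => f x * g x) = F by apply/funext => x; rewrite /F; field.
suff -> : (f u * c.1 + g u * d.1, f u * c.2 + g u * d.2) = D by [].
by rewrite /D /=; congr (_, _); field.
Qed.

Lemma sdiff_near f g u d : (\forall x \near u, f x = g x) ->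
  sdiff f u d -> sdiff g u d.
Proof.
move=> /nbhs_normP[s /= s0 hs] hf e e0.
have [r r0 {}hf] := hf e e0.
exists (Num.min r s) => [|a b]; first by rewrite lt_min r0.
rewrite !lt_min => /andP[ar as_] /andP[br bs].
rewrite -(hs a) -?(hs b) ?hf //=; by rewrite distrC.
Qed.

Lemma sdiff_comp2 f (T : R * R -> R * R) u d c0 c1 :
  sdiff (fst \o T) u c0 -> sdiff (snd \o T) u c1 -> sdiff f (T u) d ->
  sdiff (fun x => f (T x)) u
    (d.1 * c0.1 + d.2 * c1.1, d.1 * c0.2 + d.2 * c1.2).
Proof.
move=> h0 h1 hf e e0.
have [r0 r0p hL0] := sdiff_lip h0; have [r1 r1p hL1] := sdiff_lip h1.
set K0 := `|c0.1| + `|c0.2| + 1 in hL0; set K1 := `|c1.1| + `|c1.2| + 1 in hL1.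
have K0p : 0 < K0 by rewrite ltr_wpDl ?addr_ge0.
have K1p : 0 < K1 by rewrite ltr_wpDl ?addr_ge0.
set K := K0 + K1; have Kp : 0 < K by rewrite addr_gt0.
set M := `|d.1| + `|d.2| + 1.
have Mp : 0 < M by rewrite ltr_wpDl ?addr_ge0.
have e1 : 0 < e / (2 * K) by rewrite divr_gt0 // mulr_gt0.
have e2 : 0 < e / (2 * M) by rewrite divr_gt0 // mulr_gt0.
have [s sp {}hf] := hf _ e1.
have [t0 t0p {}h0] := h0 _ e2.
have [t1 t1p {}h1] := h1 _ e2.
exists (Num.min (Num.min (Num.min r0 r1) (Num.min t0 t1)) (s / K)) => [|a b].
  by rewrite !lt_min r0p r1p t0p t1p divr_gt0.
rewrite !lt_min => /andP[/andP[/andP[ar0 ar1] /andP[at0 at1]] as_].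
move=> /andP[/andP[/andP[br0 br1] /andP[bt0 bt1]] bs].
have TL x y : `|x - u| < r0 -> `|x - u| < r1 -> `|y - u| < r0 -> `|y - u| < r1 ->
    `|T x - T y| <= K * `|x - y|.
  move=> *; rewrite prod_normE ge_max; apply/andP; split.
    apply: le_trans (hL0 x y _ _) _ => //.
    by rewrite ler_wpM2r // lerDl ltW.
  apply: le_trans (hL1 x y _ _) _ => //.
  by rewrite ler_wpM2r // lerDr ltW.
have near x : `|x - u| < r0 -> `|x - u| < r1 -> `|x - u| < s / K -> `|T x - T u| < s.
  move=> xr0 xr1 xs; apply: le_lt_trans (TL x u _ _ _ _) _ => //; rewrite ?subrr ?normr0 //.
  by rewrite mulrC -ltr_pdivlMr.
have H1 := hf _ _ (near a ar0 ar1 as_) (near b br0 br1 bs).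
have H2 := h0 a b at0 bt0; have H3 := h1 a b at1 bt1.
have H4 := TL a b ar0 ar1 br0 br1.
rewrite /=.
have -> : f (T a) - f (T b) - ((d.1 * c0.1 + d.2 * c1.1) * (a.1 - b.1) +
    (d.1 * c0.2 + d.2 * c1.2) * (a.2 - b.2)) =
  (f (T a) - f (T b) - (d.1 * ((T a).1 - (T b).1) + d.2 * ((T a).2 - (T b).2))) +
  (d.1 * ((T a).1 - (T b).1 - (c0.1 * (a.1 - b.1) + c0.2 * (a.2 - b.2))) +
   d.2 * ((T a).2 - (T b).2 - (c1.1 * (a.1 - b.1) + c1.2 * (a.2 - b.2)))) by ring.
apply: le_trans (ler_normD _ _) _.
rewrite (splitr e) mulrDl; apply: lerD.
  apply: le_trans H1 _; apply: le_trans (_ : e / (2 * K) * (K * `|a - b|) <= _).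
    by rewrite ler_wpM2l // ltW.
  rewrite mulrA ler_wpM2r // le_eqVlt; apply/orP; left; apply/eqP.
  by field; rewrite gt_eqF.
apply: le_trans (ler_normD _ _) _; rewrite !normrM.
apply: le_trans (_ : (`|d.1| + `|d.2|) * (e / (2 * M) * `|a - b|) <= _).
  by rewrite mulrDl lerD // ler_wpM2l.
rewrite mulrA ler_wpM2r //.
have -> : (`|d.1| + `|d.2|) * (e / (2 * M)) = (e / 2) * ((`|d.1| + `|d.2|) / M).
  by field; rewrite gt_eqF.
rewrite ler_piMr ?divr_ge0 ?ltW //.
by rewrite ltr_pdivrMr ?mul1r ?ltrDl.
Qed.

End StrictDiff.

(** * Partial derivatives, chain rule along curves, symmetry of mixed derivatives *)

Section Partial.
Variable R : realType.

(** The difference quotient is cleared of its denominator, so that [h = 0] is allowed and errors can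
    be added and composed without division. *)
Lemma is_derive_eps (V : normedModType R) (f : V -> R) (u v : V) (d : R) :
  is_derive u v f d <-> (forall e : R, 0 < e -> exists2 r : R, 0 < r &
    forall h : R, `|h| < r -> `|f (u + h *: v) - f u - h * d| <= e * `|h|).
Proof.
have E (h : R) : h != 0 -> `|f (u + h *: v) - f u - h * d| =
    `|d - h^-1 *: (f (h *: v + u) - f u)| * `|h|.
  move=> h0; rewrite -normrM distrC addrC -(addrC u); congr `|_|.
  by rewrite /GRing.scale /=; field.
split=> [[fd fv] e e0|H].
  move: fd => /cvgrPdist_le; rewrite -/('D_v f u) fv => /(_ e e0).
  rewrite -nbhs_nearE /dnbhs => /nbhs_normP[r r0 hr]; exists r => // h hr'.
  have [->|h0] := eqVneq h 0.
    by rewrite scale0r addr0 subrr mul0r subr0 normr0 mulr0.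
  rewrite E // ler_wpM2r //; apply: hr => //=.
  by rewrite /ball_ /= sub0r normrN.
have C : h^-1 *: (f (h *: v + u) - f u) @[h --> 0^'] --> d.
  apply/cvgrPdist_le => e e0; have [r r0 hr] := H e e0.
  apply/nbhs_normP; exists r => // h /=; rewrite sub0r normrN => hh h0.
  by rewrite -(ler_pM2r (_ : 0 < `|h|)) ?normr_gt0 // -E // hr.
by split; [apply/cvg_ex; exists d|exact: cvg_lim C].
Qed.

Lemma sdiff_along (f : R * R -> R) (c : R -> R * R) t d p q :
  sdiff f (c t) d -> is_derive t 1 (fst \o c) p -> is_derive t 1 (snd \o c) q ->
  is_derive t 1 (f \o c) (d.1 * p + d.2 * q).
Proof.
move=> hf /is_derive_eps hp /is_derive_eps hq; apply/is_derive_eps => e e0.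
have [r0 r00 hp1] := hp 1 ltr01; have [r1 r10 hq1] := hq 1 ltr01.
set K := `|p| + `|q| + 1; have K0 : 0 < K by rewrite ltr_wpDl ?addr_ge0.
set M := `|d.1| + `|d.2| + 1; have M0 : 0 < M by rewrite ltr_wpDl ?addr_ge0.
have eK : 0 < e / (2 * K) by rewrite divr_gt0 // mulr_gt0.
have eM : 0 < e / (2 * M) by rewrite divr_gt0 // mulr_gt0.
have [s s0 {}hf] := hf _ eK.
have [r2 r20 {}hp] := hp _ eM; have [r3 r30 {}hq] := hq _ eM.
exists (Num.min (Num.min (Num.min r0 r1) (Num.min r2 r3)) (s / K)) => [|h].
  by rewrite !lt_min r00 r10 r20 r30 divr_gt0.
rewrite !lt_min => /andP[/andP[/andP[hr0 hr1] /andP[hr2 hr3]] hs].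
have sc : h *: (1 : R) = h by rewrite /GRing.scale /= mulr1.
rewrite sc /=.
have cL : `|c (t + h) - c t| <= K * `|h|.
  have aux (x z : R) : `|x - h * z| <= 1 * `|h| -> `|x| <= (`|z| + 1) * `|h|.
    move=> xz; rewrite -(subrK (h * z) x); apply: le_trans (ler_normD _ _) _.
    by rewrite mulrDl addrC lerD // normrM mulrC.
  rewrite prod_normE ge_max; apply/andP; split.
    have /= := hp1 h hr0; rewrite sc => /aux /le_trans; apply.
    by rewrite ler_wpM2r // /K lerD2r lerDl.
  have /= := hq1 h hr1; rewrite sc => /aux /le_trans; apply.
  by rewrite ler_wpM2r // /K lerD2r lerDr.
have H1 : `|f (c (t + h)) - f (c t) - (d.1 * ((c (t + h)).1 - (c t).1) +
     d.2 * ((c (t + h)).2 - (c t).2))| <= e / (2 * K) * `|c (t + h) - c t|.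
  apply: hf; last by rewrite subrr normr0.
  by apply: le_lt_trans cL _; rewrite mulrC -ltr_pdivlMr.
have /= := hp h hr2; rewrite sc => H2.
have /= := hq h hr3; rewrite sc => H3.
have -> : f (c (t + h)) - f (c t) - h * (d.1 * p + d.2 * q) =
  (f (c (t + h)) - f (c t) - (d.1 * ((c (t + h)).1 - (c t).1) +
     d.2 * ((c (t + h)).2 - (c t).2))) +
  (d.1 * ((c (t + h)).1 - (c t).1 - h * p) + d.2 * ((c (t + h)).2 - (c t).2 - h * q)).
  by ring.
apply: le_trans (ler_normD _ _) _.
rewrite (splitr e) mulrDl; apply: lerD.
  apply: le_trans H1 _; apply: le_trans (_ : e / (2 * K) * (K * `|h|) <= _).
    by rewrite ler_wpM2l // ltW.
  rewrite mulrA ler_wpM2r // le_eqVlt; apply/orP; left; apply/eqP.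
  by field; rewrite gt_eqF.
apply: le_trans (ler_normD _ _) _; rewrite !normrM.
apply: le_trans (_ : (`|d.1| + `|d.2|) * (e / (2 * M) * `|h|) <= _).
  by rewrite mulrDl lerD // ler_wpM2l.
rewrite mulrA ler_wpM2r //.
have -> : (`|d.1| + `|d.2|) * (e / (2 * M)) = (e / 2) * ((`|d.1| + `|d.2|) / M).
  by field; rewrite gt_eqF.
rewrite ler_piMr ?divr_ge0 ?ltW //.
by rewrite ltr_pdivrMr ?mul1r ?ltrDl.
Qed.

Lemma sdiff_derive (f : R * R -> R) (u v d : R * R) : sdiff f u d ->
  is_derive u v f (d.1 * v.1 + d.2 * v.2).
Proof.
move=> hf; apply/is_derive_eps => e e0.
have V0 : 0 < `|v| + 1 by rewrite ltr_wpDl.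
have [r r0 {}hf] := hf (e / (`|v| + 1)) (divr_gt0 e0 V0).
exists (r / (`|v| + 1)) => [|h hr]; first by rewrite divr_gt0.
have E : u + h *: v - u = h *: v by rewrite addrAC subrr add0r.
have := hf (u + h *: v) u; rewrite E subrr normr0 => /(_ _ r0) H.
have -> : h * (d.1 * v.1 + d.2 * v.2) =
   d.1 * ((u + h *: v).1 - u.1) + d.2 * ((u + h *: v).2 - u.2).
  rewrite /=. rewrite /GRing.scale /=; ring.
apply: le_trans (H _) _.
  rewrite normrZ; apply: (@le_lt_trans _ _ (`|h| * (`|v| + 1))).
    by rewrite ler_wpM2l // lerDl.
  by rewrite -ltr_pdivlMr.
rewrite normrZ mulrAC ler_pdivrMr // -mulrA ler_wpM2l //; first exact: ltW.
by rewrite ler_wpM2l // lerDl.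
Qed.

Lemma axis0 : axis R 0 = (1, 0). Proof. by []. Qed.
Lemma axis1 : axis R 1 = (0, 1). Proof. by []. Qed.

Lemma sdiff_pder0 (f : R * R -> R) u d : sdiff f u d -> pder 0 f u = d.1.
Proof.
move=> h; have H := sdiff_derive (axis R 0) h; rewrite /pder.
have -> := @derive_val _ _ _ _ _ _ _ H.
by rewrite axis0 /= mulr1 mulr0 addr0.
Qed.

Lemma sdiff_pder1 (f : R * R -> R) u d : sdiff f u d -> pder 1 f u = d.2.
Proof.
move=> h; have H := sdiff_derive (axis R 1) h; rewrite /pder.
have -> := @derive_val _ _ _ _ _ _ _ H.
by rewrite axis1 /= mulr1 mulr0 add0r.
Qed.

Lemma derivable_line0 (f : R * R -> R) (x y : R) : derivable f (x, y) (axis R 0) ->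
  is_derive x 1 (fun s => f (s, y)) (pder 0 f (x, y)).
Proof.
move=> /derivableP /is_derive_eps H; apply/is_derive_eps => e /H[r r0 hr].
exists r => // h /hr.
have -> : (x, y) + h *: axis R 0 = (x + h *: 1, y).
  by rewrite axis0 -[LHS]/(x + h *: (1 : R), y + h *: (0 : R)) scaler0 addr0.
by [].
Qed.

Lemma derivable_line1 (f : R * R -> R) (x y : R) : derivable f (x, y) (axis R 1) ->
  is_derive y 1 (fun s => f (x, s)) (pder 1 f (x, y)).
Proof.
move=> /derivableP /is_derive_eps H; apply/is_derive_eps => e /H[r r0 hr].
exists r => // h /hr.
have -> : (x, y) + h *: axis R 1 = (x, y + h *: 1).
  by rewrite axis1 -[LHS]/(x + h *: (0 : R), y + h *: (1 : R)) scaler0 addr0.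
by [].
Qed.

Lemma min_max_ball (a b x r t : R) : `|a - x| < r -> `|b - x| < r ->
  Num.min a b <= t <= Num.max a b -> `|t - x| < r.
Proof.
rewrite !ltr_norml => /andP[a1 a2] /andP[b1 b2]; rewrite ge_min le_max.
move=> /andP[t1 t2]; apply/andP; split.
  by case/orP: t1 => t1; [apply: lt_le_trans a1 _|apply: lt_le_trans b1 _]; rewrite lerD2r.
by case/orP: t2 => t2; [apply: le_lt_trans a2|apply: le_lt_trans b2]; rewrite lerD2r.
Qed.

(** The increment is split at the corner [(b1, a2)]; on each of the two legs the mean value bound is
    applied to [f] minus its linear part. *)
Lemma sdiff_partial (f : R * R -> R) (u : R * R) (r0 : R) : 0 < r0 ->
  (forall v i, `|v - u| < r0 -> derivable f v (axis R i)) ->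
  (forall i, {for u, continuous (pder i f)}) ->
  sdiff f u (pder 0 f u, pder 1 f u).
Proof.
move=> r00 hd hc e e0; have e20 : 0 < e / 2 by rewrite divr_gt0.
have /cts_eps /(_ _ e20)[s0 s00 h0] := hc 0.
have /cts_eps /(_ _ e20)[s1 s10 h1] := hc 1.
exists (Num.min r0 (Num.min s0 s1)) => [|[a1 a2] [b1 b2]].
  by rewrite !lt_min r00 s00.
case: u => [u1 u2] in hd hc h0 h1 *.
rewrite !lt_min !prod_normE !gt_max /=.
move=> /andP[/andP[ar1 ar2] /andP[/andP[as1 as2] /andP[at1 at2]]].
move=> /andP[/andP[br1 br2] /andP[/andP[bs1 bs2] /andP[bt1 bt2]]].
set d0 := pder 0 f _; set d1 := pder 1 f _.
have inb (r v1 v2 : R) : `|v1 - u1| < r -> `|v2 - u2| < r -> `|(v1, v2) - (u1, u2)| < r.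
  by move=> *; rewrite prod_normE gt_max; apply/andP.
have H0 : `|(f (a1, a2) - d0 * a1) - (f (b1, a2) - d0 * b1)| <= e / 2 * `|a1 - b1|.
  apply: (@mvt_bound R (fun s => f (s, a2) - d0 * s)
    (fun s => pder 0 f (s, a2) - d0) (Num.min a1 b1) (Num.max a1 b1)).
  - by rewrite ge_min lexx orbT le_max lexx orbT.
  - by rewrite ge_min lexx le_max lexx.
  - move=> t /(min_max_ball ar1 br1) tr.
    have H := derivable_line0 (hd (t, a2) 0 (inb _ _ _ tr ar2)).
    by apply: is_derive_eq; rewrite scaler1.
  - by move=> t /(min_max_ball as1 bs1) ts; apply: h0; apply: inb.
have H1 : `|(f (b1, a2) - d1 * a2) - (f (b1, b2) - d1 * b2)| <= e / 2 * `|a2 - b2|.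
  apply: (@mvt_bound R (fun s => f (b1, s) - d1 * s)
    (fun s => pder 1 f (b1, s) - d1) (Num.min a2 b2) (Num.max a2 b2)).
  - by rewrite ge_min lexx orbT le_max lexx orbT.
  - by rewrite ge_min lexx le_max lexx.
  - move=> t /(min_max_ball ar2 br2) tr.
    have H := derivable_line1 (hd (b1, t) 1 (inb _ _ _ br1 tr)).
    by apply: is_derive_eq; rewrite scaler1.
  - by move=> t /(min_max_ball at2 bt2) ts; apply: h1; apply: inb.
have := ler_normD ((f (a1, a2) - d0 * a1) - (f (b1, a2) - d0 * b1))
  ((f (b1, a2) - d1 * a2) - (f (b1, b2) - d1 * b2)).
have -> : f (a1, a2) - d0 * a1 - (f (b1, a2) - d0 * b1) +
   (f (b1, a2) - d1 * a2 - (f (b1, b2) - d1 * b2)) =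
   f (a1, a2) - f (b1, b2) - (d0 * (a1 - b1) + d1 * (a2 - b2)) by ring.
move=> /le_trans; apply; rewrite (splitr e) mulrDl; apply: lerD.
  by apply: le_trans H0 _; rewrite (ler_wpM2l (ltW e20)) // le_max lexx.
by apply: le_trans H1 _; rewrite (ler_wpM2l (ltW e20)) // le_max lexx orbT.
Qed.

Lemma open_eps (V : normedModType R) (U : set V) u : open U -> U u ->
  exists2 r : R, 0 < r & forall v, `|v - u| < r -> U v.
Proof.
move=> oU Uu; have /nbhs_normP[r r0 hr] := open_nbhs_nbhs (conj oU Uu).
by exists r => // v vu; apply: hr; rewrite /ball_ /= distrC.
Qed.

Lemma Ck_on_sdiff (U : set (R * R)) (f : R * R -> R) k u : open U -> U u ->
  Ck_on k.+1 U f -> sdiff f u (pder 0 f u, pder 1 f u).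
Proof.
move=> oU Uu [_ h]; have [r r0 hr] := open_eps oU Uu.
apply: (sdiff_partial r0) => [v i /hr Uv|i].
  by have [/(_ v Uv)] := h i.
by have [_] := h i; case: k {h} => [|k] [/(_ u Uu)].
Qed.

Let aux (x y c d k e : R) : 0 < k -> forall Q p q A B : R,
  `|Q - (A * (c - c) + p * (y + k - y))| <= e / 2 * k ->
  `|Q - (q * (x + k - x) + B * (d - d))| <= e / 2 * k -> `|q - p| <= e.
Proof.
move=> k0 Q p q A B; rewrite !subrr !mulr0 add0r addr0.
rewrite (_ : x + k - x = k); last by ring.
rewrite (_ : y + k - y = k); last by ring.
move=> A0 A1; rewrite -(ler_pM2r k0) -[X in _ * X <= _](gtr0_norm k0) -normrM.
have -> : (q - p) * k = (Q - p * k) - (Q - q * k) by ring.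
apply: le_trans (ler_normB _ _) _.
by rewrite (splitr e) mulrDl lerD.
Qed.

(* Both mixed partials are limits of the second difference quotient
   [(f (x+h, y+h) - f (x+h, y) - f (x, y+h) + f (x, y)) / h^2]. *)
Lemma mixed_partials (U : set (R * R)) (f : R * R -> R) u : open U -> U u ->
  Ck_on 2 U f -> pder 0 (pder 1 f) u = pder 1 (pder 0 f) u.
Proof.
case: u => [x y] oU Uu [_ h]; have [r r0 hr] := open_eps oU Uu.
have D0 v : `|v - (x, y)| < r -> derivable f v (axis R 0) by move=> /hr Uv; have [/(_ v Uv)] := h 0.
have D1 v : `|v - (x, y)| < r -> derivable f v (axis R 1) by move=> /hr Uv; have [/(_ v Uv)] := h 1.
have S0 : sdiff (pder 0 f) (x, y) (pder 0 (pder 0 f) (x, y), pder 1 (pder 0 f) (x, y)).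
  by apply: (Ck_on_sdiff (k := 0) oU Uu); have [_ ] := h 0.
have S1 : sdiff (pder 1 f) (x, y) (pder 0 (pder 1 f) (x, y), pder 1 (pder 1 f) (x, y)).
  by apply: (Ck_on_sdiff (k := 0) oU Uu); have [_ ] := h 1.
set p := pder 1 (pder 0 f) (x, y) in S0 *; set q := pder 0 (pder 1 f) (x, y) in S1 *.
apply/eqP; rewrite -subr_eq0 -normr_eq0; apply/eqP/le_anti/andP; split => //.
apply/ler_addgt0Pr => e e0; rewrite add0r.
have e20 : 0 < e / 2 by rewrite divr_gt0.
have [s0 s00 {}S0] := S0 _ e20; have [s1 s10 {}S1] := S1 _ e20.
set m := Num.min r (Num.min s0 s1).
have m0 : 0 < m by rewrite !lt_min r0 s00.
have [k k0 km] : exists2 k, 0 < k & k < m by exists (m / 2); lra.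
have box (a b : R) : 0 <= a <= k -> 0 <= b <= k -> `|(x + a, y + b) - (x, y)| < m.
  move=> /andP[a0 ak] /andP[b0 bk]; rewrite prod_normE gt_max /=.
  have E (z c : R) : z + c - z = c by ring.
  by rewrite !E !ger0_norm // (le_lt_trans ak km) (le_lt_trans bk km).
have boxr a b : 0 <= a <= k -> 0 <= b <= k -> `|(x + a, y + b) - (x, y)| < r.
  by move=> ha hb; apply: lt_le_trans (box a b ha hb) _; rewrite ge_min lexx.
have boxs0 a b : 0 <= a <= k -> 0 <= b <= k -> `|(x + a, y + b) - (x, y)| < s0.
  by move=> ha hb; apply: lt_le_trans (box a b ha hb) _; rewrite !ge_min lexx orbT.
have boxs1 a b : 0 <= a <= k -> 0 <= b <= k -> `|(x + a, y + b) - (x, y)| < s1.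
  by move=> ha hb; apply: lt_le_trans (box a b ha hb) _; rewrite !ge_min lexx !orbT.
have kk : 0 <= k <= k by rewrite lexx ltW.
have zk : 0 <= (0 : R) <= k by rewrite lexx ltW.
have sh (z t : R) : z <= t <= z + k -> 0 <= t - z <= k.
  by move=> /andP[h1 h2]; apply/andP; split; lra.
have shE (z t : R) : z + (t - z) = t by ring.
pose D := f (x + k, y + k) - f (x + k, y) - f (x, y + k) + f (x, y).
have z0 (z : R) : z + 0 = z by rewrite addr0.
have [c ck Dc] : exists2 c, x <= c <= x + k &
    D = (pder 0 f (c, y + k) - pder 0 f (c, y)) * k.
  have [|t ht|c hc E] := @mvt_eq R (fun s => f (s, y + k) - f (s, y))
     (fun s => pder 0 f (s, y + k) - pder 0 f (s, y)) x (x + k).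
  - by rewrite lerDl ltW.
  - have B1 := derivable_line0 (D0 _ (boxr _ _ (sh _ _ ht) kk)).
    have B2 := derivable_line0 (D0 _ (boxr _ _ (sh _ _ ht) zk)).
    rewrite !shE !z0 in B1 B2. by apply: is_derive_eq.
  - exists c => //; move: E; rewrite (_ : x + k - x = k); last by ring.
    by move=> <-; rewrite /D; ring.
have [d dk Dd] : exists2 d, y <= d <= y + k &
    D = (pder 1 f (x + k, d) - pder 1 f (x, d)) * k.
  have [|t ht|d hd E] := @mvt_eq R (fun s => f (x + k, s) - f (x, s))
     (fun s => pder 1 f (x + k, s) - pder 1 f (x, s)) y (y + k).
  - by rewrite lerDl ltW.
  - have B1 := derivable_line1 (D1 _ (boxr _ _ kk (sh _ _ ht))).
    have B2 := derivable_line1 (D1 _ (boxr _ _ zk (sh _ _ ht))).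
    rewrite !shE !z0 in B1 B2. by apply: is_derive_eq.
  - exists d => //; move: E; rewrite (_ : y + k - y = k); last by ring.
    by move=> <-; rewrite /D; ring.
have := S0 _ _ (boxs0 _ _ (sh _ _ ck) kk) (boxs0 _ _ (sh _ _ ck) zk).
rewrite !shE !z0 /= => A0.
have := S1 _ _ (boxs1 _ _ kk (sh _ _ dk)) (boxs1 _ _ zk (sh _ _ dk)).
rewrite !shE !z0 /= => A1.
have N0 : `|(c, y + k) - (c, y)| = k.
  rewrite prod_normE /= subrr normr0 (_ : y + k - y = k); last by ring.
  by rewrite gtr0_norm // max_r // ltW.
have N1 : `|(x + k, d) - (x, d)| = k.
  rewrite prod_normE /= subrr normr0 (_ : x + k - x = k); last by ring.
  by rewrite gtr0_norm // max_l // ltW.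
rewrite N0 in A0; rewrite N1 in A1.
move: A0 A1; set P := pder 0 f (c, y + k) - _ in Dc *; set Q := pder 1 f (x + k, d) - _ in Dd *.
have PQ : P = Q.
  by apply: (mulIf (lt0r_neq0 k0)); rewrite -Dc.
rewrite PQ => A0 A1; exact: (aux k0 A0 A1).
Qed.

End Partial.

(** * Change of variables for open sets *)

Section Dyadic.
Variable R : realType.
Implicit Types (x y : R * R) (k : nat).

(** The half-open dyadic squares, indexed by their scale and the integer coordinates of a vertex.
    Being half-open, those of one scale tile the plane, and any two are nested or disjoint. *)
Definition cell (q : nat * (int * int)) : set (R * R) :=
  [set y | Num.floor (2 ^+ q.1 * y.1) = q.2.1 /\ Num.floor (2 ^+ q.1 * y.2) = q.2.2].
Definition cellof k x :=
  cell (k, (Num.floor (2 ^+ k * x.1), Num.floor (2 ^+ k * x.2))).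

Lemma cellof_refl k x : cellof k x x. Proof. by []. Qed.

Lemma cell_cellof q x : cell q x -> cell q = cellof q.1 x.
Proof. by case: q => [k [i j]] [/= h1 h2]; rewrite /cellof h1 h2. Qed.

(** This is the nesting of dyadic intervals of consecutive scales. *)
Lemma floor_double (y : R) : Num.floor y = (Num.floor (2 * y) %/ 2)%Z.
Proof.
apply: floor_def; have /andP[h1 h2] := floor_itv (2 * y).
set n := Num.floor _ in h1 h2 *.
have e := divz_eq n 2; have m0 := modz_ge0 n (isT : (2 : int) != 0).
have m1 := ltz_pmod n (isT : (0 : int) < 2).
set m := (n %/ 2)%Z in e *; set r := (n %% 2)%Z in e m0 m1.
have er : n%:~R = m%:~R * 2 + r%:~R :> R by rewrite e intrD intrM.
have r0 : 0 <= r%:~R :> R by rewrite ler0z.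
have r1 : r%:~R <= 1 :> R by rewrite -[1]/(1%:~R) ler_int -ltzD1.
rewrite intrD in h2; rewrite intrD er in h1 h2 *.
by apply/andP; split; rewrite ?rmorph1 in h2 *; lra.
Qed.

Lemma cellof_coarser k l x y : (k <= l)%N -> cellof l x y -> cellof k x y.
Proof.
elim: l => [|l IH]; first by rewrite leqn0 => /eqP->.
rewrite leq_eqVlt => /predU1P[-> //|kl] [/= h1 h2].
have H (z : R) : Num.floor (2 ^+ l * z) = (Num.floor (2 ^+ l.+1 * z) %/ 2)%Z.
  by rewrite floor_double exprS mulrA.
by apply: IH => //; split; rewrite /= !H ?h1 ?h2.
Qed.

Lemma cellof_eq k x y : cellof k x y -> cellof k x = cellof k y.
Proof. exact: cell_cellof. Qed.

(** The pieces are the maximal cells: good, contained in [O], and with no coarser cell around them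
    having both properties. Nesting makes them disjoint, and the cell of least admissible scale
    around a point is maximal. They are enumerated through [pickle_inv]; every other index gives the
    empty set. *)
Lemma dyadic_decomp (O : set (R * R)) (good : set (R * R) -> Prop) :
  (forall x, O x -> exists k, good (cellof k x) /\ cellof k x `<=` O) ->
  exists F : nat -> set (R * R),
    [/\ trivIset setT F, \bigcup_n F n = O &
        forall n, F n = set0 \/ exists k x, F n = cellof k x /\ good (F n)].
Proof.
move=> H.
pose G A := good A /\ A `<=` O.
pose I (q : nat * (int * int)) := G (cell q) /\
  forall k x, (k < q.1)%N -> cell q x -> ~ G (cellof k x).
pose F n := if pickle_inv n is Some q then if `[< I q >] then cell q else set0 else set0.
have FE n x : F n x -> exists q, [/\ F n = cell q, I q & pickle_inv n = Some q].
  rewrite /F; case: (pickle_inv n) => [q|//]; case: asboolP => // Iq _.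
  by exists q.
exists F; split.
- apply/trivIsetP => i j _ _ ij; apply/seteqP; split=> x // [] Fi Fj.
  have [p [Ep Ip up]] := FE _ _ Fi; have [q [Eq Iq uq]] := FE _ _ Fj.
  rewrite Ep in Fi; rewrite Eq in Fj.
  have ep := cell_cellof Fi; have eq := cell_cellof Fj.
  have [pq|qp|pq] := ltngtP p.1 q.1.
  + by case: Iq => _ /(_ _ _ pq Fj); case: Ip => + _; rewrite ep.
  + by case: Ip => _ /(_ _ _ qp Fi); case: Iq => + _; rewrite eq.
  + have pqE : p = q.
      move: Fi Fj pq; clear; case: p => [k [a b]]; case: q => [l [c d]] [/= <- <-] [/= <- <-] ->.
      by [].
    pose C : countType := (nat * (int * int))%type.
    have ki := @pickle_invK C i; have kj := @pickle_invK C j.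
    rewrite up /= in ki; rewrite uq /= in kj.
    by move: ij; rewrite -ki -kj pqE eqxx.
- apply/seteqP; split=> x.
    by case=> n _ /[dup] /FE[q [-> [[_ qO] _] _]] /qO.
  move=> /H Hx.
  have ex : exists k, `[< G (cellof k x) >] by case: Hx => k Gk; exists k; exact/asboolP.
  case: (ex_minnP ex) => k /asboolP Gk kmin.
  pose q := (k, (Num.floor (2 ^+ k * x.1), Num.floor (2 ^+ k * x.2))).
  exists (pickle q) => //; rewrite /F pickleK_inv.
  case: asboolP => // -[]; split => // l y lk yx Gl.
  suff : (k <= l)%N by rewrite leqNgt lk.
  apply: kmin; apply/asboolP; rewrite (@cellof_eq l x y) //.
  by apply: cellof_coarser yx; exact: ltnW.
- move=> n; case: (pselect (F n = set0)) => [|/eqP/set0P[x Fx]]; [by left|right].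
  have [q [E Iq _]] := FE _ _ Fx; rewrite E in Fx *.
  exists q.1, x; rewrite -(cell_cellof Fx); split=> //.
  by case: Iq => -[].
Qed.

Lemma cellof_box k x : cellof k x =
  `[(Num.floor (2 ^+ k * x.1))%:~R / 2 ^+ k,
    (Num.floor (2 ^+ k * x.1))%:~R / 2 ^+ k + (2 ^+ k)^-1[ `*`
  `[(Num.floor (2 ^+ k * x.2))%:~R / 2 ^+ k,
    (Num.floor (2 ^+ k * x.2))%:~R / 2 ^+ k + (2 ^+ k)^-1[.
Proof.
have p0 : 0 < (2 ^+ k : R) by rewrite exprn_gt0.
have H (m : int) (z : R) : (Num.floor (2 ^+ k * z) = m) <->
    m%:~R / 2 ^+ k <= z < m%:~R / 2 ^+ k + (2 ^+ k)^-1.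
  have -> : m%:~R / 2 ^+ k + (2 ^+ k)^-1 = (m + 1)%:~R / 2 ^+ k :> R.
    by rewrite intrD mulrDl mul1r.
  rewrite ler_pdivrMr // ltr_pdivlMr // (mulrC z); split=> [<-|].
    exact: floor_itv.
  exact: floor_def.
by apply/seteqP; split=> y /=; rewrite !in_itv /= => -[/H ? /H ?].
Qed.

Lemma cellof_small k x y : cellof k x y -> `|y - x| < (2 ^+ k)^-1.
Proof.
rewrite cellof_box => -[/=]; have := cellof_refl k x; rewrite cellof_box => -[/=].
rewrite !in_itv /= => /andP[a1 a2] /andP[a3 a4] /andP[a5 a6] /andP[a7 a8].
by rewrite prod_normE gt_max /= !ltr_norml; apply/andP; split; apply/andP; split; lra.
Qed.

Lemma pow2_small (r : R) : 0 < r -> exists k0, forall k, (k0 <= k)%N -> (2 ^+ k)^-1 < r.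
Proof.
move=> r0; have [n nr] : exists n : nat, r^-1 < n%:R.
  by exists (Num.truncn r^-1).+1; exact: truncnS_gt.
exists n => k nk; rewrite invf_plt ?posrE ?exprn_gt0 //; apply: lt_le_trans nr _.
rewrite -natrX ler_nat; apply: leq_trans nk _; apply: ltnW; exact: ltn_expl.
Qed.

Lemma measurable_cellof k x :
  measurable (cellof k x : set (measurableTypeR R * measurableTypeR R)).
Proof. by rewrite cellof_box; apply: measurableX; exact: measurable_itv. Qed.

(** Goodness is required only at small scales, depending on the point. This is how infinitesimal
    estimates become integrated ones. *)
Lemma dyadic_open (O : set (R * R)) (good : set (R * R) -> Prop) : open O ->
  (forall x, O x -> exists2 r : R, 0 < r & forall k, (2 ^+ k)^-1 < r ->
     cellof k x `<=` O -> good (cellof k x)) ->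
  exists F : nat -> set (R * R),
    [/\ trivIset setT F, \bigcup_n F n = O &
        forall n, F n = set0 \/ exists k x, F n = cellof k x /\ good (F n)].
Proof.
move=> oO H; apply: dyadic_decomp => x Ox.
have [r r0 hr] := H x Ox; have [s s0 hs] := open_eps oO Ox.
have m0 : 0 < Num.min r s by rewrite lt_min r0.
have [k hk] := pow2_small m0.
have /hk : (k <= k)%N by [].
rewrite lt_min => /andP[kr ks]; exists k.
have sub : cellof k x `<=` O.
  by move=> y /cellof_small yx; apply: hs; exact: lt_trans ks.
by split=> //; exact: hr.
Qed.

(** Declaring every cell good exhibits an open set as a countable union of rectangles, hence as a
    member of the product sigma-algebra. *)
Lemma open_measurable2 (O : set (R * R)) : open O ->
  measurable (O : set (measurableTypeR R * measurableTypeR R)).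
Proof.
move=> oO; have [|F [_ <- hF]] := @dyadic_open O (fun=> True) oO.
  by move=> x _; exists 1.
apply: bigcupT_measurable => n; have [->|[k [x [-> _]]]] := hF n; first exact: measurable0.
exact: measurable_cellof.
Qed.

Lemma continuous_measurable2 (O : set (R * R)) (f : R * R -> R) : open O ->
  (forall x, O x -> {for x, continuous f}) ->
  measurable_fun (O : set (measurableTypeR R * measurableTypeR R)) f.
Proof.
move=> oO cf; apply: (measurability _ (measurable_realfun.RGenOpens.measurableE R)).
move=> _ [_ [a [b ->] <-]]; apply: open_measurable2.
rewrite openE => x [Ox fx]; rewrite /interior.
apply: filterI; first exact: open_nbhs_nbhs.
apply: (cf x Ox); exact: open_nbhs_nbhs.
Qed.
End Dyadic.

(** * Lebesgue measure of the plane under affine maps *)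

Section PlaneMeasure.
Variable R : realType.
Local Notation lam := (@lebesgue_measure R).
Local Notation T1 := (measurableTypeR R).
Local Notation mu := (@lebesgue_measure R \x @lebesgue_measure R)%E.

Lemma affine_preimage_itv (a c x y : R) : a != 0 ->
  (lam ((fun t => a * t + c)%R @^-1` `]x, y]) = (`|a|^-1)%:E * lam (`]x, y]%classic : set R))%E.
Proof.
move=> a0.
have [xy|yx] := ltP x y; last first.
  by rewrite set_itv_ge ?bnd_simp -?leNgt // preimage_set0 !measure0 mule0.
rewrite [in RHS]lebesgue_measure_itv /= lte_fin xy -EFinD -EFinM.
have [ap|an] : 0 < a \/ a < 0.
  by case: (ltgtP a 0) a0 => // h _; [right|left].
- have -> : (fun t => a * t + c) @^-1` `]x, y] = `](x - c) / a, (y - c) / a]%classic.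
    apply/seteqP; split=> t /=; rewrite !in_itv /= ltr_pdivrMr // ler_pdivlMr //;
    by rewrite ltrBlDr lerBrDr (mulrC t).
  rewrite lebesgue_measure_itv /= lte_fin ltr_pM2r ?invr_gt0 // ltrD2r xy -EFinD gtr0_norm //.
  by congr EFin; field; rewrite gt_eqF.
- have -> : (fun t => a * t + c) @^-1` `]x, y] = `[(y - c) / a, (x - c) / a[%classic.
    apply/seteqP; split=> t /=; rewrite !in_itv /= ltr_ndivlMr // ler_ndivrMr //;
    by rewrite ltrBlDr lerBrDr (mulrC t) andbC.
  rewrite lebesgue_measure_itv /= lte_fin ltr_nM2r ?invr_lt0 // ltrD2r xy -EFinD ltr0_norm //.
  by congr EFin; field; rewrite lt_eqF.
Qed.

Lemma affine_measurable (a c : R) : measurable_fun [set: T1] (fun t : T1 => a * t + c : T1).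
Proof.
apply: continuous_measurable_fun => x.
apply: continuousD; last exact: cvg_cst.
by apply: continuousM; [exact: cvg_cst|exact: cvg_id].
Qed.

(** Uniqueness of Lebesgue measure: [|a|] times the image measure takes the right values on
    half-open intervals. *)
Lemma affine_preimage (a c : R) (B : set T1) : a != 0 -> measurable B ->
  (lam ((fun t : T1 => a * t + c)%R @^-1` B) = (`|a|^-1)%:E * lam B)%E.
Proof.
move=> a0 mB.
have n0 : 0 <= `|a| by [].
pose f (t : T1) : T1 := a * t + c.
have mf : measurable_fun [set: T1] f := affine_measurable a c.
pose m0 := mscale (NngNum n0) (pushforward lam f); pose m' := m0 mf.
have Em (X : set T1) : m' X = (`|a|%:E * lam (f @^-1` X))%E by [].
have H : lam B = m' B.
  apply: (@lebesgue_measure_unique R m') => // X [[x y] _ <-].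
  have E := @affine_preimage_itv a c x y a0.
  rewrite -[RHS]/(`|a|%:E * lam (f @^-1` `]x, y]))%E E muleA -EFinM.
  by rewrite divff ?normr_eq0 // mul1e.
by rewrite H Em muleA -EFinM mulVf ?normr_eq0 // mul1e.
Qed.

Lemma lin_coord_measurable (p q b : R) :
  measurable_fun [set: T1 * T1] (fun z : T1 * T1 => p * z.1 + q * z.2 + b : T1).
Proof.
apply: measurable_funD; last exact: measurable_cst.
by apply: measurable_funD; apply: measurable_funM => //; exact: measurable_cst.
Qed.

Lemma lin_measurable (p q b r s c : R) :
  measurable_fun [set: T1 * T1] (fun z : T1 * T1 =>
    (p * z.1 + q * z.2 + b : T1, r * z.1 + s * z.2 + c : T1)).
Proof. by apply: measurable_fun_pair; exact: lin_coord_measurable. Qed.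

Lemma swap_preimage (B : set (T1 * T1)) : measurable B ->
  mu ((fun z : T1 * T1 => (z.2, z.1)) @^-1` B) = mu B.
Proof.
have mS : measurable_fun [set: T1 * T1] (fun z : T1 * T1 => (z.2, z.1)).
  by apply: measurable_fun_pair.
pose f (z : T1 * T1) : T1 * T1 := (z.2, z.1).
move=> mB; apply/esym.
apply: (@product_measure_unique _ _ _ _ R lam lam (pushforward mu f)) => // A C mA mC.
rewrite -[LHS]/(mu (f @^-1` (A `*` C))).
have -> : f @^-1` (A `*` C) = C `*` A by apply/seteqP; split=> -[x y] [/=].
by rewrite product_measure1E // muleC.
Qed.

Lemma shear_preimage (a c d : R) (B : set (T1 * T1)) : a != 0 -> measurable B ->
  (mu ((fun z : T1 * T1 => (z.1, c * z.1 + a * z.2 + d)%R) @^-1` B) = (`|a|^-1)%:E * mu B)%E.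
Proof.
move=> a0 mB; rewrite /product_measure1 -ge0_integralZl //; last first.
  exact: (@measurable_fun_xsection _ _ _ _ R lam).
apply: eq_integral => x _ /=.
rewrite -(@affine_preimage a (c * x + d)) //; last exact: measurable_xsection.
congr (lam _); apply/seteqP; split=> y /=; rewrite !xsectionP /=;
  have -> : c * x + a * y + d = a * y + (c * x + d) by ring.
all: by [].
Qed.

(** For [p != 0] the map is [F2] after [F1], each of which changes a single coordinate, with factors
    [p] and [(p * s - q * r) / p]. [F2] is a shear, covered by Fubini, and [F1] becomes one after
    swapping the coordinates. The case [p = 0] is reduced to this one by exchanging the two
    variables. *)
Lemma lin_preimage (p q b r s c : R) (B : set (T1 * T1)) :
  p * s - q * r != 0 -> measurable B ->
  (mu ((fun z : T1 * T1 => (p * z.1 + q * z.2 + b, r * z.1 + s * z.2 + c)%R) @^-1` B)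
   = (`|p * s - q * r|^-1)%:E * mu B)%E.
Proof.
move=> + mB; wlog p0 : p q r s / p != 0.
  move=> H; have [p0|p0] := eqVneq p 0; last exact: H.
  move=> d0; have q0 : q != 0.
    by apply: contra_neq d0 => ->; rewrite p0; ring.
  have d' : q * r - p * s != 0 by rewrite -oppr_eq0 opprB.
  rewrite -normrN opprB -(H q p s r q0 d').
  rewrite -[RHS]swap_preimage; last first.
    by rewrite -[X in measurable X]setTI; apply: lin_measurable.
  by congr (mu _); apply/seteqP; split=> z /=; rewrite (addrC (q * _)) (addrC (s * _)).
move=> d0.
have a0 : (p * s - q * r) / p != 0 by rewrite mulf_neq0 // invr_eq0.
pose F1 (z : T1 * T1) : T1 * T1 := (p * z.1 + q * z.2 + b, z.2).
pose F2 (z : T1 * T1) : T1 * T1 :=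
  (z.1, r / p * z.1 + (p * s - q * r) / p * z.2 + (c - r * b / p)).
have mF2 : measurable (F2 @^-1` B).
  rewrite -[X in measurable X]setTI.
  have := @lin_measurable 1 0 0 (r / p) ((p * s - q * r) / p) (c - r * b / p) _ _ mB.
  have -> : (fun z : T1 * T1 => (1 * z.1 + 0 * z.2 + 0 : T1,
      r / p * z.1 + (p * s - q * r) / p * z.2 + (c - r * b / p) : T1)) = F2.
    by apply/funext => z; rewrite /F2 mul1r mul0r !addr0.
  by apply.
have E1 : (mu (F1 @^-1` (F2 @^-1` B)) = (`|p|^-1)%:E * mu (F2 @^-1` B))%E.
  pose Sw (z : T1 * T1) : T1 * T1 := (z.2, z.1).
  have mSw : measurable (Sw @^-1` (F2 @^-1` B)).
    rewrite -[X in measurable X]setTI.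
    have := @measurable_swap _ _ T1 T1 measurableT _ mF2; rewrite setTI => H.
    exact: H.
  have := @shear_preimage p q b _ p0 mSw.
  rewrite (swap_preimage mF2) => <-.
  set G := (fun _ => _).
  have mG : measurable (G @^-1` (Sw @^-1` (F2 @^-1` B))).
    rewrite -[X in measurable X]setTI.
    have := @lin_measurable 1 0 0 q p b _ _ mSw.
    have -> : (fun z : T1 * T1 => (1 * z.1 + 0 * z.2 + 0 : T1, q * z.1 + p * z.2 + b : T1)) = G.
      by apply/funext => z; rewrite /G mul1r mul0r !addr0.
    by apply.
  rewrite -(swap_preimage mG); congr (mu _); apply/seteqP; split=> z;
    by rewrite /F1 /G /Sw /= (addrC (q * _)).
transitivity (mu (F1 @^-1` (F2 @^-1` B))).
  have E (z : T1 * T1) : F2 (F1 z) = (p * z.1 + q * z.2 + b, r * z.1 + s * z.2 + c).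
    by rewrite /F2 /F1 /=; congr (_, _); field.
  by congr (mu _); apply/seteqP; split=> z; rewrite /= E.
rewrite E1 (@shear_preimage _ (r / p) (c - r * b / p)) //.
rewrite muleA -EFinM; congr (_%:E * _)%E.
rewrite normrM normfV invfM invrK mulrA mulrAC mulVf ?normr_eq0 //.
by rewrite mul1r.
Qed.
End PlaneMeasure.

(** * Comparison of weighted integrals under a homeomorphism with approximate differentials *)

Section Distortion.
Variable R : realType.
Local Notation lam := (@lebesgue_measure R).
Local Notation T1 := (measurableTypeR R).
Local Notation mu := (@lebesgue_measure R \x @lebesgue_measure R)%E.

Lemma preimage_cell_measurable (O : set (R * R)) (S : R * R -> R * R) k x : open O ->
  (forall y, O y -> {for y, continuous S}) ->
  measurable (O `&` S @^-1` cellof k x : set (T1 * T1)).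
Proof.
move=> oO cS; rewrite cellof_box; set A := `[_, _[%classic; set B := `[_, _[%classic.
have -> : O `&` S @^-1` (A `*` B) = (O `&` (fst \o S) @^-1` A) `&` (O `&` (snd \o S) @^-1` B).
  by apply/seteqP; split=> y /=; tauto.
have mO := open_measurable2 oO.
have c1 y : O y -> {for y, continuous (fst \o S : R * R -> R)}.
  by move=> Oy; apply: (@continuous_comp _ _ _ S fst); [exact: cS|exact: cvg_fst].
have c2 y : O y -> {for y, continuous (snd \o S : R * R -> R)}.
  by move=> Oy; apply: (@continuous_comp _ _ _ S snd); [exact: cS|exact: cvg_snd].
have m1 := continuous_measurable2 oO c1; have m2 := continuous_measurable2 oO c2.
by apply: measurableI; [apply: m1 mO _ _|apply: m2 mO _ _]; exact: measurable_itv.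
Qed.

Lemma box_measure (a b l : R) : 0 <= l ->
  mu (`[a, a + l] `*` `[b, b + l] : set (T1 * T1)) = (l ^+ 2)%:E.
Proof.
move=> l0.
have := @product_measure1E _ _ T1 T1 R lam lam _ _ (measurable_itv `[a, a + l]) (measurable_itv `[b, b + l]).
move=> /= ->; rewrite !lebesgue_measure_itv /= !lte_fin !ltrDl.
case: ltP => l1; last by have -> : l = 0; [lra|rewrite expr0n mule0].
by rewrite -!EFinD -EFinM expr2; congr EFin; ring.
Qed.

Lemma cell_measure k x : mu (cellof k x) = ((2 ^- k) ^+ 2 : R)%:E.
Proof.
rewrite cellof_box; set a := _ / _; set b := (X in _ `*` `[X, _[); set l := _ ^-1.
have l0 : 0 < l by rewrite invr_gt0 exprn_gt0.
have := @product_measure1E _ _ T1 T1 R lam lam _ _ (measurable_itv `[a, a + l[) (measurable_itv `[b, b + l[).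
move=> /= ->; rewrite !lebesgue_measure_itv /= !lte_fin !ltrDl l0.
by rewrite -!EFinD -EFinM expr2; congr EFin; ring.
Qed.

Let box_aux (p q a1 a2 y z1 z2 w A l e : R) : A <= w -> w < A + l ->
  - (e * l) <= p * (z1 - a1) + q * (z2 - a2) - (w - y) ->
  p * (z1 - a1) + q * (z2 - a2) - (w - y) <= e * l ->
  p * z1 + q * z2 + (y - p * a1 - q * a2) \in `[A - e * l, A - e * l + (1 + 2 * e) * l].
Proof.
move=> h1 h2 h3 h4; rewrite in_itv /=.
have E : p * (z1 - a1) + q * (z2 - a2) - (w - y) =
  p * z1 + q * z2 + (y - p * a1 - q * a2) - w by ring.
rewrite E in h3 h4; move: h3 h4; set t := p * z1 + _ => h3 h4.
have -> : A - e * l + (1 + 2 * e) * l = A + l + e * l by ring.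
by apply/andP; split; lra.
Qed.

Section Bound.
Variables (O O' : set (R * R)) (T S : R * R -> R * R) (rho1 rho2 : R * R -> R).
Variable theta : R.
Hypotheses (oO : open O) (oO' : open O').
Hypotheses (TO : forall x, O x -> O' (T x)) (ST : forall x, O x -> S (T x) = x).
Hypotheses (SO : forall y, O' y -> O (S y)) (TS : forall y, O' y -> T (S y) = y).
Hypotheses (cT : forall x, O x -> {for x, continuous T}).
Hypotheses (cS : forall y, O' y -> {for y, continuous S}).
Hypotheses (c1 : forall x, O x -> {for x, continuous rho1}).
Hypotheses (c2 : forall y, O' y -> {for y, continuous rho2}).
Hypotheses (p1 : forall x, O x -> 0 <= rho1 x) (p2 : forall y, O' y -> 0 <= rho2 y).
Hypothesis theta0 : 0 < theta.
(* [(p, q; r, s)] is an approximate inverse of the differential of [T] at [x]. *)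
Hypothesis loc : forall x, O x -> exists p q r s e : R,
  [/\ p * s - q * r != 0, 0 <= e,
      rho2 (T x) * (1 + 2 * e) ^+ 2 < theta * rho1 x * `|p * s - q * r| &
      exists2 d, 0 < d & forall y, O y -> `|y - x| < d ->
       `|(p * ((T y).1 - (T x).1) + q * ((T y).2 - (T x).2),
          r * ((T y).1 - (T x).1) + s * ((T y).2 - (T x).2)) - (y - x)| <= e * `|y - x|].

(** If [S z] lies in a cell of side [l] around [x], the affine approximate inverse of [T] sends [z]
    into that cell enlarged by [e * l] on each side. So the image of the cell has area at most
    [((1 + 2 * e) * l) ^+ 2 / |D|]. Only this upper bound is needed, and nothing has to be known
    about which part of the enlarged box is filled. *)
Lemma distortion_cell x : O x -> exists2 d : R, 0 < d & forall k, 2 ^- k < d ->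
  cellof k x `<=` O ->
  (\int[mu]_(u in O' `&` S @^-1` cellof k x) (rho2 u)%:E <=
   theta%:E * \int[mu]_(u in cellof k x) (rho1 u)%:E)%E.
Proof.
move=> Ox; have [p [q [r [s [e [D0 e0 lt_ [d d0 hd]]]]]]] := loc Ox.
set D := p * s - q * r in D0 lt_.
have Dp : 0 < `|D| by rewrite normr_gt0.
set E := (1 + 2 * e) ^+ 2 in lt_.
have E0 : 0 < E by rewrite exprn_gt0 // ltr_wpDr // mulr_ge0.
(* The strict inequality in [loc] leaves room to vary both densities by [h]; the witness is the
   value for which equality is reached. *)
have [h h0 hh] : exists2 h, 0 < h & (rho2 (T x) + h) * E <= theta * (rho1 x - h) * `|D|.
  exists ((theta * rho1 x * `|D| - rho2 (T x) * E) / (E + theta * `|D|)).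
    by rewrite divr_gt0 ?subr_gt0 // addr_gt0 // mulr_gt0.
  rewrite -subr_ge0; set A := _ / _.
  have AE : A * (E + theta * `|D|) = theta * rho1 x * `|D| - rho2 (T x) * E.
    by rewrite /A divfK // gt_eqF // addr_gt0 // mulr_gt0.
  have -> : theta * (rho1 x - A) * `|D| - (rho2 (T x) + A) * E =
    theta * rho1 x * `|D| - rho2 (T x) * E - A * (E + theta * `|D|) by ring.
  by rewrite AE subrr.
have /cts_eps /(_ h h0)[d1 d10 hd1] := c1 Ox.
have cc : {for x, continuous (rho2 \o T)}.
  by apply: continuous_comp; [exact: cT|apply: c2; exact: TO].
have /cts_eps /(_ h h0)[d2 d20 hd2] := cc.
exists (Num.min d (Num.min d1 d2)) => [|k]; first by rewrite !lt_min d0 d10.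
rewrite !lt_min => /andP[kd /andP[kd1 kd2]] kO.
set l : R := 2 ^- k in kd kd1 kd2 *.
have l0 : 0 < l by rewrite invr_gt0 exprn_gt0.
set C := cellof k x; set C' := O' `&` _.
have mC : measurable (C : set (T1 * T1)) by exact: measurable_cellof.
have mC' : measurable (C' : set (T1 * T1)) by exact: preimage_cell_measurable.
have near y : C y -> `|y - x| < l by exact: cellof_small.
have rho1b y : C y -> rho1 x - h <= rho1 y.
  move=> Cy; have := hd1 y (lt_trans (near _ Cy) kd1).
  by rewrite ler_norml => /andP[+ _]; lra.
have rho2b z : C' z -> rho2 z <= rho2 (T x) + h.
  move=> [Vz Cz]; have := hd2 (S z) (lt_trans (near _ Cz) kd2).
  by rewrite /= TS // ler_norml => /andP[_ +]; lra.
have R2 : 0 <= rho2 (T x) + h by rewrite addr_ge0 ?p2 ?ltW //; exact: TO.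
have R1 : 0 <= rho1 x - h.
  have : 0 <= theta * (rho1 x - h) * `|D| by apply: le_trans hh; rewrite mulr_ge0 // ltW.
  by rewrite pmulr_lge0 // pmulr_rge0.
have mr1 : measurable_fun (C : set (T1 * T1)) (fun u => (rho1 u)%:E).
  apply/measurable_EFinP; apply: (@measurable_funS _ _ _ _ O) => //.
    exact: open_measurable2.
  exact: continuous_measurable2.
have mr2 : measurable_fun (C' : set (T1 * T1)) (fun u => (rho2 u)%:E).
  apply/measurable_EFinP; apply: (@measurable_funS _ _ _ _ O') => //.
  - exact: open_measurable2.
  - by move=> y [].
  - exact: continuous_measurable2.
have I1 : (((rho1 x - h) * l ^+ 2)%:E <= \int[mu]_(u in C) (rho1 u)%:E)%E.
  rewrite EFinM -[X in (_ * X)%E](cell_measure k x) -integral_cst //.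
  by apply: ge0_le_integral.
have muC' : (mu C' <= (`|D|^-1 * ((1 + 2 * e) * l) ^+ 2)%:E)%E.
  have := cellof_refl k x; rewrite -/C.
  have CE := cellof_box k x; rewrite -/C -/l in CE.
  set a := (X in _ = `[X, _[ `*` _) in CE; set b := (X in _ = _ `*` `[X, _[) in CE.
  pose B : set (T1 * T1) := `[a - e * l, a - e * l + (1 + 2 * e) * l] `*`
     `[b - e * l, b - e * l + (1 + 2 * e) * l].
  have mB : measurable B by apply: measurableX; exact: measurable_itv.
  pose f (z : T1 * T1) : T1 * T1 := (p * z.1 + q * z.2 + (x.1 - p * (T x).1 - q * (T x).2),
       r * z.1 + s * z.2 + (x.2 - r * (T x).1 - s * (T x).2)).
  have mf : measurable (f @^-1` B).
    by rewrite -[X in measurable X]setTI; exact: lin_measurable.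
  have := lin_preimage (x.1 - p * (T x).1 - q * (T x).2)
    (x.2 - r * (T x).1 - s * (T x).2) D0 mB.
  rewrite -/f -/D box_measure; last first.
    by rewrite mulr_ge0 // ?ltW // ltr_wpDr // mulr_ge0.
  rewrite -EFinM => <- Cx; apply: le_measure; rewrite ?inE //.
  move=> z [Vz Cz]; have yx := near _ Cz.
  have := hd (S z) (SO Vz) (lt_trans yx kd); rewrite TS //.
  move=> /le_trans /(_ (ler_wpM2l e0 (ltW yx))).
  rewrite prod_normE ge_max /= !ler_norml => /andP[/andP[u1 u2] /andP[u3 u4]].
  move: Cz; rewrite /= CE /= !in_itv /= => -[/andP[v1 v2] /andP[v3 v4]].
  split; [exact: (box_aux v1 v2 u1 u2)|exact: (box_aux v3 v4 u3 u4)].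
have I2 : (\int[mu]_(u in C') (rho2 u)%:E <=
    ((rho2 (T x) + h) * (`|D|^-1 * ((1 + 2 * e) * l) ^+ 2))%:E)%E.
  apply: (@le_trans _ _ (\int[mu]_(u in C') (cst (rho2 (T x) + h)%:E u))%E).
    apply: ge0_le_integral => //.
    by move=> z [Vz _]; rewrite lee_fin p2.
  rewrite integral_cst // EFinM; exact: lee_wpmul2l.
apply: le_trans I2 _; apply: le_trans (lee_wpmul2l _ I1); last by rewrite lee_fin ltW.
rewrite -EFinM lee_fin exprMn -/E.
have -> : (rho2 (T x) + h) * (`|D|^-1 * (E * l ^+ 2)) =
   ((rho2 (T x) + h) * E) * (`|D|^-1 * l ^+ 2) by ring.
have -> : theta * ((rho1 x - h) * l ^+ 2) =
   (theta * (rho1 x - h) * `|D|) * (`|D|^-1 * l ^+ 2) by field; rewrite gt_eqF.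
by rewrite ler_wpM2r // mulr_ge0 // ?invr_ge0 // exprn_ge0 // ltW.
Qed.

Lemma distortion : (\int[mu]_(u in O') (rho2 u)%:E <=
   theta%:E * \int[mu]_(u in O) (rho1 u)%:E)%E.
Proof.
have mO := open_measurable2 oO; have mO' := open_measurable2 oO'.
have [F [tF OF hF]] := @dyadic_open R O (fun C =>
  (\int[mu]_(u in O' `&` S @^-1` C) (rho2 u)%:E <=
   theta%:E * \int[mu]_(u in C) (rho1 u)%:E)%E) oO distortion_cell.
have mF n : measurable (F n : set (T1 * T1)).
  by have [->|[k [x [-> _]]]] := hF n; [exact: measurable0|exact: measurable_cellof].
pose G n := O' `&` S @^-1` F n.
have mG n : measurable (G n : set (T1 * T1)).
  rewrite /G; have [->|[k [x [-> _]]]] := hF n.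
    by rewrite preimage_set0 setI0; exact: measurable0.
  exact: preimage_cell_measurable.
have GO' : O' = \bigcup_n G n.
  apply/seteqP; split=> [y Vy|y [n _ []] //].
  by have := SO Vy; rewrite -OF => -[n _ Fn]; exists n.
have tG : trivIset setT G.
  apply/trivIsetP => i j _ _ ij; apply/seteqP; split=> y // [[_ Fi] [_ Fj]].
  by move/trivIsetP : tF => /(_ i j Logic.I Logic.I ij) E; rewrite -[set0 y]/((set0 : set (R * R)) (S y)) -E.
have fin n : (\int[mu]_(u in G n) (rho2 u)%:E <=
   theta%:E * \int[mu]_(u in F n) (rho1 u)%:E)%E.
  rewrite /G; have [->|[k [x [-> ]]] //] := hF n.
  by rewrite preimage_set0 setI0 !integral_set0 mule0.
have mr1 : measurable_fun (O : set (T1 * T1)) (fun u => (rho1 u)%:E).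
  by apply/measurable_EFinP; exact: continuous_measurable2.
have mr2 : measurable_fun (O' : set (T1 * T1)) (fun u => (rho2 u)%:E).
  by apply/measurable_EFinP; exact: continuous_measurable2.
have FO n u : F n u -> O u by move=> Fn; rewrite -OF; exists n.
rewrite [X in (X <= _)%E](_ : _ = \sum_(0 <= n <oo) \int[mu]_(u in G n) (rho2 u)%:E)%E; last first.
  by rewrite GO'; apply: ge0_integral_bigcup => //; rewrite -GO'.
rewrite [X in (_ <= _ * X)%E](_ : _ = \sum_(0 <= n <oo) \int[mu]_(u in F n) (rho1 u)%:E)%E; last first.
  by rewrite -OF; apply: ge0_integral_bigcup => //; rewrite OF.
rewrite -nneseriesZl; last first.
  by move=> n _; apply: integral_ge0 => u /FO Ou; rewrite lee_fin p1.
apply: lee_nneseries => n // _ _; apply: integral_ge0 => u [Vu _].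
by rewrite lee_fin p2.
Qed.

End Bound.
End Distortion.

(** * Planar flows *)

Section Picard.
Variable R : realType.
Implicit Types (f g F : R -> R * R).

Definition is_derive2 (t : R) f (v : R * R) :=
  is_derive t 1 (fst \o f) v.1 /\ is_derive t 1 (snd \o f) v.2.

Lemma cts_pair (V : normedModType R) (f : V -> R * R) u :
  {for u, continuous (fst \o f)} -> {for u, continuous (snd \o f)} ->
  {for u, continuous f}.
Proof.
move=> /cts_eps h1 /cts_eps h2; apply/cts_eps => e e0.
have [r r0 hr] := h1 e e0; have [s s0 hs] := h2 e e0.
exists (Num.min r s) => [|a]; first by rewrite lt_min r0.
rewrite lt_min => /andP[/hr a1 /hs a2].
by rewrite prod_normE ge_max; apply/andP.
Qed.

Lemma mvt_bound2 (f df : R -> R * R) (a b M s t : R) : a <= s <= b -> a <= t <= b ->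
  (forall t, a <= t <= b -> is_derive2 t f (df t)) ->
  (forall t, a <= t <= b -> `|df t| <= M) ->
  `|f t - f s| <= M * `|t - s|.
Proof.
move=> sab tab h hM; rewrite prod_normE ge_max /=; apply/andP; split.
  apply: (@mvt_bound R (fst \o f) (fst \o df) a b) => // u uab; first by have [] := h u uab.
  exact: le_trans (norm_fst _) (hM u uab).
apply: (@mvt_bound R (snd \o f) (snd \o df) a b) => // u uab; first by have [] := h u uab.
exact: le_trans (norm_snd _) (hM u uab).
Qed.

Lemma primitive (g : R -> R) (T : R) : 0 < T -> continuous g ->
  exists2 F : R -> R, F 0 = 0 & forall t : R, `|t| < T -> is_derive t 1 F (g t).
Proof.
move=> T0 cg.
pose G x := \int[@lebesgue_measure R]_(t in `[- T, x]) g t.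
exists (fun x => G x - G 0) => [|t]; first by rewrite subrr.
rewrite ltr_norml => /andP[t1 t2].
have intg : (@lebesgue_measure R).-integrable `[- T, T] (EFin \o g).
  apply: continuous_compact_integrable; first exact: segment_compact.
  exact: continuous_subspaceT.
have [dG vG] := continuous_FTC1_closed t2 intg t1 (cg t).
have H : is_derive t 1 G (g t) by rewrite -vG derive1E; exact: derivableP.
by apply: is_derive_eq; rewrite subr0.
Qed.

Lemma primitive2 g (T : R) : 0 < T -> continuous (fst \o g) -> continuous (snd \o g) ->
  exists2 F, F 0 = 0 & forall t : R, `|t| < T -> is_derive2 t F (g t).
Proof.
move=> T0 /(primitive T0)[F1 F10 h1] /(primitive T0)[F2 F20 h2].
by exists (fun t => (F1 t, F2 t)) => [|t tT]; [rewrite F10 F20|split; [exact: h1|exact: h2]].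
Qed.

(** With [v n] the tail of the geometric series, the intervals from [u n - v n] to [u n + v n] are
    nested, and the supremum of their left ends lies in all of them. *)
Lemma geometric_limit (u : nat -> R) (C : R) :
  (forall n, `|u n.+1 - u n| <= C * 2 ^- n) ->
  exists l, forall n, `|u n - l| <= 2 * C * 2 ^- n.
Proof.
move=> h; pose v n := 2 * C * 2 ^- n.
have half n : v n.+1 = v n - C * 2 ^- n.
  by rewrite /v exprS invfM; field; rewrite expf_neq0.
have lo n : u n - v n <= u n.+1 - v n.+1.
  by rewrite half; have := h n; rewrite ler_norml => /andP[+ _]; lra.
have hi n : u n.+1 + v n.+1 <= u n + v n.
  by rewrite half; have := h n; rewrite ler_norml => /andP[_ +]; lra.
have C0 : 0 <= C.
  by have := h 0%N; rewrite expr0 invr1 mulr1; apply: le_trans.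
have v0 n : 0 <= v n by rewrite /v !mulr_ge0 // invr_ge0 exprn_ge0.
have los m n : (m <= n)%N -> u m - v m <= u n - v n.
  by apply: (homo_leq (r := fun x y => x <= y) (f := fun n => u n - v n)) => // x y z; exact: le_trans.
have his m n : (m <= n)%N -> u n + v n <= u m + v m.
  by apply: (homo_leq (r := fun x y => y <= x) (f := fun n => u n + v n)) => // x y z xy yz; exact: le_trans yz xy.
pose A := [set x | exists n, x = u n - v n].
have ub n : ubound A (u n + v n).
  move=> _ [m ->]; case: (leqP m n) => [/los|/ltnW/his] H.
    by apply: le_trans H _; rewrite lerD2l; have := v0 n; lra.
  by apply: le_trans H; rewrite lerD2l; have := v0 m; lra.
have sA : has_sup A by split; [exists (u 0%N - v 0%N), 0%N|exists (u 0%N + v 0%N)].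
exists (sup A) => n; rewrite ler_norml.
have h1 : u n - v n <= sup A by apply: sup_upper_bound => //; exists n.
have h2 : sup A <= u n + v n by apply: ge_sup => //; exists (u 0%N - v 0%N), 0%N.
by apply/andP; rewrite -/(v n); split; lra.
Qed.

Lemma geometric_limit2 (u : nat -> R * R) (C : R) :
  (forall n, `|u n.+1 - u n| <= C * 2 ^- n) ->
  exists l, forall n, `|u n - l| <= 2 * C * 2 ^- n.
Proof.
move=> h.
have [|l1 h1] := @geometric_limit (fun n => (u n).1) C.
  by move=> n; apply: le_trans (h n); exact: (norm_fst (u n.+1 - u n)).
have [|l2 h2] := @geometric_limit (fun n => (u n).2) C.
  by move=> n; apply: le_trans (h n); exact: (norm_snd (u n.+1 - u n)).
by exists (l1, l2) => n; rewrite prod_normE ge_max; apply/andP; split; [exact: h1|exact: h2].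
Qed.

(** The projection of the line onto a segment. It extends data from the segment to the whole line
    without increasing Lipschitz constants. *)
Definition clamp (a b t : R) := Num.max a (Num.min b t).

Lemma clamp_itv a b t : a <= b -> a <= clamp a b t <= b.
Proof. by move=> ab; rewrite le_max lexx ge_max ab ge_min lexx. Qed.

Lemma clamp_id a b t : a <= t <= b -> clamp a b t = t.
Proof. by move=> /andP[at_ tb]; rewrite /clamp min_r // max_r. Qed.

Lemma clamp_lip a b s t : `|clamp a b s - clamp a b t| <= `|s - t|.
Proof.
wlog st : s t / t <= s.
  by move=> H; case: (leP t s) => [|/ltW] /H //; rewrite distrC (distrC s).
have mono : clamp a b t <= clamp a b s.
  have mm : Num.min b t <= Num.min b s by rewrite le_min !ge_min lexx st orbT.
  by rewrite /clamp ge_max !le_max lexx mm orbT.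
rewrite !ger0_norm ?subr_ge0 //.
rewrite /clamp; case: (leP b s) => bs; case: (leP b t) => bt.
all: repeat match goal with |- context [Num.max ?x ?y] => case: (leP x y) => ? end; lra.
Qed.

Section GlobalLipschitz.
Variables (w : R * R -> R * R) (L B tau : R).
Hypotheses (L0 : 0 < L) (wL : forall a b, `|w a - w b| <= L * `|a - b|).
Hypotheses (wB : forall a, `|w a| <= B) (tau0 : 0 < tau) (tauL : L * tau <= 2^-1).

Let contw f : continuous f -> continuous (w \o f).
Proof.
move=> cf t; apply: continuous_comp; first exact: cf.
apply/cts_eps => e e0; exists (e / L) => [|a ae]; first by rewrite divr_gt0.
by apply: le_trans (wL _ _) _; rewrite -ler_pdivlMl // mulrC ltW.
Qed.

Let ct (t : R) := clamp (- tau) tau t.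
Let ct_itv (t : R) : - tau <= ct t <= tau.
Proof. by apply: clamp_itv; rewrite ge0_cp // ltW. Qed.
Let itv_lt (t : R) : - tau <= t <= tau -> `|t| < 2 * tau.
Proof.
rewrite ltr_norml => /andP[t1 t2]; have T : tau < 2 * tau by rewrite ltr_pMl // ltr1n.
by apply/andP; split; [apply: lt_le_trans t1; rewrite ltrN2|exact: le_lt_trans T].
Qed.
Let zero_itv : - tau <= (0 : R) <= tau.
Proof. by rewrite oppr_le0 ltW. Qed.
Let ct0 : ct 0 = 0.
Proof. exact: clamp_id. Qed.

(** Differentiability is asked on an interval twice as long as needed, so that the end points of the
    segment from [- tau] to [tau] are interior. *)
Let P g F := F 0 = 0 /\ forall t : R, `|t| < 2 * tau -> is_derive2 t F (g t).

Let P_bound g F M (t : R) : P g F -> (forall t : R, - tau <= t <= tau -> `|g t| <= M) ->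
  - tau <= t <= tau -> `|F t| <= M * tau.
Proof.
move=> [F0 hF] gM ht.
have := @mvt_bound2 F g (- tau) tau M 0 t zero_itv ht _ gM.
rewrite F0 !subr0 => H; apply: le_trans (H _) _.
  by move=> u /itv_lt; exact: hF.
have M0 : 0 <= M by apply: le_trans (gM _ zero_itv).
by rewrite ler_wpM2l // ler_norml.
Qed.

Let P_cont g F x : P g F -> continuous (fun t => x + F (ct t)).
Proof.
move=> [_ hF] t.
apply: (@continuousD _ _ _ (fun=> x) (F \o ct)); first exact: cvg_cst.
apply: continuous_comp.
  apply/cts_eps => e e0; exists e => // a ae; apply: le_trans (ltW ae); exact: clamp_lip.
have [d1 d2] := hF _ (itv_lt (ct_itv t)).
have c1 : {for ct t, continuous (fst \o F)}.
  by apply: differentiable_continuous; apply/derivable1_diffP; exact: ex_derive.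
have c2 : {for ct t, continuous (snd \o F)}.
  by apply: differentiable_continuous; apply/derivable1_diffP; exact: ex_derive.
exact: cts_pair.
Qed.

Let ex_P g : exists F, continuous g -> P g F.
Proof.
case: (pselect (continuous g)) => [cg|]; last by exists (fun=> 0).
have T0 : 0 < 2 * tau by rewrite mulr_gt0.
have [||F F0 hF] := @primitive2 g _ T0.
- by move=> t; apply: continuous_comp; [exact: cg|exact: cvg_fst].
- by move=> t; apply: continuous_comp; [exact: cg|exact: cvg_snd].
- by exists F => _; split.
Qed.

(** Picard iteration, where [tauL] makes each step halve the distance of consecutive iterates.
    Evaluating the primitives at the clamped time keeps all iterates continuous on the whole line,
    so the operator can be repeated without restricting functions to a segment. *)
Lemma picard_global x : exists f, [/\ f 0 = x, continuous f,
  (forall t : R, - tau <= t <= tau -> `|f t - x| <= B * tau) &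
  forall t : R, `|t| < tau -> is_derive2 t f (w (f t))].
Proof.
have [Pr hPr] := choice ex_P.
pose f_ := fix f_ n := if n is n'.+1 then (fun t => x + Pr (w \o f_ n') (ct t)) else (fun=> x).
have cf n : continuous (f_ n).
  by elim: n => [|n IH]; [move=> t; exact: cvg_cst|apply: P_cont (hPr _ (contw IH))].
have PF n : P (w \o f_ n) (Pr (w \o f_ n)) by apply: hPr; exact: contw.
have B0 : 0 <= B by apply: le_trans (wB 0).
have PB2 g F g' F' M (t : R) : P g F -> P g' F' -> (forall t, `|g t - g' t| <= M) ->
    - tau <= t <= tau -> `|F t - F' t| <= M * tau.
  move=> [F0 hF] [F'0 hF'] gM ht.
  apply: (@P_bound (fun t => g t - g' t) (fun t => F t - F' t)) => //.
  split; first by rewrite F0 F'0 subrr.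
  move=> s hs; have [a1 a2] := hF s hs; have [b1 b2] := hF' s hs.
  by split; [exact: (is_deriveB a1 b1)|exact: (is_deriveB a2 b2)].
have LM M : 0 <= M -> L * M * tau <= M / 2.
  by move=> M0; rewrite mulrAC (mulrC M) ler_wpM2r.
have step n t : `|f_ n.+1 t - f_ n t| <= B * tau * 2 ^- n.
  elim: n t => [|n IH] t.
    rewrite expr0 invr1 mulr1 /= addrAC subrr add0r.
    by apply: (P_bound (PF 0%N)) (ct_itv t) => s _; exact: wB.
  rewrite /= opprD addrACA subrr add0r.
  apply: le_trans (PB2 _ _ _ _ (L * (B * tau * 2 ^- n)) _ (PF n.+1) (PF n) _ (ct_itv t)) _.
    by move=> s; apply: le_trans (wL _ _) _; rewrite ler_wpM2l ?(ltW L0) //; exact: IH.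
  apply: le_trans (LM _ _) _.
    by rewrite !mulr_ge0 ?(ltW tau0) // invr_ge0 exprn_ge0.
  by rewrite exprS invfM mulrA mulrAC.
have [f hf] := choice (fun t => geometric_limit2 (fun n => step n t)).
pose C := 2 * (B * tau).
have C0 : 0 <= C by rewrite !mulr_ge0 // ltW.
have small (e : R) : 0 < e -> exists n, C * 2 ^- n <= e.
  move=> e0; have [k hk] := pow2_small (divr_gt0 e0 (ltr_wpDl C0 ltr01)).
  exists k; have /ltW H := hk k (leqnn k).
  apply: le_trans (ler_wpM2l C0 H) _; rewrite mulrA ler_pdivrMr ?ltr_wpDl //.
  by rewrite mulrDr mulr1 mulrC lerDl ltW.
have cfl : continuous f.
  move=> t; apply/cts_eps => e e0; have e30 : 0 < e / 3 by rewrite divr_gt0.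
  have [n hn] := small _ e30.
  have /cts_eps /(_ _ e30)[r r0 hr] := cf n t.
  exists r => // a ar.
  apply: le_trans (ler_distD (f_ n a) _ _) _.
  have h2 := ler_distD (f_ n t) (f_ n a) (f t).
  have := hf t n; have := hf a n; rewrite (distrC (f_ n a) (f a)).
  have := hr a ar; rewrite -/C; move: hn h2; clear.
  move: `|f a - f_ n a| `|f_ n a - f t| `|f_ n a - f_ n t| `|f_ n t - f t| (C / 2 ^+ n).
  by move=> *; lra.
have f0 (t : R) : - tau <= t <= tau -> f t = x + Pr (w \o f) t.
  move=> ht; have Pf := hPr _ (contw cfl).
  apply/eqP; rewrite -subr_eq0 -normr_eq0; apply/eqP/le_anti/andP; split=> //.
  apply/ler_addgt0Pr => e e0; rewrite add0r.
  have e20 : 0 < e / 2 by rewrite divr_gt0.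
  have [n hn] := small _ e20.
  have h1 := hf t n.+1.
  have := PB2 _ _ _ _ (L * (C * 2 ^- n)) _ (PF n) Pf _ ht.
  move=> /(_ (fun s => le_trans (wL _ _) (ler_wpM2l (ltW L0) (hf s n)))) h2.
  have C2 : 0 <= C / 2 ^+ n by rewrite mulr_ge0 // invr_ge0 exprn_ge0.
  have h3 := le_trans h2 (LM _ C2).
  have E : f_ n.+1 t = x + Pr (w \o f_ n) t by rewrite /= /ct clamp_id.
  apply: le_trans (ler_distD (f_ n.+1 t) _ _) _; rewrite (distrC (f t)).
  have -> : f_ n.+1 t - (x + Pr (w \o f) t) = Pr (w \o f_ n) t - Pr (w \o f) t.
    by rewrite E opprD addrACA subrr add0r.
  have : C * 2 ^- n.+1 = C * 2 ^- n / 2 by rewrite exprS invfM; ring.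
  rewrite -/C in h1; move: h1 h3 hn e0; clear; set p := C / 2 ^+ n; set p' := C / 2 ^+ n.+1.
  move: `|f_ n.+1 t - f t| `|Pr (w \o f_ n) t - Pr (w \o f) t| p p'.
  by move=> *; lra.
exists f; split=> //.
- by rewrite f0 ?(hPr _ (contw cfl)).1 ?addr0 //; exact: zero_itv.
- move=> t ht; rewrite f0 // addrAC subrr add0r.
  by apply: (P_bound (hPr _ (contw cfl))) ht => s _; exact: wB.
- move=> t tt; have [Pf hd] := hPr _ (contw cfl).
  have [|d1 d2] := hd t; first by apply: lt_trans tt _; rewrite ltr_pMl // ltr1n.
  have nt : \forall s \near t, f s = x + Pr (w \o f) s.
    have [r r0 hr] : exists2 r : R, 0 < r & forall s, `|s - t| < r -> `|s| < tau.
      exists (tau - `|t|) => [|s st]; first by rewrite subr_gt0.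
      have := ler_distD t s 0; rewrite !subr0; move: st.
      by move: `|s - t| `|s| `|t| => *; lra.
    apply/nbhs_normP; exists r => // s /=; rewrite distrC => /hr; rewrite ltr_norml => /andP[s1 s2].
    by apply: f0; rewrite !ltW.
  split.
    apply: (@near_eq_is_derive _ _ _ (fun s => x.1 + (fst \o Pr (w \o f)) s)) => //.
      near=> s. rewrite /= (near nt s) //.
    by have := @is_deriveD _ _ _ (fun=> x.1) _ _ _ _ _ (is_derive_cst _ _ _) d1; rewrite add0r.
  apply: (@near_eq_is_derive _ _ _ (fun s => x.2 + (snd \o Pr (w \o f)) s)) => //.
    near=> s. rewrite /= (near nt s) //.
  by have := @is_deriveD _ _ _ (fun=> x.2) _ _ _ _ _ (is_derive_cst _ _ _) d2; rewrite add0r.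
Unshelve. all: by end_near. Qed.
End GlobalLipschitz.
End Picard.

(** * Local flow of a planar field and its effect on weighted area *)

Section LocalFlow.
Variable R : realType.
Implicit Types (x y z : R * R) (h t : R).

(** The arithmetic of infinitesimal expansion. [q] stands for the derivative of the density along
    the field and [tr] for the divergence of the field, so the hypothesis bounds the divergence of
    the product from below. [rhoT] and [d] stand for the density and the Jacobian after flowing
    backwards for time [h], and [e] for the error of the linearisation. Half of [delta] pays for all
    errors. *)
Lemma contraction_factor (rho0 q tr delta : R) : 0 < rho0 -> 0 < delta ->
  delta * rho0 <= q + rho0 * tr ->
  exists2 eta : R, 0 < eta <= 1 & exists2 tau : R, 0 < tau &
  forall h rhox rhoT d e : R, 0 < h < tau -> `|rhox - rho0| <= eta ->
    0 <= rhoT -> rhoT <= rhox - h * q + h * eta -> 0 <= e <= eta * h ->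
    0 <= d -> d <= 1 - h * tr + eta * h ->
    rhoT * (1 + 2 * e) ^+ 2 * d < (1 - delta / 2 * h) * rhox.
Proof.
move=> r0 d0 hq.
pose b := `|tr|; have b0 : 0 <= b by exact: normr_ge0.
pose a := `|q|; have a0 : 0 <= a by exact: normr_ge0.
have [tb1 tb2] : - b <= tr /\ tr <= b by apply/andP; rewrite -ler_norml.
have [qa1 qa2] : - a <= q /\ q <= a by apply/andP; rewrite -ler_norml.
move: a0 b0 tb1 tb2 qa1 qa2; move: a b => a b a0 b0 tb1 tb2 qa1 qa2.
(* [K1] collects the multiples of [eta] in the first-order term and [K3] bounds the resulting
   density. [K2], below, bounds the coefficient of [h ^+ 2], which the choice of [tau] absorbs. With
   [eta * D <= delta * rho0 / 4] the final inequality is strict. *)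
pose K1 : R := 3 + rho0 + b; pose K3 : R := rho0 + 1 + K1.
pose D : R := K1 + 8 * K3 + delta.
have K1p : 0 < K1 by rewrite /K1; lra.
have K3p : 0 < K3 by rewrite /K3; lra.
have Dp : 0 < D by rewrite /D; lra.
have dr : 0 < delta * rho0 by rewrite mulr_gt0.
pose K2 : R := (1 + a) * (1 + b).
have K2p : 0 < K2 by rewrite mulr_gt0 // ltr_pwDl.
exists (Num.min 1 (delta * rho0 / (4 * D))).
  by rewrite lt_min ltr01 divr_gt0 ?mulr_gt0 //= ge_min lexx.
set eta := Num.min _ _.
have eta0 : 0 < eta by rewrite lt_min ltr01 divr_gt0 ?mulr_gt0.
have eta1 : eta <= 1 by rewrite ge_min lexx.
have etaD : eta * D <= delta * rho0 / 4.
  have : eta <= delta * rho0 / (4 * D) by rewrite ge_min lexx orbT.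
  by rewrite invfM mulrA ler_pdivlMr.
move: eta eta0 eta1 etaD => eta eta0 eta1 etaD.
exists (Num.min 1 (eta / K2)); first by rewrite lt_min ltr01 divr_gt0.
move=> h rhox rhoT d e /andP[h0]; rewrite lt_min => /andP[h1 hK].
rewrite ltr_pdivlMr // in hK.
rewrite ler_norml => /andP[x1 x2] T0 T1 /andP[e0 e1] dd0 d1.
pose P := rhox - h * q + h * eta; pose Q := 1 - h * tr + eta * h.
pose X := - (delta * rho0) + eta * K1.
have PQ : P * Q <= rhox + h * X.
  have -> : P * Q = rhox + h * ((eta - q) + rhox * (eta - tr) + h * ((eta - q) * (eta - tr))).
    by rewrite /P /Q; ring.
  rewrite lerD2l ler_pM2l //.
  have s1 : rhox * eta <= (rho0 + 1) * eta by rewrite ler_wpM2r //; lra.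
  have s2 : (rho0 - rhox) * tr <= eta * b.
    apply: le_trans (ler_norm _) _; rewrite normrM; apply: ler_pM => //.
      by rewrite ler_norml; apply/andP; split; lra.
    by rewrite ler_norml; apply/andP.
  have s3 : h * ((eta - q) * (eta - tr)) <= eta.
    apply: le_trans (_ : h * K2 <= _); last exact: ltW.
    rewrite ler_pM2l //; apply: le_trans (ler_norm _) _; rewrite normrM.
    by apply: ler_pM => //; rewrite ler_norml; apply/andP; split; lra.
  have -> : eta - q + rhox * (eta - tr) + h * ((eta - q) * (eta - tr)) =
     eta - (q + rho0 * tr) + rhox * eta + (rho0 - rhox) * tr + h * ((eta - q) * (eta - tr)) by ring.
  by rewrite /X /K1; move: s1 s2 s3 hq; clear; lra.
have Td : rhoT * d <= rhox + h * X.
  by apply: le_trans PQ; apply: ler_pM.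
have e8 : (1 + 2 * e) ^+ 2 <= 1 + 8 * (eta * h).
  have eh : eta * h <= 1 by rewrite mulr_ile1 // ltW.
  have ee : e * e <= e by rewrite ler_piMl // (le_trans e1).
  by rewrite expr2; move: ee e1; clear; move=> *; lra.
have eh0 : 0 < eta * h by rewrite mulr_gt0.
have XK : rhox + h * X <= K3.
  have XK1 : X <= K1.
    have : eta * K1 <= K1 by rewrite ler_piMl // ltW.
    by rewrite /X; lra.
  have hX : h * X <= K1.
    apply: le_trans (_ : h * K1 <= _); first by rewrite ler_pM2l.
    by rewrite ler_piMl // ltW.
  by rewrite /K3; lra.
have S0 : 0 <= rhox + h * X by apply: le_trans Td; rewrite mulr_ge0.
rewrite mulrAC.
apply: (@le_lt_trans _ _ ((rhox + h * X) * (1 + 8 * (eta * h)))).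
  by apply: ler_pM => //; [rewrite mulr_ge0|exact: sqr_ge0].
apply: (@le_lt_trans _ _ (rhox + h * (X + 8 * (eta * K3)))).
  have s : (rhox + h * X) * (eta * h) <= K3 * (eta * h) by rewrite ler_pM2r.
  have -> : (rhox + h * X) * (1 + 8 * (eta * h)) =
    rhox + h * X + 8 * ((rhox + h * X) * (eta * h)) by ring.
  have -> : rhox + h * (X + 8 * (eta * K3)) = rhox + h * X + 8 * (K3 * (eta * h)) by ring.
  by rewrite lerD2l ler_pM2l.
have -> : (1 - delta / 2 * h) * rhox = rhox + h * (- (delta / 2 * rhox)) by ring.
rewrite ltrD2l ltr_pM2l //.
have s : delta * rhox <= delta * (rho0 + eta) by rewrite ler_pM2l //; lra.
have de : 0 < delta * eta by rewrite mulr_gt0.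
by move: s etaD dr de; rewrite /X /D; clear => s etaD dr de; lra.
Qed.
End LocalFlow.

Section LocalFlow.
Variable R : realType.
Implicit Types (x y z : R * R) (c : R -> R * R).
Variables (w : R * R -> R * R) (u0 : R * R) (r2 L B : R).
Hypotheses (r20 : 0 < r2) (L0 : 0 < L) (B0 : 0 < B).
Hypothesis wL : forall x y, `|x - u0| < r2 -> `|y - u0| < r2 -> `|w x - w y| <= L * `|x - y|.
Hypothesis wB : forall x, `|x - u0| < r2 -> `|w x| <= B.

Lemma flow_gronwall c1 c2 (a b s t : R) : a <= s <= b -> a <= t <= b ->
  L * (b - a) <= 2^-1 ->
  (forall t, a <= t <= b -> `|c1 t - u0| < r2 /\ is_derive2 t c1 (w (c1 t))) ->
  (forall t, a <= t <= b -> `|c2 t - u0| < r2 /\ is_derive2 t c2 (w (c2 t))) ->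
  `|c1 t - c2 t| <= 2 * `|c1 s - c2 s|.
Proof.
move=> sab tab Lab h1 h2.
apply: (@gronwall2 R (fun t => c1 t - c2 t) (fun t => w (c1 t) - w (c2 t)) a b L) => //.
- move=> u hu; have [_ [d1 _]] := h1 u hu; have [_ [d2 _]] := h2 u hu.
  exact: (is_deriveB d1 d2).
- move=> u hu; have [_ [_ d1]] := h1 u hu; have [_ [_ d2]] := h2 u hu.
  exact: (is_deriveB d1 d2).
- exact: ltW.
- by move=> u hu; have [n1 _] := h1 u hu; have [n2 _] := h2 u hu; exact: wL.
Qed.

Let s0 := 3 / 4 * r2.
Let proj x : R * R := (clamp (u0.1 - s0) (u0.1 + s0) x.1, clamp (u0.2 - s0) (u0.2 + s0) x.2).

Let s0p : 0 < s0. Proof. by rewrite mulr_gt0 // divr_gt0. Qed.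

Let proj_lip x y : `|proj x - proj y| <= `|x - y|.
Proof.
rewrite prod_normE ge_max; apply/andP; split.
  by apply: le_trans (clamp_lip _ _ _ _) (norm_fst (x - y)).
by apply: le_trans (clamp_lip _ _ _ _) (norm_snd (x - y)).
Qed.

Let proj_in x : `|proj x - u0| < r2.
Proof.
have h (a z : R) : `|clamp (a - s0) (a + s0) z - a| <= s0.
  have /andP[h1 h2] : a - s0 <= clamp (a - s0) (a + s0) z <= a + s0.
    by apply: clamp_itv; rewrite lerD2l ge0_cp // ltW.
  by rewrite ler_norml; apply/andP; split; lra.
apply: (@le_lt_trans _ _ s0); last by rewrite /s0; move: r20; lra.
by rewrite prod_normE ge_max; apply/andP; split; exact: h.
Qed.

Let proj_id x : `|x - u0| <= s0 -> proj x = x.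
Proof.
case: x => x1 x2; rewrite prod_normE ge_max /= !ler_norml => /andP[/andP[a1 a2] /andP[a3 a4]].
by rewrite /proj; congr (_, _); apply: clamp_id => /=; apply/andP; split; lra.
Qed.

(** The field is composed with [proj], which makes it globally Lipschitz and bounded. Since
    [B * tau <= r2 / 8], flow lines that start within [r2 / 2] of the centre stay where [proj] is
    the identity, and those that start within [r2 / 4] stay within [r2 / 2]. *)
Lemma local_flow : exists2 tau : R, 0 < tau /\ L * tau <= 4^-1 & exists phi : R -> R * R -> R * R,
  forall x, `|x - u0| < r2 / 2 -> phi 0 x = x /\
   forall t : R, `|t| < tau -> [/\ `|phi t x - u0| < r2,
     `|x - u0| < r2 / 4 -> `|phi t x - u0| < r2 / 2 &
     is_derive2 t (phi^~ x) (w (phi t x))].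
Proof.
pose tau : R := Num.min ((4 * L)^-1) (r2 / (8 * B)).
have t0 : 0 < tau by rewrite lt_min invr_gt0 divr_gt0 ?mulr_gt0.
have tL : L * tau <= 4^-1.
  have : tau <= (4 * L)^-1 by rewrite ge_min lexx.
  by rewrite -(ler_pM2l L0) invfM mulrCA divff ?mulr1 // gt_eqF.
have tB : B * tau <= r2 / 8.
  have : tau <= r2 / (8 * B) by rewrite ge_min lexx orbT.
  rewrite -(ler_pM2l B0) => /le_trans; apply.
  by rewrite le_eqVlt; apply/orP; left; apply/eqP; field; rewrite gt_eqF.
exists tau => //.
have wL' a b : `|w (proj a) - w (proj b)| <= L * `|a - b|.
  by apply: le_trans (wL _ _) _ => //; rewrite ler_wpM2l // ltW.
have wB' a : `|w (proj a)| <= B by exact: wB.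
have tL2 : L * tau <= 2^-1 by apply: le_trans tL _; rewrite lef_pV2 ?posrE // ler_nat.
have [F hF] := choice (picard_global L0 wL' wB' t0 tL2).
exists (fun t x => F x t) => x xr; have [F0 _ FB Fd] := hF x.
split=> // t; rewrite ltr_norml => /andP[t1 t2].
have tt : - tau <= t <= tau by rewrite !ltW.
have d := le_trans (FB t tt) tB.
have d1 : `|F x t - u0| <= r2 / 8 + `|x - u0|.
  by apply: le_trans (ler_distD x _ _) _; rewrite lerD2r.
have d2 : `|F x t - u0| <= s0.
  by apply: le_trans d1 _; rewrite /s0; move: xr r20; move: `|x - u0| => *; lra.
split.
- by apply: le_lt_trans d2 _; rewrite /s0; move: r20; lra.
- by move=> xq; apply: le_lt_trans d1 _; move: xq r20; move: `|x - u0| => *; lra.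
- have H : is_derive2 t (F x) (w (proj (F x t))) by apply: Fd; rewrite ltr_norml t1.
  by rewrite proj_id in H.
Qed.

End LocalFlow.

Section ExpandingFlow.
Variable R : realType.
Implicit Types (x y z : R * R) (c : R -> R * R).
Local Notation mu := (@lebesgue_measure R \x @lebesgue_measure R)%E.

Lemma is_derive2_shift c (t s : R) v : is_derive2 (t + s) c v ->
  is_derive2 t (fun t => c (t + s)) v.
Proof.
move=> [/is_derive_eps h1 /is_derive_eps h2].
split; apply/is_derive_eps => e e0.
  have [r r0 hr] := h1 e e0; exists r => // h hh.
  have := hr h hh; rewrite /= (addrAC t s); exact: id.
have [r r0 hr] := h2 e e0; exists r => // h hh.
have := hr h hh; rewrite /= (addrAC t s); exact: id.
Qed.

Lemma eps_open (V : normedModType R) (O : set V) :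
  (forall x : V, O x -> exists2 r : R, 0 < r & forall y : V, `|y - x| < r -> O y) -> open O.
Proof.
move=> h; rewrite openE => x /h[r r0 hr]; apply/nbhs_normP.
by exists r => // y /=; rewrite distrC; exact: hr.
Qed.

Section Flow.
Variables (w : R * R -> R * R) (u0 : R * R) (r L tau : R) (phi : R -> R * R -> R * R).
Hypotheses (r0 : 0 < r) (L0 : 0 < L) (tau0 : 0 < tau) (tL : L * tau <= 4^-1).
Hypothesis wL : forall x y, `|x - u0| < r -> `|y - u0| < r -> `|w x - w y| <= L * `|x - y|.
Hypothesis fl : forall x, `|x - u0| < r / 2 -> phi 0 x = x /\
   forall t : R, `|t| < tau -> [/\ `|phi t x - u0| < r,
     `|x - u0| < r / 4 -> `|phi t x - u0| < r / 2 &
     is_derive2 t (phi^~ x) (w (phi t x))].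

Lemma flow_lip x y (t : R) : `|x - u0| < r / 2 -> `|y - u0| < r / 2 -> `|t| < tau ->
  `|phi t x - phi t y| <= 2 * `|x - y|.
Proof.
move=> xr yr tt; have [x0 hx] := fl xr; have [y0 hy] := fl yr.
have a0 : 0 <= `|t| by [].
have h u : - `|t| <= u <= `|t| -> `|u| < tau.
  by rewrite -ler_norml => /le_lt_trans; apply.
have := @flow_gronwall R w u0 r L L0 wL (phi^~ x) (phi^~ y) (- `|t|) `|t| 0 t.
rewrite x0 y0; apply.
- by rewrite oppr_le0 a0.
- by rewrite -ler_norml.
- rewrite opprK; have : L * `|t| <= L * tau by rewrite ler_pM2l // ltW.
  by move: tL; rewrite mulrDr; lra.
- by move=> u /h ut; have [] := hx u ut.
- by move=> u /h ut; have [] := hy u ut.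
Qed.

(** Both [s |-> phi s (phi t x)] and [s |-> phi (s + t) x] are flow lines with the same value at 0;
    the Gronwall bound makes them agree at [s = - t]. As [t] has either sign, the segment runs
    between the minimum and the maximum of [- t] and 0. *)
Lemma flow_inv x (t : R) : `|x - u0| < r / 2 -> `|t| < tau -> `|phi t x - u0| < r / 2 ->
  phi (- t) (phi t x) = x.
Proof.
move=> xr tt xtr; have [x0 hx] := fl xr; have [y0 hy] := fl xtr.
have h u : - `|t| <= u <= `|t| -> `|u| < tau.
  by rewrite -ler_norml => /le_lt_trans; apply.
pose a := Num.min (- t) 0; pose b := Num.max (- t) 0.
have ab u : a <= u <= b -> `|u| < tau /\ `|u + t| < tau.
  move: tt; rewrite /a /b !ltr_norml.
  by case: (leP (- t) 0) => ht /andP[t1 t2] /andP[u1 u2]; split; apply/andP; split; lra.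
have := @flow_gronwall R w u0 r L L0 wL (phi^~ (phi t x)) (fun s => phi (s + t) x) a b 0 (- t).
rewrite y0 add0r addNr x0 subrr normr0 mulr0 => H.
apply/eqP; rewrite -subr_eq0 -normr_eq0; apply/eqP/le_anti/andP; split=> //; apply: H.
- by rewrite ge_min le_max lexx !orbT.
- by rewrite ge_min le_max lexx.
- have : b - a <= tau.
    by move: tt; rewrite /a /b ltr_norml; case: (leP (- t) 0) => ht /andP[t1 t2]; lra.
  by rewrite -(ler_pM2l L0); move: tL; lra.
- by move=> u /ab[ut _]; have [] := hy u ut.
- move=> u /ab[_ ut]; have [n1 _ d1] := hx _ ut; split=> //.
  exact: (@is_derive2_shift (phi^~ x) u t _ d1).
Qed.

Lemma flow_cts (t : R) x : `|x - u0| < r / 2 -> `|t| < tau -> {for x, continuous (phi t)}.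
Proof.
move=> xr tt; apply/cts_eps => e e0.
exists (Num.min (r / 2 - `|x - u0|) (e / 2)) => [|a].
  by rewrite lt_min subr_gt0 xr divr_gt0.
rewrite lt_min => /andP[a1 a2].
have ar : `|a - u0| < r / 2.
  by have := ler_distD x a u0; move: a1; move: `|a - x| `|x - u0| `|a - u0| => *; lra.
apply: le_trans (flow_lip ar xr tt) _.
by move: a2; move: `|a - x| => *; lra.
Qed.

Lemma ball_open u (s : R) : open [set x : R * R | `|x - u| < s].
Proof.
apply: eps_open => x /= xs; exists (s - `|x - u|) => [|y]; first by rewrite subr_gt0.
by have := ler_distD x y u; move: `|y - x| `|x - u| `|y - u| => *; lra.
Qed.

(** The image is written as a preimage under the inverse flow, so that its openness is a matter of
    continuity. *)
Definition flow_image (t : R) (C : set (R * R)) :=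
  [set y | `|y - u0| < r / 2 /\ C (phi (- t) y)].

Lemma flow_imageE (t : R) (C : set (R * R)) : (forall x, C x -> `|x - u0| < r / 4) ->
  `|t| < tau -> phi t @` C = flow_image t C.
Proof.
move=> CN tt; have tt' : `|- t| < tau by rewrite normrN.
have rr : r / 4 < r / 2 by move: r0; lra.
apply/seteqP; split=> [_ [x Cx <-]|y [yr Cy]].
  have xr := lt_trans (CN _ Cx) rr.
  have [_ h] := fl xr; have [_ /(_ (CN _ Cx)) xtr _] := h t tt.
  by split=> //; rewrite flow_inv.
exists (phi (- t) y) => //; rewrite -{1}(opprK t) flow_inv //.
exact: lt_trans (CN _ Cy) rr.
Qed.

Lemma flow_image_open (t : R) (C : set (R * R)) : open C -> `|t| < tau ->
  open (flow_image t C).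
Proof.
move=> oC tt; rewrite openE => y [yr Cy].
apply: filterI; first exact: (open_nbhs_nbhs (conj (@ball_open u0 (r / 2)) yr)).
apply: (flow_cts (t := - t) yr); first by rewrite normrN.
exact: open_nbhs_nbhs.
Qed.

Section Linearised.
Variables (a0 a1 : R * R) (eta : R).
Let A x : R * R := (a0.1 * x.1 + a0.2 * x.2, a1.1 * x.1 + a1.2 * x.2).
Hypothesis wA : forall x y, `|x - u0| < r -> `|y - u0| < r ->
  `|w x - w y - A (x - y)| <= eta * `|x - y|.
Hypothesis eta0 : 0 <= eta.
Let alpha : R := (`|a0.1| + `|a0.2|) + (`|a1.1| + `|a1.2|).

Lemma A_bound x : `|A x| <= alpha * `|x|.
Proof.
have n1 := norm_fst x; have n2 := norm_snd x.
have aux (p q : R) : `|p * x.1 + q * x.2| <= (`|p| + `|q|) * `|x|.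
  apply: le_trans (ler_normD _ _) _; rewrite !normrM mulrDl.
  by rewrite lerD // ler_wpM2l.
rewrite prod_normE ge_max; apply/andP; split.
  by apply: le_trans (aux _ _) _; rewrite ler_wpM2r // /alpha lerDl addr_ge0.
by apply: le_trans (aux _ _) _; rewrite ler_wpM2r // /alpha lerDr addr_ge0.
Qed.

(** To first order the flow at time [- h] acts on differences as I - h A. The term in [eta] comes
    from the deviation of [w] from its linear part, the term in [alpha * L * h] from the change of
    the difference during the flow. *)
Lemma flow_linear x y (h : R) : `|x - u0| < r / 2 -> `|y - u0| < r / 2 -> 0 <= h < tau ->
  `|phi (- h) y - phi (- h) x - ((y - x) - h *: A (y - x))| <=
    h * (2 * eta + 2 * alpha * L * h) * `|y - x|.
Proof.
move=> xr yr /andP[h0 ht]; have [x0 hx] := fl xr; have [y0 hy] := fl yr.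
have al0 : 0 <= alpha by rewrite !addr_ge0.
have itv (u : R) : - h <= u <= 0 -> `|u| < tau.
  by move=> /andP[u1 u2]; rewrite ltr_norml; apply/andP; split; lra.
have hi : - h <= - h <= 0 by rewrite lexx oppr_le0.
have zi : - h <= (0 : R) <= 0 by rewrite lexx oppr_le0 h0.
have dif (u : R) : - h <= u <= 0 -> `|phi u y - phi u x - (y - x)| <= 2 * L * h * `|y - x|.
  move=> ui.
  have := @mvt_bound2 R (fun u => phi u y - phi u x)
    (fun u => w (phi u y) - w (phi u x)) (- h) 0 (2 * L * `|y - x|) 0 u zi ui.
  rewrite x0 y0 subr0 => H.
  have {}H := H _ _; apply: le_trans (H _ _) _.
  - move=> t /itv tt; have [_ _ [b1 b2]] := hy t tt; have [_ _ [c1 c2]] := hx t tt.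
    by split; [exact: (is_deriveB b1 c1)|exact: (is_deriveB b2 c2)].
  - move=> t /itv tt; have [n1 _ _] := hy t tt; have [n2 _ _] := hx t tt.
    apply: le_trans (wL n1 n2) _; rewrite (mulrC 2) -mulrA ler_pM2l //.
    exact: flow_lip.
  rewrite -!mulrA !ler_pM2l // mulrC ler_wpM2r //.
  by move/andP: ui => [u1 u2]; rewrite ler_norml; apply/andP; split; lra.
have := @mvt_bound2 R (fun u => phi u y - phi u x - ((y - x) + u *: A (y - x)))
  (fun u => w (phi u y) - w (phi u x) - A (y - x)) (- h) 0
  ((2 * eta + 2 * alpha * L * h) * `|y - x|) 0 (- h) zi hi.
rewrite x0 y0 scale0r addr0 subrr !subr0 scaleNr normrN (ger0_norm h0) => H.
rewrite -mulrA mulrC; apply: H.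
- move=> t /itv tt; have [_ _ [b1 b2]] := hy t tt; have [_ _ [c1 c2]] := hx t tt.
  have lin (p q : R) : is_derive t 1 (fun u : R => p + u * q) q.
    by apply: is_derive_eq; rewrite add0r /GRing.scale /= ?mulr1 ?mul1r ?mulr0 ?addr0 ?add0r.
  split.
    exact: (is_deriveB (is_deriveB b1 c1) (lin (y - x).1 (A (y - x)).1)).
  exact: (is_deriveB (is_deriveB b2 c2) (lin (y - x).2 (A (y - x)).2)).
- move=> t ti; have tt := itv t ti.
  have [n1 _ _] := hy t tt; have [n2 _ _] := hx t tt.
  have E : w (phi t y) - w (phi t x) - A (y - x) =
    (w (phi t y) - w (phi t x) - A (phi t y - phi t x)) +
    A (phi t y - phi t x - (y - x)).
    rewrite -[RHS]/(_, _) -[LHS]/(_, _) /=; congr (_, _); ring.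
  rewrite E; apply: le_trans (ler_normD _ _) _; rewrite mulrDl; apply: lerD.
    apply: le_trans (wA n1 n2) _; rewrite (mulrC 2) -mulrA ler_wpM2l //.
    exact: flow_lip.
  apply: le_trans (A_bound _) _; apply: le_trans (ler_wpM2l al0 (dif t ti)) _.
  by rewrite le_eqVlt; apply/orP; left; apply/eqP; ring.
Qed.

End Linearised.
End Flow.
End ExpandingFlow.

Section Expansion.
Variable R : realType.
Implicit Types (x y z : R * R).
Local Notation mu := (@lebesgue_measure R \x @lebesgue_measure R)%E.

(** The hypothesis says that the divergence of [rho] times [w] is at least [delta] times [rho] at
    [u0]; by strict differentiability this persists up to small errors nearby. [distortion] is
    applied to the backward flow, which contracts weighted area by the factor [1 - delta / 2 * h],
    and (1 - x) e^x <= 1 turns this into expansion by the forward flow. The time [tau] does not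
    depend on the open set [C]. *)
Lemma expanding_flow (w : R * R -> R * R) (rho : R * R -> R) (U : set (R * R)) (u0 : R * R)
    (a0 a1 c : R * R) (delta : R) :
  open U -> U u0 -> sdiff (fst \o w) u0 a0 -> sdiff (snd \o w) u0 a1 -> sdiff rho u0 c ->
  (forall x, U x -> {for x, continuous rho}) -> (forall x, U x -> 0 < rho x) -> 0 < delta ->
  delta * rho u0 <= (c.1 * (w u0).1 + c.2 * (w u0).2) + rho u0 * (a0.1 + a1.2) ->
  exists r L tau phi, [/\ 0 < r, 0 < L, 0 < tau, L * tau <= 4^-1 &
  [/\ forall x, `|x - u0| < r -> U x /\ rho x <= rho u0 + 1,
      forall x y, `|x - u0| < r -> `|y - u0| < r -> `|w x - w y| <= L * `|x - y|,
      forall x, `|x - u0| < r / 2 -> phi 0 x = x /\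
        forall t : R, `|t| < tau -> [/\ `|phi t x - u0| < r,
          `|x - u0| < r / 4 -> `|phi t x - u0| < r / 2 &
          is_derive2 t (phi^~ x) (w (phi t x))] &
      forall (h : R) C, 0 <= h < tau -> open C -> (forall x, C x -> `|x - u0| < r / 4) ->
        ((expR (delta / 2 * h))%:E * \int[mu]_(u in C) (rho u)%:E <=
         \int[mu]_(u in flow_image u0 r phi h C) (rho u)%:E)%E]].
Proof.
move=> oU Uu w1 w2 rhod rho_cts rho_pos delta0 div_ge.
pose q := c.1 * (w u0).1 + c.2 * (w u0).2; pose tr := a0.1 + a1.2.
have [eta /andP[eta0 eta1] [tau1 tau10 CF]] := contraction_factor (rho_pos _ Uu) delta0 div_ge.
pose alpha : R := (`|a0.1| + `|a0.2|) + (`|a1.1| + `|a1.2|).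
have al0 : 0 <= alpha by rewrite !addr_ge0.
pose L := alpha + 1; have L0 : 0 < L by rewrite ltr_wpDl.
pose B := `|w u0| + 1; have B0 : 0 < B by rewrite ltr_wpDl.
pose c1 := `|c.1| + `|c.2| + 1; have c10 : 0 < c1 by rewrite ltr_wpDl // addr_ge0.
pose A x : R * R := (a0.1 * x.1 + a0.2 * x.2, a1.1 * x.1 + a1.2 * x.2).
have e12 : 0 < eta / 12 by rewrite divr_gt0.
have eB : 0 < eta / (2 * B) by rewrite divr_gt0 // mulr_gt0.
pose ec := Num.min 1 (eta / (2 * c1)).
have ec0 : 0 < ec by rewrite lt_min ltr01 divr_gt0 // mulr_gt0.
have [s1 s10 h1] := w1 _ e12; have [s2 s20 h2] := w2 _ e12.
have [s3 s30 h3] := rhod _ eB.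
have /cts_eps /(_ _ eta0)[s4 s40 h4] := rho_cts _ Uu.
have [s5 s50 h5] := open_eps oU Uu.
pose r := Num.min (Num.min (Num.min s1 s2) (Num.min s3 s4)) (Num.min s5 (ec / L)).
have r0 : 0 < r by rewrite !lt_min s10 s20 s30 s40 s50 /= divr_gt0.
have wA x y : `|x - u0| < r -> `|y - u0| < r -> `|w x - w y - A (x - y)| <= eta / 12 * `|x - y|.
  rewrite !lt_min => /andP[/andP[/andP[x1 x2] _] _] /andP[/andP[/andP[y1 y2] _] _].
  by rewrite prod_normE ge_max; apply/andP; split; [exact: h1|exact: h2].
have wL x y : `|x - u0| < r -> `|y - u0| < r -> `|w x - w y| <= L * `|x - y|.
  move=> xr yr; rewrite -(subrK (A (x - y)) (w x - w y)).
  apply: le_trans (ler_normD _ _) _; rewrite /L mulrDl mul1r addrC lerD //.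
    exact: A_bound.
  apply: le_trans (wA x y xr yr) _; rewrite ler_piMl //.
  by clear -eta1; lra.
have u0r : `|u0 - u0| < r by rewrite subrr normr0.
have wD x : `|x - u0| < r -> `|w x - w u0| <= ec.
  move=> xr; apply: le_trans (wL _ _ xr u0r) _.
  move: xr; rewrite !lt_min => /andP[_ /andP[_]].
  by rewrite ltr_pdivlMr // mulrC => /ltW.
have wB x : `|x - u0| < r -> `|w x| <= B.
  move=> xr; rewrite -(subrK (w u0) (w x)); apply: le_trans (ler_normD _ _) _.
  by rewrite /B addrC lerD2l; apply: le_trans (wD _ xr) _; rewrite ge_min lexx.
have rhoA x y : `|x - u0| < r -> `|y - u0| < r ->
    `|rho x - rho y - (c.1 * (x.1 - y.1) + c.2 * (x.2 - y.2))| <= eta / (2 * B) * `|x - y|.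
  rewrite !lt_min => /andP[/andP[_ /andP[x1 _]] _] /andP[/andP[_ /andP[y1 _]] _]; exact: h3.
have rhoD x : `|x - u0| < r -> `|rho x - rho u0| <= eta.
  by rewrite !lt_min => /andP[/andP[_ /andP[_ x1]] _]; exact: h4.
have rU x : `|x - u0| < r -> U x.
  by rewrite !lt_min => /andP[_ /andP[x1 _]]; exact: h5.
have [tau2 [tau20 tau2L] [phi fl2]] := local_flow r0 L0 B0 wL wB.
pose tau := Num.min (Num.min tau1 tau2) (Num.min (eta / (16 * (L ^+ 2))) (delta^-1)).
have LL : 0 < L ^+ 2 by rewrite exprn_gt0.
have tau0 : 0 < tau.
  by rewrite !lt_min tau10 tau20 invr_gt0 delta0 andbT divr_gt0 // mulr_gt0.
have tL : L * tau <= 4^-1.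
  by apply: le_trans tau2L; rewrite ler_pM2l // !ge_min lexx orbT.
have fl x : `|x - u0| < r / 2 -> phi 0 x = x /\
   forall t : R, `|t| < tau -> [/\ `|phi t x - u0| < r,
     `|x - u0| < r / 4 -> `|phi t x - u0| < r / 2 & is_derive2 t (phi^~ x) (w (phi t x))].
  have tau_2 : tau <= tau2 by rewrite !ge_min lexx orbT.
  by move=> /fl2[x0 hx]; split=> // t /lt_le_trans /(_ tau_2); exact: hx.
exists r, L, tau, phi; split=> //; split=> //.
  move=> x xr; split; first exact: rU.
  have := rhoD x xr; rewrite ler_norml => /andP[_ +]; clear -eta1; lra.
move=> h C /andP[h0 ht] oC CN.
have oD := flow_image_open L0 tL wL fl (t := h) oC.
have habs : `|h| < tau by rewrite ger0_norm.
have nabs : `|- h| < tau by rewrite normrN.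
have {}oD := oD habs.
have r42 : r / 4 < r / 2 by clear -r0; lra.
have r2r : r / 2 < r by clear -r0; lra.
(* Time 0 is separate, since [contraction_factor] needs [h] positive. *)
move: h0; rewrite le_eqVlt => /predU1P[h0|h0].
  rewrite -h0 mulr0 expR0 mul1e.
  have <- : C = flow_image u0 r phi 0 C; last by [].
  rewrite -(flow_imageE r0 L0 tL wL fl) //; last by rewrite normr0.
  apply/seteqP; split=> [x Cx|_ [x Cx <-]].
    by exists x => //; have [] := fl x (lt_trans (CN _ Cx) r42).
  by have [->] := fl x (lt_trans (CN _ Cx) r42).
set D := flow_image u0 r phi h C in oD *.
have DE : phi h @` C = D by exact: (flow_imageE r0 L0 tL wL fl).
move: (ht); rewrite !lt_min => /andP[/andP[ht1 ht2] /andP[htL htd]].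
have hd : delta * h < 1 by rewrite mulrC -ltr_pdivlMr // div1r.
have theta0 : 0 < 1 - delta / 2 * h by rewrite mulrAC; clear -hd; lra.
have hLL : h * L ^+ 2 <= eta / 16.
  by move: htL; rewrite invfM mulrA ltr_pdivlMr // => /ltW.
have hL : h * L <= eta / 16.
  apply: le_trans hLL; rewrite expr2 mulrA ler_peMr ?mulr_ge0 ?(ltW h0) ?(ltW L0) //.
  by rewrite /L lerDr.
have aL : alpha <= L by rewrite /L lerDl.
have hal : h * alpha <= 16^-1.
  by apply: le_trans (_ : h * L <= _); [rewrite ler_pM2l|clear -hL eta1; lra].
have hal2 : h * (alpha ^+ 2) <= eta / 16.
  apply: le_trans hLL; rewrite ler_pM2l // !expr2; exact: ler_pM.
have haL : h * (alpha * L) <= eta / 16.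
  by apply: le_trans hLL; rewrite ler_pM2l // !expr2 ler_pM2r.
have DU x : D x -> `|x - u0| < r / 2 by case.
have DC x : D x -> C (phi (- h) x) by case.
have Dr x : D x -> `|x - u0| < r by move=> /DU xr; exact: lt_trans xr r2r.
have Cr x : C x -> `|x - u0| < r by move=> /CN xr; apply: lt_trans xr (lt_trans r42 r2r).
have inv x : D x -> phi h (phi (- h) x) = x.
  move=> Dx; rewrite -{1}(opprK h) (flow_inv L0 tL wL fl) //; first exact: DU.
  exact: lt_trans (CN _ (DC _ Dx)) r42.
(* The displacement of [x] under the backward flow, to first order in [h]. *)
have disp x : D x -> `|phi (- h) x - x + h *: w u0| <= ec * h.
  move=> Dx; have [x0 hx] := fl x (DU _ Dx).
  have zi : - h <= (0 : R) <= 0 by rewrite lexx oppr_le0 ltW.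
  have hi : - h <= - h <= 0 by rewrite lexx oppr_le0 ltW.
  have it (t : R) : - h <= t <= 0 -> `|t| < tau.
    by move=> /andP[t1 t2]; rewrite ltr_norml; clear -t1 t2 ht h0; apply/andP; split; lra.
  have := @mvt_bound2 R (fun t => phi t x - x - t *: w u0) (fun t => w (phi t x) - w u0)
    (- h) 0 ec 0 (- h) zi hi.
  rewrite x0 scale0r subrr !subr0 scaleNr opprK normrN (gtr0_norm h0); apply.
  - move=> t /it tt; have [_ _ [b1 b2]] := hx t tt.
    have lin (p z : R) : is_derive t 1 (fun u : R => z + u * p) p.
      by apply: is_derive_eq; rewrite add0r /GRing.scale /= ?mulr1 ?mul1r ?mulr0 ?addr0 ?add0r.
    have E (f1 f2 : R -> R) (d1 d2 : R) : is_derive t 1 f1 d1 -> f2 = f1 -> d1 = d2 -> is_derive t 1 f2 d2.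
      by move=> ? -> <-.
    split.
      apply: E (is_deriveB b1 (lin (w u0).1 x.1)) _ _ => //.
      by apply/funext => u; rewrite /= opprD addrA.
    apply: E (is_deriveB b2 (lin (w u0).2 x.2)) _ _ => //.
    by apply/funext => u; rewrite /= opprD addrA.
  - by move=> t /it tt; apply: wD; have [] := hx t tt.
have rho_le x : D x -> rho (phi (- h) x) <= rho x - h * q + h * eta.
  move=> Dx; have := rhoA _ _ (Cr _ (DC _ Dx)) (Dr _ Dx).
  have dx := disp x Dx; set v := phi (- h) x in dx *.
  have vx : `|v - x| <= B * h.
    rewrite -(addrK (h *: w u0) (v - x)); apply: le_trans (ler_normB _ _) _.
    rewrite normrZ (gtr0_norm h0) /B mulrDl mul1r addrC; apply: lerD; first by rewrite mulrC.
    by apply: le_trans dx _; rewrite ler_piMl ?(ltW h0) // ge_min lexx.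
  have ecc : ec * h * c1 <= eta / 2 * h.
    have : ec <= eta / (2 * c1) by rewrite ge_min lexx orbT.
    by rewrite invfM mulrA ler_pdivlMr // mulrAC => /(ler_wpM2r (ltW h0)); rewrite mulrAC.
  have eBB : eta / (2 * B) * `|v - x| <= eta / 2 * h.
    apply: le_trans (ler_wpM2l (ltW eB) vx) _.
    by rewrite invfM !mulrA mulfVK // gt_eqF.
  have d1 : c.1 * (v.1 - x.1 + h * (w u0).1) + c.2 * (v.2 - x.2 + h * (w u0).2) <= eta / 2 * h.
    apply: le_trans ecc; apply: le_trans (ler_norm _) _.
    apply: le_trans (ler_normD _ _) _; rewrite !normrM.
    have e1 := le_trans (norm_fst _) dx; have e2 := le_trans (norm_snd _) dx.
    apply: (@le_trans _ _ (`|c.1| * (ec * h) + `|c.2| * (ec * h))).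
      apply: lerD; [exact: (ler_wpM2l _ e1)|exact: (ler_wpM2l _ e2)].
    rewrite -mulrDl mulrC; apply: ler_wpM2l; last by rewrite /c1 lerDl.
    by rewrite mulr_ge0 ?(ltW ec0) ?(ltW h0).
  move=> /(le_trans (ler_norm _)) /le_trans /(_ eBB) H.
  clear -H d1; move: H d1; rewrite /q.
  set X := c.1 * (v.1 - x.1) + _.
  have -> : c.1 * (v.1 - x.1 + h * (w u0).1) + c.2 * (v.2 - x.2 + h * (w u0).2) =
    X + h * (c.1 * (w u0).1 + c.2 * (w u0).2) by rewrite /X; ring.
  by move: X (h * (_ + _)) => X Y H d1; lra.
have dist_loc x : D x -> exists p1 q1 r1 s1' e : R,
  [/\ p1 * s1' - q1 * r1 != 0, 0 <= e,
      rho (phi (- h) x) * (1 + 2 * e) ^+ 2 < (1 - delta / 2 * h) * rho x * `|p1 * s1' - q1 * r1| &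
      exists2 d, 0 < d & forall y, D y -> `|y - x| < d ->
       `|(p1 * ((phi (- h) y).1 - (phi (- h) x).1) + q1 * ((phi (- h) y).2 - (phi (- h) x).2),
          r1 * ((phi (- h) y).1 - (phi (- h) x).1) + s1' * ((phi (- h) y).2 - (phi (- h) x).2))
          - (y - x)| <= e * `|y - x|].
  move=> Dx.
  (* The determinant of I - h A. The entries supplied to [distortion] below are those of the
     adjugate divided by [d]. *)
  pose d := (1 - h * a0.1) * (1 - h * a1.2) - (h * a0.2) * (h * a1.1).
  have n1 : `|a0.1| <= alpha by rewrite /alpha -addrA lerDl !addr_ge0.
  have n2 : `|a0.2| <= alpha by rewrite /alpha -addrA addrCA lerDl !addr_ge0.
  have n3 : `|a1.1| <= alpha by rewrite /alpha addrCA lerDl !addr_ge0.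
  have n4 : `|a1.2| <= alpha by rewrite /alpha addrA lerDr !addr_ge0.
  have hn (z : R) : `|z| <= alpha -> `|h * z| <= 16^-1.
    by move=> zn; rewrite normrM (gtr0_norm h0); apply: le_trans hal; rewrite ler_pM2l.
  have hd2 : `|h * (a0.1 * a1.2 - a0.2 * a1.1)| <= eta / 8.
    rewrite normrM (gtr0_norm h0).
    apply: le_trans (_ : h * (alpha ^+ 2 + alpha ^+ 2) <= _).
      rewrite ler_pM2l //; apply: le_trans (ler_normB _ _) _; rewrite !normrM !expr2.
      by apply: lerD; apply: ler_pM.
    by rewrite mulrDr; clear -hal2; lra.
  have dE : d = 1 - h * tr + h * (h * (a0.1 * a1.2 - a0.2 * a1.1)).
    by rewrite /d /tr; ring.
  have hh1 : h * (h * (a0.1 * a1.2 - a0.2 * a1.1)) <= eta * h.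
    rewrite mulrC; apply: ler_wpM2r; first exact: ltW.
    by apply: le_trans (ler_norm _) _; apply: le_trans hd2 _; clear -eta0; lra.
  have m1 := hn _ n1; have m2 := hn _ n2; have m3 := hn _ n3; have m4 := hn _ n4.
  have dlow : 1 / 2 <= d.
    have p1 : `|h * a0.1 * (h * a1.2)| <= 16^-1 * 16^-1 by rewrite normrM; apply: ler_pM.
    have p2 : `|h * a0.2 * (h * a1.1)| <= 16^-1 * 16^-1 by rewrite normrM; apply: ler_pM.
    have -> : d = 1 - h * a0.1 - h * a1.2 + h * a0.1 * (h * a1.2) - h * a0.2 * (h * a1.1).
      by rewrite /d; ring.
    move: m1 m4 p1 p2; rewrite !ler_norml => /andP[_ m1] /andP[_ m4] /andP[p1 _] /andP[_ p2].
    clear -m1 m4 p1 p2; move: m1 m4 p1 p2.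
    by lra.
  have d0 : 0 < d by clear -dlow; lra.
  (* The factor 3 bounds the inverse of I - h A in the sup norm: its rows have absolute sum at most
     9/8 before division by [d >= 1 / 2]. With [eta / 12] as linearisation error this leaves
     [e <= eta * h]. *)
  pose e := 3 * (h * (2 * (eta / 12) + 2 * alpha * L * h)).
  have e0 : 0 <= e.
    rewrite /e !mulr_ge0 ?(ltW h0) // addr_ge0 // ?mulr_ge0 ?(ltW L0) ?(ltW h0) //.
    by rewrite ltW // divr_gt0.
  have eh : e <= eta * h.
    rewrite /e mulrCA mulrC ler_wpM2r ?(ltW h0) //.
    have -> : 3 * (2 * (eta / 12) + 2 * alpha * L * h) = eta / 2 + 6 * (h * (alpha * L)).
      by field.
    by clear -haL eta0; lra.
  have detE : (1 - h * a1.2) / d * ((1 - h * a0.1) / d) - (h * a0.2) / d * ((h * a1.1) / d) = d^-1.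
    have dn : (1 - h * a0.1) * (1 - h * a1.2) - (h * a0.2) * (h * a1.1) != 0.
      by rewrite -/d gt_eqF.
    by rewrite /d; field.
  exists ((1 - h * a1.2) / d), ((h * a0.2) / d), ((h * a1.1) / d), ((1 - h * a0.1) / d), e.
  rewrite detE; split=> //.
  - by rewrite invr_eq0 gt_eqF.
  - rewrite gtr0_norm ?invr_gt0 // ltr_pdivlMr //.
    apply: CF => //.
    + by rewrite h0.
    + by apply: rhoD; exact: Dr.
    + by apply: ltW; apply: rho_pos; apply: rU; apply: Cr; exact: DC.
    + exact: rho_le.
    + by rewrite e0.
    + exact: ltW.
    + by rewrite dE lerD2l.
  - exists 1 => // y Dy _.
    have hb : 0 <= h < tau by rewrite ltW.
    have e12' := ltW e12.
    have FL := flow_linear L0 tL wL fl wA e12' (DU _ Dx) (DU _ Dy) hb.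
    rewrite -/alpha in FL.
    set v := phi (- h) y - phi (- h) x - _ in FL.
    have -> : ((1 - h * a1.2) / d * ((phi (- h) y).1 - (phi (- h) x).1) +
               h * a0.2 / d * ((phi (- h) y).2 - (phi (- h) x).2),
               h * a1.1 / d * ((phi (- h) y).1 - (phi (- h) x).1) +
               (1 - h * a0.1) / d * ((phi (- h) y).2 - (phi (- h) x).2)) - (y - x) =
       (((1 - h * a1.2) * v.1 + h * a0.2 * v.2) / d, (h * a1.1 * v.1 + (1 - h * a0.1) * v.2) / d).
      have dn : (1 - h * a0.1) * (1 - h * a1.2) - (h * a0.2) * (h * a1.1) != 0.
        by rewrite -/d gt_eqF.
      rewrite /v /d /= /GRing.scale /= -[LHS]/(_, _) /=.
      by congr (_, _); field.
    have bnd (p z : R) : `|p| <= 1 + 16^-1 -> `|z| <= 16^-1 -> forall z1 z2 : R,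
        `|z1| <= `|v| -> `|z2| <= `|v| ->
        `|(p * z1 + z * z2) / d| <= 3 * `|v|.
      move=> hp hz z1 z2 hz1 hz2; rewrite normrM normfV (gtr0_norm d0) ler_pdivrMr //.
      apply: le_trans (ler_normD _ _) _; rewrite !normrM.
      apply: le_trans (lerD (ler_pM _ _ hp hz1) (ler_pM _ _ hz hz2)) _ => //.
      have : `|v| / 2 <= d * `|v|.
        by rewrite mulrC ler_wpM2r //; clear -dlow; lra.
      have : 0 <= `|v| by [].
      by clear; move: `|v| d => V d' V0 hV; lra.
    have one (z : R) : `|h * z| <= 16^-1 -> `|1 - h * z| <= 1 + 16^-1.
      by move=> hz; apply: le_trans (ler_normB _ _) _; rewrite normr1 lerD2l.
    have vb : `|(((1 - h * a1.2) * v.1 + h * a0.2 * v.2) / d,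
         (h * a1.1 * v.1 + (1 - h * a0.1) * v.2) / d)| <= 3 * `|v|.
      rewrite prod_normE ge_max /=; apply/andP; split.
        exact: (bnd _ _ (one _ m4) m2 _ _ (norm_fst v) (norm_snd v)).
      by rewrite addrC; exact: (bnd _ _ (one _ m1) m3 _ _ (norm_snd v) (norm_fst v)).
    apply: le_trans vb _; rewrite /e -mulrA ler_pM2l //.
have key : (\int[mu]_(u in C) (rho u)%:E <=
    (1 - delta / 2 * h)%:E * \int[mu]_(u in D) (rho u)%:E)%E.
  have CD x : C x -> D (phi h x) by move=> Cx; rewrite -DE; exists x.
  apply: (@distortion R D C (phi (- h)) (phi h)) => //.
  - move=> x Cx; rewrite (flow_inv L0 tL wL fl) //; last exact: (DU _ (CD _ Cx)).
    exact: lt_trans (CN _ Cx) r42.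
  - by move=> x Dx; apply: (flow_cts L0 tL wL fl) => //; exact: DU.
  - move=> x Cx; apply: (flow_cts L0 tL wL fl) => //; exact: lt_trans (CN _ Cx) r42.
  - by move=> x Dx; apply: rho_cts; apply: rU; exact: Dr.
  - by move=> x Cx; apply: rho_cts; apply: rU; exact: Cr.
  - by move=> x Dx; apply: ltW; apply: rho_pos; apply: rU; exact: Dr.
  - by move=> x Cx; apply: ltW; apply: rho_pos; apply: rU; exact: Cr.
have I0 : (0 <= \int[mu]_(u in D) (rho u)%:E)%E.
  apply: integral_ge0 => x [xr _]; rewrite lee_fin ltW //; apply: rho_pos; apply: rU.
  exact: lt_trans xr r2r.
apply: (@le_trans _ _ ((expR (delta / 2 * h))%:E *
   ((1 - delta / 2 * h)%:E * \int[mu]_(u in D) (rho u)%:E))%E).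
  by apply: lee_wpmul2l => //; rewrite lee_fin expR_ge0.
rewrite muleA -EFinM -[leRHS]mul1e; apply: lee_wpmul2r => //.
rewrite lee_fin; apply: (@le_trans _ _ (expR (delta / 2 * h) * expR (- (delta / 2 * h)))).
  by rewrite ler_wpM2l ?expR_ge0 // expR_ge1Dx.
by rewrite -expRD subrr expR0.
Qed.
End Expansion.

(** * Geometry of a chart *)

Section Projections.
Variable R : realType.
Variables (V : normedModType R) (l : V -> R).
Hypotheses (lD : forall x y, l (x - y) = l x - l y) (lZ : forall a x, l (a *: x) = a * l x).
Hypothesis l_cts : continuous l.

Lemma derive_proj (W : normedModType R) (f : W -> V) u v : derivable f u v ->
  is_derive u v (l \o f) (l ('D_v f u)).
Proof.
move=> df.
have C : h^-1 *: ((l \o f) (h *: v + u) - (l \o f) u) @[h --> 0^'] --> l ('D_v f u).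
  have -> : (fun h : R => h^-1 *: ((l \o f) (h *: v + u) - (l \o f) u)) =
      l \o (fun h : R => h^-1 *: (f (h *: v + u) - f u)).
    by apply/funext => h; rewrite /= lZ lD.
  by apply: continuous_cvg; [exact: l_cts|exact: df].
by split; [apply/cvg_ex; exists (l ('D_v f u))|exact: cvg_lim C].
Qed.

Lemma near_open (U : set (R * R)) (f g : R * R -> R) u : open U -> U u ->
  (forall u, U u -> f u = g u) -> \forall x \near u, f x = g x.
Proof.
by move=> oU Uu fg; apply: filterS (open_nbhs_nbhs (conj oU Uu)) => x; exact: fg.
Qed.

Lemma Ck_on_ext (U : set (R * R)) (f g : R * R -> R) k : open U ->
  (forall u, U u -> f u = g u) -> Ck_on k U f -> Ck_on k U g.
Proof.
move=> oU; elim: k f g => [|k IH] f g fg.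
  move=> [cf _]; split=> // u Uu; apply/cts_eps => e e0.
  have /cts_eps /(_ e e0)[r r0 hr] := cf u Uu.
  have [s s0 hs] := open_eps oU Uu.
  exists (Num.min r s) => [|a]; first by rewrite lt_min r0.
  by rewrite lt_min => /andP[/hr ar /hs Ua]; rewrite -!fg.
move=> [cf hf]; split.
  move=> u Uu; apply/cts_eps => e e0.
  have /cts_eps /(_ e e0)[r r0 hr] := cf u Uu.
  have [s s0 hs] := open_eps oU Uu.
  exists (Num.min r s) => [|a]; first by rewrite lt_min r0.
  by rewrite lt_min => /andP[/hr ar /hs Ua]; rewrite -!fg.
move=> i; have [df hi] := hf i; split.
  by move=> u Uu; exact: (near_eq_derivable (near_open oU Uu fg) (df u Uu)).
apply: IH hi => u Uu; exact: (near_eq_derive (axis R i) (near_open oU Uu fg)).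
Qed.

Lemma Ck_on_proj (U : set (R * R)) (f : R * R -> V) k : open U ->
  Ck_on k U f -> Ck_on k U (l \o f).
Proof.
move=> oU; elim: k f => [|k IH] f [cf hf].
  by split=> // u Uu; apply: continuous_comp; [exact: cf|exact: l_cts].
split; first by move=> u Uu; apply: continuous_comp; [exact: cf|exact: l_cts].
move=> i; have [df hi] := hf i; split.
  by move=> u Uu; have H := derive_proj (df u Uu); exact: ex_derive.
apply: (@Ck_on_ext U (l \o pder i f)) => //; last exact: IH.
move=> u Uu; have H := derive_proj (df u Uu).
by rewrite /pder (@derive_val _ _ _ _ _ _ _ H).
Qed.

End Projections.

Lemma sum_ord3 (R : realType) (F : 'I_3 -> R) : \sum_i F i = F 0 + F 1 + F ord_max.
Proof.
by rewrite !big_ord_recl big_ord0 addr0 addrA; congr (F _ + F _ + F _); apply: val_inj.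
Qed.

Lemma sum_ord2 (R : zmodType) (F : 'I_2 -> R) : \sum_i F i = F 0 + F 1.
Proof. by rewrite !big_ord_recl big_ord0 addr0; congr (F _ + F _); apply: val_inj. Qed.

(** * Algebra of a pair of tangent vectors in space *)

Section ChartAlgebra.
Variable R : realType.

Definition ddot (a b : 'I_3 -> R) := a 0 * b 0 + a 1 * b 1 + a ord_max * b ord_max.

Definition cross (a b : 'I_3 -> R) (k : 'I_3) : R :=
  if k == 0 then a 1 * b ord_max - a ord_max * b 1
  else if k == 1 then a ord_max * b 0 - a 0 * b ord_max
  else a 0 * b 1 - a 1 * b 0.

Definition gdet (a b : 'I_3 -> R) := ddot a a * ddot b b - ddot a b ^+ 2.

Lemma lagrange a b : gdet a b = ddot (cross a b) (cross a b).
Proof. by rewrite /gdet /ddot /cross /=; ring. Qed.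

(* The contravariant components of the tangential projection of [U]. *)
Definition wfield (a b U : 'I_3 -> R) : R * R :=
  ((ddot b b * ddot U a - ddot a b * ddot U b) / gdet a b,
   (ddot a a * ddot U b - ddot a b * ddot U a) / gdet a b).

Lemma wfield_normal a b U : gdet a b != 0 -> let w := wfield a b U in
  (w.1 * ddot a a + w.2 * ddot a b = ddot U a) /\ (w.1 * ddot a b + w.2 * ddot b b = ddot U b).
Proof.
move=> g0; rewrite /wfield /=; rewrite /gdet in g0 *.
by split; field; exact: g0.
Qed.

Lemma wfield_unique a b U (w : R * R) : gdet a b != 0 ->
  w.1 * ddot a a + w.2 * ddot a b = ddot U a ->
  w.1 * ddot a b + w.2 * ddot b b = ddot U b -> w = wfield a b U.
Proof.
case: w => w1 w2 /= g0 e1 e2; rewrite /wfield -e1 -e2 /gdet in g0 *.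
by congr (_, _); field; exact: g0.
Qed.

(* Change of parametrization: [a = t00 a' + t10 b'], [b = t01 a' + t11 b']. *)
Lemma gdet_change (t00 t01 t10 t11 : R) a' b' :
  gdet (fun k => t00 * a' k + t10 * b' k) (fun k => t01 * a' k + t11 * b' k) =
  (t00 * t11 - t01 * t10) ^+ 2 * gdet a' b'.
Proof. by rewrite /gdet /ddot; ring. Qed.

(** The transformed components solve the normal equations of the new frame, and these have only one
    solution. *)
Lemma wfield_change (t00 t01 t10 t11 : R) a b a' b' U :
  a = (fun k => t00 * a' k + t10 * b' k) -> b = (fun k => t01 * a' k + t11 * b' k) ->
  gdet a b != 0 ->
  wfield a' b' U = (t00 * (wfield a b U).1 + t01 * (wfield a b U).2,
                    t10 * (wfield a b U).1 + t11 * (wfield a b U).2).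
Proof.
move=> ea eb g0; have [n1 n2] := wfield_normal U g0.
set w := wfield a b U in n1 n2 *.
have := g0; rewrite ea eb gdet_change mulf_eq0 negb_or sqrf_eq0 => /andP[t0 g'].
have dl (p q : R) x y z : ddot (fun k => p * x k + q * y k) z = p * ddot x z + q * ddot y z.
  by rewrite /ddot; ring.
have dr (p q : R) x y z : ddot z (fun k => p * x k + q * y k) = p * ddot z x + q * ddot z y.
  by rewrite /ddot; ring.
have sy x y : ddot x y = ddot y x by rewrite /ddot; ring.
rewrite ea eb !dl !dr (sy b' a') in n1 n2.
clearbody w; apply/esym/wfield_unique => //=.
- set P := ddot a' a' in n1 n2 *; set Q := ddot a' b' in n1 n2 *.
  set S := ddot b' b' in n1 n2 *; set c := ddot U a' in n1 n2 *; set d := ddot U b' in n1 n2 *.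
  apply: (mulfI t0).
  have E : (t00 * t11 - t01 * t10) * c = t11 * (t00 * c + t10 * d) - t10 * (t01 * c + t11 * d) by ring.
  by rewrite E -n1 -n2; ring.
- set P := ddot a' a' in n1 n2 *; set Q := ddot a' b' in n1 n2 *.
  set S := ddot b' b' in n1 n2 *; set c := ddot U a' in n1 n2 *; set d := ddot U b' in n1 n2 *.
  apply: (mulfI t0).
  have E : (t00 * t11 - t01 * t10) * d = t00 * (t01 * c + t11 * d) - t01 * (t00 * c + t10 * d) by ring.
  by rewrite E -n1 -n2; ring.
Qed.

(** [v] is the orthogonal projection of [U], so the difference of the two sides is the square of U -
    v. *)
Lemma wfield_bound a b U (w := wfield a b U) (v := fun k => w.1 * a k + w.2 * b k) :
  gdet a b != 0 -> ddot v v <= ddot U U.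
Proof.
move=> g0; have [n1 n2] := wfield_normal U g0; rewrite -/w in n1 n2.
have sy x y : ddot x y = ddot y x by rewrite /ddot; ring.
have E : ddot U v = ddot v v.
  have -> : ddot U v = w.1 * ddot U a + w.2 * ddot U b by rewrite /v /ddot; ring.
  by rewrite -n1 -n2 /v /ddot; ring.
rewrite -subr_ge0.
have -> : ddot U U - ddot v v = ddot (fun k => U k - v k) (fun k => U k - v k).
  have -> : ddot (fun k => U k - v k) (fun k => U k - v k) = ddot U U - 2 * ddot U v + ddot v v.
    by rewrite /ddot; ring.
  by rewrite E; ring.
by rewrite /ddot !addr_ge0 // -expr2 sqr_ge0.
Qed.

(* The divergence of the tangential part of [U] is the tangential trace of [DU]
   plus the normal part of [U] against the mean curvature vector. *)
Lemma divergence_identity (a b a0 a1 b1 U U0 U1 : 'I_3 -> R) (w00 w01 w10 w11 : R) (H : R) :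
  gdet a b != 0 ->
  let w := wfield a b U in let D := gdet a b in let n := cross a b in
  let E0 := 2 * ddot a a0 in let E1 := 2 * ddot a a1 in
  let F0 := ddot a0 b + ddot a a1 in let F1 := ddot a1 b + ddot a b1 in
  let G0 := 2 * ddot b a1 in let G1 := 2 * ddot b b1 in
  let D0 := E0 * ddot b b + ddot a a * G0 - 2 * ddot a b * F0 in
  let D1 := E1 * ddot b b + ddot a a * G1 - 2 * ddot a b * F1 in
  w00 * ddot a a + w10 * ddot a b + w.1 * E0 + w.2 * F0 = ddot U0 a + ddot U a0 ->
  w00 * ddot a b + w10 * ddot b b + w.1 * F0 + w.2 * G0 = ddot U0 b + ddot U a1 ->
  w01 * ddot a a + w11 * ddot a b + w.1 * E1 + w.2 * F1 = ddot U1 a + ddot U a1 ->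
  w01 * ddot a b + w11 * ddot b b + w.1 * F1 + w.2 * G1 = ddot U1 b + ddot U b1 ->
  ddot b b * ddot n a0 - 2 * ddot a b * ddot n a1 + ddot a a * ddot n b1 = D * H ->
  D * (w00 + w11) + (w.1 * D0 + w.2 * D1) / 2 =
  ddot b b * ddot U0 a - ddot a b * ddot U0 b - ddot a b * ddot U1 a + ddot a a * ddot U1 b
  + ddot U n * H.
Proof.
move=> g0 w D n E0 E1 F0 F1 G0 G1 D0 D1 e00 e01 e10 e11 mc.
have [n1 n2] := wfield_normal U g0; rewrite -/w in n1 n2.
move: w n1 n2 e00 e01 e10 e11 => w n1 n2 e00 e01 e10 e11.
(* The normal part of [U]. Orthogonal to [a] and [b], it is a multiple of [n] (this is [vn]), which
   is what turns the remaining second derivatives of the chart into the term with [H]. *)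
pose v k := U k - w.1 * a k - w.2 * b k.
have sy x y : ddot x y = ddot y x by rewrite /ddot; ring.
have vx x : ddot v x = ddot U x - w.1 * ddot a x - w.2 * ddot b x by rewrite /v /ddot; ring.
have va : ddot v a = 0 by rewrite vx -n1 (sy b a); ring.
have vb : ddot v b = 0 by rewrite vx -n2; ring.
have T : D * (w00 + w11) = ddot b b * (ddot U0 a + ddot U a0 - w.1 * E0 - w.2 * F0)
    - ddot a b * (ddot U0 b + ddot U a1 - w.1 * F0 - w.2 * G0)
    - ddot a b * (ddot U1 a + ddot U a1 - w.1 * E1 - w.2 * F1)
    + ddot a a * (ddot U1 b + ddot U b1 - w.1 * F1 - w.2 * G1).
  by rewrite -e00 -e01 -e10 -e11 /D /gdet; ring.
have vn x : D * ddot v x = ddot v n * ddot n x + (ddot b b * ddot v a - ddot a b * ddot v b) * ddot a x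
    + (ddot a a * ddot v b - ddot a b * ddot v a) * ddot b x.
  by rewrite /D /gdet /n /ddot /cross /=; ring.
have vnU : ddot v n = ddot U n.
  by rewrite /v /n /ddot /cross /=; ring.
have key : ddot b b * ddot v a0 - 2 * ddot a b * ddot v a1 + ddot a a * ddot v b1 = ddot U n * H.
  apply: (mulfI g0); rewrite -/D.
  have -> : D * (ddot b b * ddot v a0 - 2 * ddot a b * ddot v a1 + ddot a a * ddot v b1) =
     ddot b b * (D * ddot v a0) - 2 * ddot a b * (D * ddot v a1) + ddot a a * (D * ddot v b1) by ring.
  rewrite !vn va vb vnU.
  have -> : D * (ddot U n * H) = ddot U n * (D * H) by ring.
  by rewrite -mc; ring.
rewrite T -key.
rewrite (_ : (w.1 * D0 + w.2 * D1) / 2 = w.1 * (D0 / 2) + w.2 * (D1 / 2)); last by ring.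
have -> : D0 / 2 = ddot a a0 * ddot b b + ddot a a * ddot b a1 - ddot a b * F0 by rewrite /D0 /E0 /G0; field.
have -> : D1 / 2 = ddot a a1 * ddot b b + ddot a a * ddot b b1 - ddot a b * F1 by rewrite /D1 /E1 /G1; field.
rewrite !vx /E0 /E1 /F0 /F1 /G0 /G1.
rewrite (sy a0 b) (sy a1 b).
ring.
Qed.

End ChartAlgebra.

Lemma det_mx2 (R : comPzRingType) (M : 'M[R]_2) : \det M = M 0 0 * M 1 1 - M 0 1 * M 1 0.
Proof.
rewrite (expand_det_row _ 0) sum_ord2 /cofactor !det_mx11 !mxE /= expr0 mul1r expr1.
have -> : lift (0 : 'I_2) (0 : 'I_1) = 1 by apply: val_inj.
have -> : lift (1 : 'I_2) (0 : 'I_1) = 0 by apply: val_inj.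
by rewrite mulN1r mulrN.
Qed.

Lemma ord2P (i : 'I_2) : i = 0 \/ i = 1.
Proof. by case: i => [[|[|//]] h]; [left|right]; apply: val_inj. Qed.

Lemma ord3P (i : 'I_3) : [\/ i = 0, i = 1 | i = ord_max].
Proof. by case: i => [[|[|[|//]]] h]; [constructor 1|constructor 2|constructor 3]; apply: val_inj. Qed.

Lemma invmx2 (F : fieldType) (M : 'M[F]_2) (a b c : F) :
  M 0 0 = a -> M 0 1 = b -> M 1 0 = b -> M 1 1 = c -> a * c - b ^+ 2 != 0 ->
  invmx M = (a * c - b ^+ 2)^-1 *: \matrix_(i, j)
    (if i == 0 then if j == 0 then c else - b else if j == 0 then - b else a).
Proof.
move=> e00 e01 e10 e11 D0; set N := _ *: _.
have NM : N *m M = 1%:M.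
  have NE i j : N i j = (a * c - b ^+ 2)^-1 *
    (if i == 0 then if j == 0 then c else - b else if j == 0 then - b else a) by rewrite !mxE.
  apply/matrixP => i j; rewrite mxE sum_ord2 !NE [1%:M _ _]mxE.
  by case: (ord2P i) => ->; case: (ord2P j) => ->; rewrite /= ?e00 ?e01 ?e10 ?e11;
    field; exact: D0.
have [Nu Mu] := mulmx1_unit NM.
by rewrite -[LHS]mul1mx -NM -mulmxA mulmxV // mulmx1.
Qed.

(** * Metric and translator equation in a chart *)

Section Chart.
Variables (R : realType) (S : immersed_surface R).

Definition comp (n : nat) (k : 'I_3) (u : R * R) : R := lpar S n u 0 k.
Definition Da n u (k : 'I_3) : R := pder 0 (comp n k) u.
Definition Db n u (k : 'I_3) : R := pder 1 (comp n k) u.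
Definition dg n u : R := gdet (Da n u) (Db n u).

Lemma entry_cts (m n : nat) (i : 'I_m) (j : 'I_n) : continuous (fun M : 'M[R]_(m, n) => M i j).
Proof. exact: coord_continuous. Qed.

Lemma comp_Ck n k j : Ck_on j (dom S n) (comp n k).
Proof.
apply: (@Ck_on_proj R _ (fun v : 'rV[R]_3 => v 0 k) _ _ _ (dom S n) (lpar S n)).
- by move=> x y; rewrite !mxE.
- by move=> a x; rewrite !mxE.
- exact: entry_cts.
- exact: dom_open.
- exact: imm_smooth.
Qed.

Lemma comp_is_derive k i (f : R * R -> 'rV[R]_3) u : derivable f u (axis R i) ->
  is_derive u (axis R i) (fun v => f v 0 k) (pder i f u 0 k).
Proof.
move=> d; apply: (@derive_proj R _ (fun v : 'rV[R]_3 => v 0 k) _ _ _ _ f u (axis R i) d).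
- by move=> x y; rewrite !mxE.
- by move=> a x; rewrite !mxE.
- exact: entry_cts.
Qed.

Lemma comp_pder n k i u : dom S n u -> pder i (lpar S n) u 0 k = pder i (comp n k) u.
Proof.
move=> Uu; have [_ /(_ i)[d _]] := @imm_smooth R S n 1%N.
by have H := comp_is_derive k (d u Uu); rewrite -(@derive_val _ _ _ _ _ _ _ H).
Qed.

Lemma comp_pder2 n k i j u : dom S n u ->
  pder i (pder j (lpar S n)) u 0 k = pder i (pder j (comp n k)) u.
Proof.
move=> Uu; have [_ /(_ j)[_ [_ /(_ i)[d _]]]] := @imm_smooth R S n 2%N.
have H := comp_is_derive k (d u Uu); rewrite -(@derive_val _ _ _ _ _ _ _ H).
apply: near_eq_derive; apply: near_open Uu _; first exact: dom_open.
by move=> v Uv; exact: comp_pder.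
Qed.

Lemma comp_sdiff n k u : dom S n u -> sdiff (comp n k) u (Da n u k, Db n u k).
Proof. by move=> Uu; exact: (Ck_on_sdiff (@dom_open R S n) Uu (comp_Ck n k 1)). Qed.

Lemma Da_sdiff n k u : dom S n u ->
  sdiff (fun v => Da n v k) u (pder 0 (Da n ^~ k) u, pder 1 (Da n ^~ k) u).
Proof.
move=> Uu; have h : Ck_on 1 (dom S n) (pder 0 (comp n k)) by have [_ /(_ 0)[]] := comp_Ck n k 2.
exact: (Ck_on_sdiff (@dom_open R S n) Uu h).
Qed.

Lemma Db_sdiff n k u : dom S n u ->
  sdiff (fun v => Db n v k) u (pder 0 (Db n ^~ k) u, pder 1 (Db n ^~ k) u).
Proof.
move=> Uu; have h : Ck_on 1 (dom S n) (pder 1 (comp n k)) by have [_ /(_ 1)[]] := comp_Ck n k 2.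
exact: (Ck_on_sdiff (@dom_open R S n) Uu h).
Qed.

Lemma DaDb_mixed n k u : dom S n u -> pder 0 (Db n ^~ k) u = pder 1 (Da n ^~ k) u.
Proof. by move=> Uu; apply: (mixed_partials (@dom_open R S n) Uu); exact: (comp_Ck n k 2). Qed.

Lemma jacobian0 n u k : dom S n u -> Defs.jacobian (lpar S n) u 0 k = Da n u k.
Proof. by move=> Uu; rewrite mxE comp_pder. Qed.

Lemma jacobian1 n u k : dom S n u -> Defs.jacobian (lpar S n) u 1 k = Db n u k.
Proof. by move=> Uu; rewrite mxE comp_pder. Qed.

Lemma gramE n u : dom S n u ->
  [/\ gram S n u 0 0 = ddot (Da n u) (Da n u), gram S n u 0 1 = ddot (Da n u) (Db n u),
      gram S n u 1 0 = ddot (Da n u) (Db n u) & gram S n u 1 1 = ddot (Db n u) (Db n u)].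
Proof.
move=> Uu; set J := Defs.jacobian (lpar S n) u.
have tE i j : J^T i j = J j i by rewrite mxE.
have gE i j : gram S n u i j = J i 0 * J j 0 + J i 1 * J j 1 + J i ord_max * J j ord_max.
  by rewrite /gram -/J mxE sum_ord3 !tE.
have J0 k : J 0 k = Da n u k by exact: jacobian0.
have J1 k : J 1 k = Db n u k by exact: jacobian1.
rewrite !gE !J0 !J1; split; [reflexivity|reflexivity| |reflexivity].
by clear; move: (Da n u) (Db n u) => f g; rewrite /ddot; ring.
Qed.

Lemma det_gram n u : dom S n u -> \det (gram S n u) = dg n u.
Proof. by move=> Uu; rewrite det_mx2; have [-> -> -> ->] := gramE Uu; rewrite /dg /gdet expr2. Qed.

(** If the cross product vanished, the combinations b_j a - a_j b would vanish for every j.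
    Independence of the rows of the Jacobian then forces each a_j to be zero, which contradicts
    independence once more. *)
Lemma dg_gt0 n u : dom S n u -> 0 < dg n u.
Proof.
move=> Uu; set a := Da n u; set b := Db n u.
rewrite lt_neqAle; apply/andP; split; last first.
  by rewrite /dg lagrange /ddot !addr_ge0 // -expr2 sqr_ge0.
apply/eqP => D0.
have rk : row_free (Defs.jacobian (lpar S n) u) by rewrite /row_free (imm_immersion Uu).
have c0 k : cross a b k = 0.
  move: D0; rewrite /dg lagrange -/a -/b /ddot => /esym/eqP.
  rewrite !paddr_eq0 ?addr_ge0 -?expr2 ?sqr_ge0 // !sqrf_eq0.
  by move=> /andP[/andP[/eqP h0 /eqP h1] /eqP h2]; case: (ord3P k) => ->.
have ker (p q : R) : (forall k, p * a k + q * b k = 0) -> p = 0.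
  move=> h; pose v : 'rV[R]_2 := \row_j (if j == 0 then p else q).
  have /(row_free_inj rk) : v *m Defs.jacobian (lpar S n) u = 0 *m Defs.jacobian (lpar S n) u.
    rewrite mul0mx; apply/rowP => k.
    by rewrite mxE sum_ord2 jacobian0 // jacobian1 // ![v _ _]mxE /= -/a -/b h mxE.
  by move=> /matrixP /(_ 0 0); rewrite !mxE.
have ker2 (p q : R) : (forall k, p * a k + q * b k = 0) -> q = 0.
  move=> h; pose v : 'rV[R]_2 := \row_j (if j == 0 then p else q).
  have /(row_free_inj rk) : v *m Defs.jacobian (lpar S n) u = 0 *m Defs.jacobian (lpar S n) u.
    rewrite mul0mx; apply/rowP => k.
    by rewrite mxE sum_ord2 jacobian0 // jacobian1 // ![v _ _]mxE /= -/a -/b h mxE.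
  by move=> /matrixP /(_ 0 1); rewrite !mxE.
have ak0 j : a j = 0.
  suff h : - a j = 0 by apply/eqP; rewrite -oppr_eq0 h.
  apply: (ker2 (b j)) => k; have := c0 0; have := c0 1; have := c0 ord_max.
  rewrite /cross /=; move: (a) (b) => f g h0 h1 h2.
  have [-> | -> | ->] := ord3P j; have [-> | -> | ->] := ord3P k;
    first [by ring | by rewrite -h0; ring | by rewrite -h1; ring | by rewrite -h2; ring
      | by apply: oppr_inj; rewrite oppr0 -h0; ring | by apply: oppr_inj; rewrite oppr0 -h1; ring
      | by apply: oppr_inj; rewrite oppr0 -h2; ring].
by have /eqP := ker 1 0 (fun k => etrans (congr2 _ (congr1 _ (ak0 k)) (mul0r _)) (etrans (addr0 _) (mulr0 _))); rewrite oner_eq0.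
Qed.

Lemma invmx_gram n u : dom S n u ->
  invmx (gram S n u) = (dg n u)^-1 *: \matrix_(i, j)
    (if i == 0 then if j == 0 then ddot (Db n u) (Db n u) else - ddot (Da n u) (Db n u)
     else if j == 0 then - ddot (Da n u) (Db n u) else ddot (Da n u) (Da n u)).
Proof.
move=> Uu; have D0 : dg n u != 0 by rewrite gt_eqF // dg_gt0.
rewrite /dg /gdet in D0 *.
by have [e00 e01 e10 e11] := gramE Uu; rewrite (invmx2 e00 e01 e10 e11 D0).
Qed.

Hypothesis mc : forall n u, dom S n u -> mean_curvature S n u = normal_proj S n u (e3 R).

(** The vector equation is paired with the normal [nn], which the Jacobian kills. All tangential
    projections then drop out, and only the inverse Gram matrix and the second derivatives remain;
    both sides are multiplied by the Gram determinant. *)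
Lemma translator_scalar n u : dom S n u ->
  let a := Da n u in let b := Db n u in let nn := cross a b in
  ddot b b * ddot nn (fun k => pder 0 (Da n ^~ k) u)
  - 2 * ddot a b * ddot nn (fun k => pder 1 (Da n ^~ k) u)
  + ddot a a * ddot nn (fun k => pder 1 (Db n ^~ k) u) = dg n u * nn ord_max.
Proof.
move=> Uu a b nn; have D0 : dg n u != 0 by rewrite gt_eqF // dg_gt0.
pose nv : 'cV[R]_3 := \col_k nn k.
have nvE k j : nv k j = nn k by rewrite mxE.
have Jn : Defs.jacobian (lpar S n) u *m nv = 0.
  apply/matrixP => i j; rewrite mxE sum_ord3 !nvE [RHS]mxE.
  have [-> | ->] := ord2P i.
    by rewrite !(jacobian0 _ Uu) -/a /nn /cross /=; ring.
  by rewrite !(jacobian1 _ Uu) -/b /nn /cross /=; ring.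
have np v : normal_proj S n u v *m nv = v *m nv.
  by rewrite /normal_proj mulmxBl /tangent_proj -!mulmxA Jn !mulmx0 subr0.
have dt (v : 'rV[R]_3) : (v *m nv) 0 0 = ddot nn (v 0).
  by rewrite mxE sum_ord3 !nvE /ddot !(mulrC (nn _)).
have dE (v : 'rV[R]_3) (f : 'I_3 -> R) : (forall k, v 0 k = f k) -> ddot nn (v 0) = ddot nn f.
  by move=> h; rewrite /ddot !h.
have := congr1 (fun v => (v *m nv) 0 0) (mc Uu).
rewrite /= np (dt (e3 R)) (_ : ddot nn (e3 R 0) = nn ord_max); last first.
  by rewrite /ddot /e3 !mxE /=; ring.
have sc (x : R) (v : 'rV[R]_3) : ((x *: v) *m nv) 0 0 = x * (v *m nv) 0 0.
  by rewrite -scalemxAl mxE.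
have ad (v v' : 'rV[R]_3) : ((v + v') *m nv) 0 0 = (v *m nv) 0 0 + (v' *m nv) 0 0.
  by rewrite mulmxDl mxE.
have sf i j (f : 'I_3 -> R) : (forall k, pder i (pder j (comp n k)) u = f k) ->
    (second_form S n u i j *m nv) 0 0 = ddot nn f.
  by move=> h; rewrite /second_form np dt; apply: dE => k; rewrite comp_pder2.
have s00 := sf 0 0 (fun k => pder 0 (Da n ^~ k) u) (fun k => erefl).
have s01 := sf 0 1 (fun k => pder 1 (Da n ^~ k) u) (fun k => DaDb_mixed k Uu).
have s10 := sf 1 0 (fun k => pder 1 (Da n ^~ k) u) (fun k => erefl).
have s11 := sf 1 1 (fun k => pder 1 (Db n ^~ k) u) (fun k => erefl).
have lin (A : 'M[R]_2) (f : 'I_2 -> 'I_2 -> 'rV[R]_3) c00 c01 c10 c11 t00 t01 t10 t11 :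
    (A 0 0 = c00) -> (A 0 1 = c01) -> (A 1 0 = c10) -> (A 1 1 = c11) ->
    (f 0 0 *m nv) 0 0 = t00 -> (f 0 1 *m nv) 0 0 = t01 ->
    (f 1 0 *m nv) 0 0 = t10 -> (f 1 1 *m nv) 0 0 = t11 ->
    ((\sum_i \sum_j A i j *: f i j) *m nv) 0 0 = (c00 * t00 + c01 * t01) + (c10 * t10 + c11 * t11).
  by move=> <- <- <- <- <- <- <- <-; rewrite !sum_ord2 !ad !sc.
have iE i j : invmx (gram S n u) i j = (dg n u)^-1 *
    (if i == 0 then if j == 0 then ddot b b else - ddot a b
     else if j == 0 then - ddot a b else ddot a a).
  by rewrite (invmx_gram Uu) !mxE.
rewrite /mean_curvature (lin _ _ _ _ _ _ _ _ _ _ (iE 0 0) (iE 0 1) (iE 1 0) (iE 1 1) s00 s01 s10 s11).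
have fin (D P Q T X Y Z : R) : D != 0 -> T * X - 2 * Q * Y + P * Z =
    D * (D^-1 * T * X + D^-1 * - Q * Y + (D^-1 * - Q * Y + D^-1 * P * Z)).
  by move=> h; field.
by rewrite /= => <-; apply: fin.
Qed.

End Chart.

(** * The tangential field, the weighted density and their divergence in a chart *)

Section FieldInChart.
Variable R : realType.

Lemma sdiff_unique (f : R * R -> R) u c d : sdiff f u c -> sdiff f u d -> c = d.
Proof.
move=> h k; rewrite [c]surjective_pairing [d]surjective_pairing.
by rewrite -(sdiff_pder0 h) -(sdiff_pder1 h) (sdiff_pder0 k) (sdiff_pder1 k).
Qed.

Lemma sdiffN (f : R * R -> R) u d : sdiff f u d -> sdiff (fun x => - f x) u (- d.1, - d.2).
Proof.
move=> h e e0; have [r r0 hr] := h e e0; exists r => // a b ar br.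
have := hr a b ar br; rewrite -[X in X <= _ -> _]normrN; congr (`|_| <= _).
by rewrite /=; ring.
Qed.

Lemma ddot_sdiff (f g : R * R -> 'I_3 -> R) u (f0 f1 g0 g1 : 'I_3 -> R) :
  (forall k, sdiff (f ^~ k) u (f0 k, f1 k)) -> (forall k, sdiff (g ^~ k) u (g0 k, g1 k)) ->
  sdiff (fun v => ddot (f v) (g v)) u
    (ddot (f u) g0 + ddot (g u) f0, ddot (f u) g1 + ddot (g u) f1).
Proof.
move=> hf hg.
have := sdiffD (sdiffD (sdiffM (hf 0) (hg 0)) (sdiffM (hf 1) (hg 1)))
  (sdiffM (hf ord_max) (hg ord_max)).
congr (sdiff _ _ _); congr (_, _); rewrite /ddot /=.
- by move: (f u) (g u) => x y; ring.
- by move: (f u) (g u) => x y; ring.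
Qed.

Lemma sdiff1_inv (x : R) : x != 0 -> sdiff1 (fun y => y^-1) x (- x ^- 2).
Proof.
move=> x0; apply: (@sdiff1_C1 R _ (fun y => - y ^- 2) x `|x|).
- by rewrite normr_gt0.
- move=> y yx; have y0 : y != 0.
    by apply: contraTneq yx => ->; rewrite sub0r normrN ltxx.
  have := is_deriveV y0 (is_derive_id y (1 : R)).
  by rewrite /GRing.scale /= mulr1.
- have h : (fun y : R => y ^- 2) z @[z --> x] --> x ^- 2.
    by apply: cvgV; [rewrite expf_neq0|exact: exprn_continuous].
  exact: cvgN h.
Qed.

Lemma sdiff1_sqrt (x : R) : 0 < x -> sdiff1 Num.sqrt x (2 * Num.sqrt x)^-1.
Proof.
move=> x0; apply: (@sdiff1_C1 R _ (fun y => (2 * Num.sqrt y)^-1) x x) => //.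
- move=> y; rewrite ltr_norml => /andP[h _]; apply: is_derive1_sqrt.
  by move: h; rewrite ltrBDl addrN.
- apply: cvgV; first by rewrite mulf_neq0 // gt_eqF // sqrtr_gt0.
  by apply: (@cvgM _ _ _ _ (fun=> 2) Num.sqrt 2 (Num.sqrt x)); [exact: cvg_cst|exact: sqrt_continuous].
Qed.

Lemma sdiff1_exp (x : R) : sdiff1 expR x (expR x).
Proof.
by apply: (@sdiff1_C1 R _ expR x 1) => //; exact: continuous_expR.
Qed.

Variable S : immersed_surface R.
Hypothesis mc : forall n u, dom S n u -> mean_curvature S n u = normal_proj S n u (e3 R).
Variables (uf duf : 'I_3 -> R -> R) (kappa beta delta : R) (uslab : set R).
Hypothesis uf1 : forall k x, sdiff1 (uf k) x (duf k x).

Definition UU n (u : R * R) (k : 'I_3) : R := uf k (comp S n 0 u).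
Definition wf n (u : R * R) : R * R := wfield (Da S n u) (Db S n u) (UU n u).
(** Volume element times weight. With it, the planar divergence of [rho] times [wf] is [rho] times
    the weighted divergence on the surface. *)
Definition rho n (u : R * R) : R :=
  Num.sqrt (dg S n u) * expR (- kappa * (comp S n ord_max u + beta * comp S n 1 u)).

Lemma rho_gt0 n u : dom S n u -> 0 < rho n u.
Proof. by move=> Uu; rewrite mulr_gt0 ?expR_gt0 ?sqrtr_gt0 ?dg_gt0. Qed.

Lemma UU_sdiff n k u : dom S n u ->
  sdiff (fun v => UU n v k) u (duf k (comp S n 0 u) * Da S n u 0, duf k (comp S n 0 u) * Db S n u 0).
Proof. by move=> Uu; exact: (sdiff_comp1 (comp_sdiff 0 Uu) (uf1 k (comp S n 0 u))). Qed.

Lemma wf_rho_sdiff n u : dom S n u -> exists a0 a1 c,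
  [/\ sdiff (fst \o wf n) u a0, sdiff (snd \o wf n) u a1 & sdiff (rho n) u c].
Proof.
move=> Uu; set a := Da S n; set b := Db S n.
have sa k : sdiff (fun v => a v k) u _ := Da_sdiff k Uu.
have sb k : sdiff (fun v => b v k) u _ := Db_sdiff k Uu.
have sU k : sdiff (fun v => UU n v k) u _ := UU_sdiff k Uu.
have saa := ddot_sdiff sa sa; have sab := ddot_sdiff sa sb; have sbb := ddot_sdiff sb sb.
have sUa := ddot_sdiff sU sa; have sUb := ddot_sdiff sU sb.
have sD : exists d, sdiff (dg S n) u d.
  eexists; rewrite /dg /gdet.
  exact: (sdiffD (sdiffM saa sbb) (sdiffN (sdiffM sab sab))).
have [dD {}sD] := sD.
have D0 := dg_gt0 Uu.
have D1 : dg S n u != 0 by rewrite gt_eqF.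
have sV := sdiff_comp1 sD (sdiff1_inv D1).
have sS := sdiff_comp1 sD (sdiff1_sqrt D0).
have sE := sdiff_comp1 (sdiffM (sdiff_cst (- kappa) u)
  (sdiffD (comp_sdiff ord_max Uu) (sdiffM (sdiff_cst beta u) (comp_sdiff 1 Uu)))) (sdiff1_exp _).
eexists; eexists; eexists; split.
- exact: (sdiffM (sdiffD (sdiffM sbb sUa) (sdiffN (sdiffM sab sUb))) sV).
- exact: (sdiffM (sdiffD (sdiffM saa sUb) (sdiffN (sdiffM sab sUa))) sV).
- exact: (sdiffM sS sE).
Qed.

Lemma dg_sdiff n u : dom S n u ->
  let a := Da S n u in let b := Db S n u in
  let a0 k := pder 0 (Da S n ^~ k) u in let a1 k := pder 1 (Da S n ^~ k) u in
  let b1 k := pder 1 (Db S n ^~ k) u in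
  sdiff (dg S n) u
    (2 * ddot a a0 * ddot b b + ddot a a * (2 * ddot b a1) - 2 * ddot a b * (ddot a0 b + ddot a a1),
     2 * ddot a a1 * ddot b b + ddot a a * (2 * ddot b b1) - 2 * ddot a b * (ddot a1 b + ddot a b1)).
Proof.
move=> Uu a b a0 a1 b1.
have sa k : sdiff (fun v => Da S n v k) u (a0 k, a1 k) := Da_sdiff k Uu.
have sb k : sdiff (fun v => Db S n v k) u (a1 k, b1 k).
  by have := Db_sdiff k Uu; rewrite DaDb_mixed.
have saa := ddot_sdiff sa sa; have sab := ddot_sdiff sa sb; have sbb := ddot_sdiff sb sb.
have := sdiffD (sdiffM saa sbb) (sdiffN (sdiffM sab sab)).
have E : (fun v => ddot (Da S n v) (Da S n v) * ddot (Db S n v) (Db S n v) +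
   - (ddot (Da S n v) (Db S n v) * ddot (Da S n v) (Db S n v))) = dg S n.
  by apply/funext => v; rewrite /dg /gdet expr2.
rewrite E; congr (sdiff _ _ _).
have fin (x0 y z : 'I_3 -> R) : forall f g : 'I_3 -> R,
    ddot f f * (ddot g x0 + ddot g x0) + ddot g g * (ddot f y + ddot f y)
    - (ddot f g * (ddot f x0 + ddot g y) + ddot f g * (ddot f x0 + ddot g y)) =
    2 * ddot f y * ddot g g + ddot f f * (2 * ddot g x0) - 2 * ddot f g * (ddot y g + ddot f x0).
  move=> f g; have -> : ddot y g = ddot g y by rewrite /ddot; ring.
  by ring.
by rewrite /=; congr (_, _); exact: fin.
Qed.

Lemma rho_sdiff n u dD : dom S n u -> sdiff (dg S n) u dD ->
  sdiff (rho n) u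
    (rho n u * (dD.1 / (2 * dg S n u) - kappa * (Da S n u ord_max + beta * Da S n u 1)),
     rho n u * (dD.2 / (2 * dg S n u) - kappa * (Db S n u ord_max + beta * Db S n u 1))).
Proof.
move=> Uu sD.
have D0 := dg_gt0 Uu.
have sS := sdiff_comp1 sD (sdiff1_sqrt D0).
have sE := sdiff_comp1 (sdiffM (sdiff_cst (- kappa) u)
  (sdiffD (comp_sdiff ord_max Uu) (sdiffM (sdiff_cst beta u) (comp_sdiff 1 Uu)))) (sdiff1_exp _).
have := sdiffM sS sE; congr (sdiff _ _ _); rewrite /rho /=.
have fin (d D e x y f g : R) : 0 < D ->
  Num.sqrt D * (e * (- kappa * (x + (beta * y + f * 0)) + g * 0))
    + e * ((2 * Num.sqrt D)^-1 * d) =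
  Num.sqrt D * e * (d / (2 * D) - kappa * (x + beta * y)).
  move=> h; have s0 : Num.sqrt D != 0 by rewrite gt_eqF // sqrtr_gt0.
  by rewrite -[in RHS](sqr_sqrtr (ltW h)) ![Num.sqrt (_ ^+ 2)]sqrtr_sqr ger0_norm ?sqrtr_ge0 //; field.
by congr (_, _); exact: fin.
Qed.

(** Pointwise algebra. The four long equations are the differentiated normal equations of [w], and
    the next one is the translator equation. After division by the density and multiplication by the
    Gram determinant, which equals [s], [divergence_identity] gives the unweighted part of the form
    and [tang] the part with [kappa]. *)
Lemma divergence_bound (a b p0 p1 q1 U dU : 'I_3 -> R) (w00 w01 w10 w11 r : R) :
  0 < gdet a b -> 0 < r ->
  let w := wfield a b U in let m := cross a b in let s := ddot m m in let q := ddot U m in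
  let D0 := 2 * ddot a p0 * ddot b b + ddot a a * (2 * ddot b p1)
    - 2 * ddot a b * (ddot p0 b + ddot a p1) in
  let D1 := 2 * ddot a p1 * ddot b b + ddot a a * (2 * ddot b q1)
    - 2 * ddot a b * (ddot p1 b + ddot a q1) in
  w.1 * (ddot a p0 + ddot a p0) + ddot a a * w00 + (w.2 * (ddot a p1 + ddot b p0) + ddot a b * w10)
    = ddot U p0 + ddot a (fun k => dU k * a 0) ->
  w.1 * (ddot a p1 + ddot a p1) + ddot a a * w01 + (w.2 * (ddot a q1 + ddot b p1) + ddot a b * w11)
    = ddot U p1 + ddot a (fun k => dU k * b 0) ->
  w.1 * (ddot a p1 + ddot b p0) + ddot a b * w00 + (w.2 * (ddot b p1 + ddot b p1) + ddot b b * w10)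
    = ddot U p1 + ddot b (fun k => dU k * a 0) ->
  w.1 * (ddot a q1 + ddot b p1) + ddot a b * w01 + (w.2 * (ddot b q1 + ddot b q1) + ddot b b * w11)
    = ddot U q1 + ddot b (fun k => dU k * b 0) ->
  ddot b b * ddot m p0 - 2 * ddot a b * ddot m p1 + ddot a a * ddot m q1 = gdet a b * m ord_max ->
  delta * s <= dU 0 * (s - m 0 ^+ 2) - dU 1 * (m 0 * m 1) - dU ord_max * (m 0 * m ord_max)
    + q * m ord_max
    - kappa * ((s * U ord_max - q * m ord_max) + beta * (s * U 1 - q * m 1)) ->
  delta * r <=
    r * (D0 / (2 * gdet a b) - kappa * (a ord_max + beta * a 1)) * w.1 +
    r * (D1 / (2 * gdet a b) - kappa * (b ord_max + beta * b 1)) * w.2 + r * (w00 + w11).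
Proof.
move=> g0 r0 w m s q D0 D1 e00 e01 e10 e11 mcs dp.
have g1 : gdet a b != 0 by rewrite gt_eqF.
have sE : s = gdet a b by rewrite lagrange.
have sy (x y : 'I_3 -> R) : ddot x y = ddot y x by rewrite /ddot; ring.
have := @divergence_identity R a b p0 p1 q1 U (fun k => dU k * a 0) (fun k => dU k * b 0)
  w00 w01 w10 w11 (m ord_max) g1.
rewrite -/w /= -/m => /(_ _ _ _ _ mcs) I.
have {}I := I _ _ _ _.
rewrite [delta * r]mulrC.
have -> : r * (D0 / (2 * gdet a b) - kappa * (a ord_max + beta * a 1)) * w.1 +
    r * (D1 / (2 * gdet a b) - kappa * (b ord_max + beta * b 1)) * w.2 + r * (w00 + w11) =
  r * (D0 / (2 * gdet a b) * w.1 + D1 / (2 * gdet a b) * w.2 + (w00 + w11)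
    - kappa * ((w.1 * a ord_max + w.2 * b ord_max) + beta * (w.1 * a 1 + w.2 * b 1))) by ring.
rewrite ler_pM2l // -(ler_pM2r g0) -sE.
apply: le_trans dp _; rewrite sE.
have tang k : (w.1 * a k + w.2 * b k) * gdet a b = s * U k - q * m k.
  rewrite sE /w /wfield /=.
  rewrite (_ : (_ * a k + _ * b k) * gdet a b = (ddot b b * ddot U a - ddot a b * ddot U b) * a k
    + (ddot a a * ddot U b - ddot a b * ddot U a) * b k); last by field.
  by rewrite /q /m /gdet /ddot /cross; have [-> | -> | ->] := ord3P k => /=; ring.
have -> : (D0 / (2 * gdet a b) * w.1 + D1 / (2 * gdet a b) * w.2 + (w00 + w11)
    - kappa * ((w.1 * a ord_max + w.2 * b ord_max) + beta * (w.1 * a 1 + w.2 * b 1))) * gdet a b =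
  gdet a b * (w00 + w11) + (w.1 * D0 + w.2 * D1) / 2
  - kappa * ((w.1 * a ord_max + w.2 * b ord_max) * gdet a b + beta * ((w.1 * a 1 + w.2 * b 1) * gdet a b)).
  by field.
rewrite !tang sE lerD2r.
rewrite /D0 /D1.
rewrite [X in _ <= X](_ : _ = ddot b b * ddot (fun k : 'I_3 => dU k * a 0) a -
    ddot a b * ddot (fun k : 'I_3 => dU k * a 0) b - ddot a b * ddot (fun k : 'I_3 => dU k * b 0) a +
    ddot a a * ddot (fun k : 'I_3 => dU k * b 0) b + ddot U m * m ord_max).
  rewrite lerD2r le_eqVlt; apply/orP; left; apply/eqP.
  rewrite -sE; rewrite /s /m /ddot /cross /=; ring.
rewrite -I; last 4 first.
- by rewrite (sy (fun k => dU k * a 0) a) [RHS]addrC -e00 (sy p0 b) /w /wfield /=; ring.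
- by rewrite (sy (fun k => dU k * a 0) b) [RHS]addrC -e10 (sy p0 b) /w /wfield /=; ring.
- by rewrite (sy (fun k => dU k * b 0) a) [RHS]addrC -e01 (sy p1 b) /w /wfield /=; ring.
- by rewrite (sy (fun k => dU k * b 0) b) [RHS]addrC -e11 (sy p1 b) /w /wfield /=; ring.
by rewrite /w /wfield /=; ring.
Qed.

Hypothesis delta_pos : forall (x : R) (m : 'I_3 -> R), uslab x ->
  let s := ddot m m in let q := ddot (uf ^~ x) m in
  delta * s <= duf 0 x * (s - m 0 ^+ 2) - duf 1 x * (m 0 * m 1) - duf ord_max x * (m 0 * m ord_max)
    + q * m ord_max
    - kappa * ((s * uf ord_max x - q * m ord_max) + beta * (s * uf 1 x - q * m 1)).

(** The derivatives of [wf] are never read off from its quotient formula. The normal equations hold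
    near [u], both of their sides are strictly differentiable, and uniqueness of the differential
    gives the relations that [divergence_bound] wants. *)
Lemma div_ge n u a0 a1 c : dom S n u -> uslab (comp S n 0 u) ->
  sdiff (fst \o wf n) u a0 -> sdiff (snd \o wf n) u a1 -> sdiff (rho n) u c ->
  delta * rho n u <= (c.1 * (wf n u).1 + c.2 * (wf n u).2) + rho n u * (a0.1 + a1.2).
Proof.
move=> Uu xI s0 s1 sc.
pose p0 k := pder 0 (Da S n ^~ k) u; pose p1 k := pder 1 (Da S n ^~ k) u.
pose q1 k := pder 1 (Db S n ^~ k) u.
have sa k : sdiff (fun v => Da S n v k) u (p0 k, p1 k) := Da_sdiff k Uu.
have sb k : sdiff (fun v => Db S n v k) u (p1 k, q1 k).
  by have := Db_sdiff k Uu; rewrite DaDb_mixed.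
have sU k := UU_sdiff k Uu.
have saa := ddot_sdiff sa sa; have sab := ddot_sdiff sa sb; have sbb := ddot_sdiff sb sb.
have sUa := ddot_sdiff sU sa; have sUb := ddot_sdiff sU sb.
have gd v : dom S n v -> gdet (Da S n v) (Db S n v) != 0 by move=> Uv; rewrite gt_eqF // dg_gt0.
have /sdiff_unique /(_ sUa) e0 := sdiff_near
  (near_open (@dom_open R S n) Uu (fun v Uv => (wfield_normal (UU n v) (gd v Uv)).1))
  (sdiffD (sdiffM s0 saa) (sdiffM s1 sab)).
have /sdiff_unique /(_ sUb) e1 := sdiff_near
  (near_open (@dom_open R S n) Uu (fun v Uv => (wfield_normal (UU n v) (gd v Uv)).2))
  (sdiffD (sdiffM s0 sab) (sdiffM s1 sbb)).
have ec := sdiff_unique sc (rho_sdiff Uu (dg_sdiff Uu)).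
have mcs := translator_scalar mc Uu.
have := @divergence_bound (Da S n u) (Db S n u) p0 p1 q1 (UU n u)
  (fun k => duf k (comp S n 0 u)) a0.1 a0.2 a1.1 a1.2 (rho n u) (dg_gt0 Uu) (rho_gt0 Uu).
move=> /(_ (congr1 fst e0) (congr1 snd e0) (congr1 fst e1) (congr1 snd e1) mcs).
by move=> /(_ (delta_pos _ xI)); rewrite ec.
Qed.

End FieldInChart.

(** * The ambient field *)

Section AmbientField.
Variable R : realType.

Lemma binary_form_ge (h p K c x y : R) : 0 < h - c -> K ^+ 2 / 4 <= (h - c) * (p - c) ->
  c * (x ^+ 2 + y ^+ 2) <= h * x ^+ 2 + K * (x * y) + p * y ^+ 2.
Proof.
move=> hc d; rewrite -subr_ge0 -(pmulr_rge0 _ hc).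
have -> : (h - c) * (h * x ^+ 2 + K * (x * y) + p * y ^+ 2 - c * (x ^+ 2 + y ^+ 2)) =
  ((h - c) * x + K / 2 * y) ^+ 2 + ((h - c) * (p - c) - K ^+ 2 / 4) * y ^+ 2 by field.
by rewrite addr_ge0 ?sqr_ge0 // mulr_ge0 ?sqr_ge0 // subr_ge0.
Qed.

Lemma cross_term (e x y : R) : 0 < e -> - (e * x ^+ 2 + e^-1 * y ^+ 2) / 2 <= x * y.
Proof.
move=> e0; have e1 : e != 0 by rewrite gt_eqF.
rewrite -subr_ge0 (_ : _ - _ = (e * x + y) ^+ 2 / (2 * e)); last by field.
by rewrite divr_ge0 ?sqr_ge0 // mulr_ge0 // ltW.
Qed.

(* The matrix of this form is that of [pressure_form] for the field
   [(- g' / (1 + kappa), K, - g)] with [h = - g'']; the factor [1 / (1 + kappa)]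
   makes its [x z] coefficient vanish. *)
Lemma form_bound (B beta K eta : R) : 0 < eta -> 1 <= B -> exists kappa delta,
  [/\ 0 < kappa, 0 < delta & forall g g1 h x y z : R,
    `|g| <= B -> `|g1| <= B -> `|h| <= B -> eta <= g - beta * K -> eta <= h -> eta <= h - g ->
    K ^+ 2 / 4 + eta <= h * (h - g) ->
    delta * (x ^+ 2 + y ^+ 2 + z ^+ 2) <=
      kappa * (g - beta * K) * x ^+ 2 + (h / (1 + kappa) + kappa * g) * y ^+ 2
      + (h / (1 + kappa) - g - kappa * (beta * K)) * z ^+ 2
      - kappa * beta * (g1 / (1 + kappa)) * (x * y) + (K + kappa * (K - beta * g)) * (y * z)].
Proof.
move=> eta0 B1; have B0 : 0 < B by exact: lt_le_trans B1.
(* [c] is a lower bound for the eigenvalues of the binary form in [y] and [z] at [kappa = 0]. [C]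
   dominates, per unit of [kappa], everything that is lost in the coefficients of the squares of [y]
   and [z]; [kappa] is so small that this costs at most half of [c]. *)
pose c := eta / (4 * B).
have c0 : 0 < c by rewrite divr_gt0 // mulr_gt0.
pose C := 2 * B + `|beta * K| + (`|K| + `|beta| * B) + (beta * B) ^+ 2 / (2 * eta).
have C0 : 0 < C.
  by rewrite ltr_wpDr ?divr_ge0 ?sqr_ge0 ?mulr_ge0 ?ltW // ltr_wpDr ?addr_ge0 ?mulr_ge0 // ?ltW // ltr_wpDr // mulr_gt0.
pose kappa := Num.min 1 (c / (2 * C)).
have k0 : 0 < kappa by rewrite lt_min ltr01 divr_gt0 // mulr_gt0.
have kC : kappa * C <= c / 2.
  rewrite -ler_pdivlMr // ge_min (_ : c / 2 / C = c / (2 * C)) ?lexx ?orbT //.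
  by field; rewrite gt_eqF.
have ke : 0 < kappa * eta / 2 by rewrite divr_gt0 // mulr_gt0.
exists kappa, (Num.min (kappa * eta / 2) (c / 2)); split=> //.
  by rewrite lt_min ke divr_gt0.
move=> g g1 h x y z gB g1B hB gK he hg hh.
have h0 : 0 <= h by exact: le_trans (ltW eta0) he.
have k1 : 0 < 1 + kappa by rewrite addr_gt0.
have hk : h - kappa * B <= h / (1 + kappa).
  rewrite ler_pdivlMr // -subr_ge0.
  have -> : h - (h - kappa * B) * (1 + kappa) = kappa * (B - h) + kappa ^+ 2 * B by ring.
  by rewrite addr_ge0 // mulr_ge0 ?sqr_ge0 ?subr_ge0 ?(le_trans (ler_norm _) hB) // ltW.
pose u := g1 / (1 + kappa); have uB : `|u| <= B.
  rewrite /u normrM normfV (gtr0_norm k1) ler_pdivrMr //.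
  by apply: le_trans g1B _; rewrite ler_peMr ?lerDl ?(ltW k0) ?(ltW B0).
rewrite -/u; clearbody u; clear g1B g1.
have bin : c * (y ^+ 2 + z ^+ 2) <= h * y ^+ 2 + K * (y * z) + (h - g) * z ^+ 2.
  have pB : h - g <= 2 * B.
    by move: gB hB; clear; rewrite !ler_norml => /andP[? ?] /andP[? ?]; lra.
  have hBB : h <= 2 * B by apply: le_trans (ler_norm _) _; apply: le_trans hB _; lra.
  have ce : c <= eta / 4.
    by rewrite /c invfM mulrA ler_pdivrMr // ler_peMr // divr_ge0 // ltW.
  apply: binary_form_ge; first by move: he ce eta0; clear; lra.
  have cB : c * (4 * B) = eta by rewrite /c divfK // gt_eqF // mulr_gt0.
  have -> : (h - c) * (h - g - c) = h * (h - g) - c * (h + (h - g)) + c ^+ 2 by ring.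
  have q1 : c * (h + (h - g)) <= eta.
    by rewrite -cB ler_pM2l //; move: pB hBB; clear; lra.
  by have := sqr_ge0 c; move: hh q1; clear; lra.
(* The mixed term in [x] and [y] is of order [kappa], like the coefficient of the square of [x].
   Young's inequality with weight [eta] spends only half of [kappa * eta * x ^+ 2] on it and charges
   the rest to the square of [y]. *)
have t12 : - (kappa * (eta / 2 * x ^+ 2 + (beta * B) ^+ 2 / (2 * eta) * y ^+ 2)) <=
    - kappa * beta * u * (x * y).
  have := @cross_term eta x (- (beta * u) * y) eta0.
  have : (beta * u * y) ^+ 2 <= (beta * B) ^+ 2 * y ^+ 2.
    rewrite [leLHS]exprMn ler_wpM2r ?sqr_ge0 // !exprMn ler_wpM2l ?sqr_ge0 //.
    by rewrite -(real_normK (num_real u)) ler_sqr ?nnegrE ?(ltW B0).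
  set Y := (beta * u * y) ^+ 2; set Z := (_ * _) ^+ 2 * _ => YZ.
  have -> : (- (beta * u) * y) ^+ 2 = Y by rewrite /Y; ring.
  have eYZ : eta^-1 * Y <= eta^-1 * Z by rewrite ler_pM2l // invr_gt0.
  move=> H.
  have -> : - kappa * beta * u * (x * y) = kappa * (x * (- (beta * u) * y)) by ring.
  rewrite -mulrN ler_pM2l //; apply: le_trans H.
  have -> : (beta * B) ^+ 2 / (2 * eta) * y ^+ 2 = eta^-1 * Z / 2 by rewrite /Z; field; rewrite gt_eqF.
  by move: eYZ; clear; lra.
have t23 : - (kappa * ((`|K| + `|beta| * B) * (y ^+ 2 + z ^+ 2))) <= kappa * (K - beta * g) * (y * z).
  rewrite -mulrN -[leRHS]mulrA ler_pM2l //.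
  have W : `|K - beta * g| <= `|K| + `|beta| * B.
    by apply: le_trans (ler_normB _ _) _; rewrite lerD2l normrM ler_wpM2l.
  set w := K - _ in W *; set V := _ + _ in W *.
  have yz : `|y * z| <= y ^+ 2 + z ^+ 2.
    rewrite normrM -(real_normK (num_real y)) -(real_normK (num_real z)).
    move: `|y| `|z| => p q; have := sqr_ge0 (p - q); have := sqr_ge0 (p + q).
    have := sqr_ge0 p; have := sqr_ge0 q; rewrite sqrrD sqrrB; clear; lra.
  have : `|w * (y * z)| <= V * (y ^+ 2 + z ^+ 2) by rewrite normrM ler_pM.
  by rewrite ler_norml => /andP[].
have m1 : Num.min (kappa * eta / 2) (c / 2) <= kappa * eta / 2 by rewrite ge_min lexx.
have m2 : Num.min (kappa * eta / 2) (c / 2) <= c / 2 by rewrite ge_min lexx orbT.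
set d := Num.min _ _ in m1 m2 *.
have dx : d * x ^+ 2 <= kappa * eta / 2 * x ^+ 2 by rewrite ler_wpM2r ?sqr_ge0.
have dy : d * y ^+ 2 <= (c - kappa * C) * y ^+ 2.
  by rewrite ler_wpM2r ?sqr_ge0 //; move: m2 kC; clear; lra.
have dz : d * z ^+ 2 <= (c - kappa * C) * z ^+ 2.
  by rewrite ler_wpM2r ?sqr_ge0 //; move: m2 kC; clear; lra.
have gx : kappa * eta * x ^+ 2 <= kappa * (g - beta * K) * x ^+ 2.
  by rewrite ler_wpM2r ?sqr_ge0 // ler_pM2l.
have g0 : - B <= g by move: gB; rewrite ler_norml => /andP[].
have hy : (h - kappa * (2 * B)) * y ^+ 2 <= (h / (1 + kappa) + kappa * g) * y ^+ 2.
  rewrite ler_wpM2r ?sqr_ge0 //.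
  have : kappa * - B <= kappa * g by rewrite ler_pM2l.
  by move: hk; clear; lra.
have hz : (h - g - kappa * (B + `|beta * K|)) * z ^+ 2 <=
    (h / (1 + kappa) - g - kappa * (beta * K)) * z ^+ 2.
  rewrite ler_wpM2r ?sqr_ge0 //.
  have : kappa * (beta * K) <= kappa * `|beta * K| by rewrite ler_pM2l // ler_norm.
  by move: hk; clear; lra.
have slack : 0 <= kappa * ((`|beta * K|) * y ^+ 2 + (B + (beta * B) ^+ 2 / (2 * eta)) * z ^+ 2).
  have N0 : 0 <= (beta * B) ^+ 2 / (2 * eta) by rewrite divr_ge0 ?sqr_ge0 ?mulr_ge0 // ltW.
  by rewrite mulr_ge0 ?(ltW k0) // addr_ge0 // mulr_ge0 ?sqr_ge0 // addr_ge0 // ltW.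
have E : (c - kappa * C) * (y ^+ 2 + z ^+ 2) + kappa * eta / 2 * x ^+ 2 +
   kappa * ((`|beta * K|) * y ^+ 2 + (B + (beta * B) ^+ 2 / (2 * eta)) * z ^+ 2) =
   c * (y ^+ 2 + z ^+ 2) - h * y ^+ 2 - K * (y * z) - (h - g) * z ^+ 2 +
   (h - kappa * (2 * B)) * y ^+ 2 + (h - g - kappa * (B + `|beta * K|)) * z ^+ 2 + kappa * eta * x ^+ 2
   - (kappa * (eta / 2 * x ^+ 2 + (beta * B) ^+ 2 / (2 * eta) * y ^+ 2)) + K * (y * z)
   - (kappa * ((`|K| + `|beta| * B) * (y ^+ 2 + z ^+ 2))).
  by rewrite /C; field; rewrite gt_eqF.
have e3 : c * (y ^+ 2 + z ^+ 2) - h * y ^+ 2 - K * (y * z) - (h - g) * z ^+ 2 <= 0.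
  by move: bin; set a1 := _ * (_ + _); set a2 := _ * _; set a3 := _ * (_ * _); set a4 := _ * _; clear; lra.
have fin (X Y Z P1 P2 P3 Gx G HY Hy HZ Hz T12 t T23 tt s k b : R) :
  X <= P1 -> Y <= P2 -> Z <= P3 -> G <= Gx -> Hy <= HY -> Hz <= HZ -> - T12 <= t -> - T23 <= tt ->
  0 <= s -> b <= 0 -> (P2 + P3) + P1 + s = b + Hy + Hz + G - T12 + k - T23 ->
  X + Y + Z <= Gx + HY + HZ + t + (k + tt).
  by clear; lra.
have := fin _ _ _ _ _ _ _ _ _ _ _ _ _ _ _ _ _ _ _ dx dy dz gx hy hz t12 t23 slack e3.
move=> /(_ (K * (y * z))); rewrite -mulrDr => /(_ E).
by rewrite !mulrDr -mulrDl; congr (_ <= _ + _ + _ + _ + _); ring.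
Qed.

(* The divergence of the tangential part of the field, with respect to the
   weighted area, times [|m|^2] for a normal vector [m] of a translator. *)
Definition pressure_form (uf duf : 'I_3 -> R -> R) (kappa beta x : R) (m : 'I_3 -> R) : R :=
  let s := ddot m m in let q := ddot (uf ^~ x) m in
  duf 0 x * (s - m 0 ^+ 2) - duf 1 x * (m 0 * m 1) - duf ord_max x * (m 0 * m ord_max)
    + q * m ord_max
    - kappa * ((s * uf ord_max x - q * m ord_max) + beta * (s * uf 1 x - q * m 1)).

(** The interface between the choice of the profile and the geometry: all that the flow argument has
    to know about the slab and [beta]. Smoothness is asked on the whole line, bounds and positivity
    only over the slab. *)
Definition expanding_ambient (beta : R) (slab : set R) := exists uf duf kappa delta B,
  [/\ 0 < kappa, 0 < delta, forall k x, sdiff1 (uf k) x (duf k x),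
      forall k x, slab x -> `|uf k x| <= B &
      forall x m, slab x -> delta * ddot m m <= pressure_form uf duf kappa beta x m].

Lemma sdiff1_shift (f df : R -> R) (s c x : R) : (forall y : R, is_derive y 1 f (df y)) -> continuous df ->
  sdiff1 (fun x => s * f (x - c)) x (s * df (x - c)).
Proof.
move=> fd cdf; apply: (@sdiff1_C1 R _ (fun x => s * df (x - c)) x 1) => //.
- move=> y _; apply: is_derive_eq.
  rewrite /GRing.scale /=; ring.
- move=> z; apply: (@continuous_comp _ _ _ (fun x => x - c) (fun y => s * df y)).
    by apply: cvgB; [exact: cvg_id|exact: cvg_cst].
  by apply: (@cvgM _ _ _ _ (fun=> s) df); [exact: cvg_cst|exact: cdf].
Qed.

Lemma ambient_of_profile (c beta K eta B : R) (g g1 h : R -> R) (Y : set R) :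
  0 < eta -> 1 <= B ->
  (forall y : R, is_derive y 1 g (g1 y)) -> (forall y : R, is_derive y 1 g1 (- h y)) ->
  continuous h ->
  (forall y, Y y -> [/\ `|g y| <= B, `|g1 y| <= B & `|h y| <= B]) ->
  (forall y, Y y -> [/\ eta <= g y - beta * K, eta <= h y, eta <= h y - g y &
    K ^+ 2 / 4 + eta <= h y * (h y - g y)]) ->
  expanding_ambient beta [set x | Y (x - c)].
Proof.
move=> eta0 B1 gd g1d ch bnd pos.
have [kappa [delta [k0 d0 form]]] := form_bound beta K eta0 B1.
have k1 : 0 < 1 + kappa by rewrite addr_gt0.
have kn : 1 + kappa != 0 by rewrite gt_eqF.
have BK : B <= B + `|K| by rewrite lerDl.
pose uf (k : 'I_3) x : R := if k == 0 then - (1 + kappa)^-1 * g1 (x - c)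
  else if k == 1 then K else - 1 * g (x - c).
pose duf (k : 'I_3) x : R := if k == 0 then - (1 + kappa)^-1 * (- h (x - c))
  else if k == 1 then 0 else - 1 * g1 (x - c).
exists uf, duf, kappa, delta, (B + `|K|); split=> //.
- move=> k x; have [-> | -> | ->] := ord3P k; rewrite /uf /duf /=.
  + by apply: (@sdiff1_shift g1 (fun y => - h y)) => // y; apply: cvgN; exact: ch.
  + by move=> e e0; exists 1 => // p q _ _; rewrite mul0r !subrr normr0 mulr_ge0 // ltW.
  + apply: sdiff1_shift => // y; have H := g1d y.
    by apply: differentiable_continuous; apply/derivable1_diffP; exact: ex_derive.
- move=> k x /= /bnd[b0 b1 b2]; have [-> | -> | ->] := ord3P k; rewrite /uf /=.
  + rewrite normrM normrN normfV (gtr0_norm k1) mulrC ler_pdivrMr //.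
    apply: le_trans b1 (le_trans BK _).
    by rewrite ler_peMr ?lerDl ?(ltW k0) // addr_ge0 // (le_trans _ B1).
  + by rewrite lerDr (le_trans _ B1).
  + by rewrite normrM normrN1 mul1r (le_trans b0).
- move=> x m /= Yx; have [b0 b1 b2] := bnd _ Yx; have [p0 p1 p2 p3] := pos _ Yx.
  have := form (g (x - c)) (g1 (x - c)) (h (x - c)) (m 0) (m 1) (m ord_max) b0 b1 b2 p0 p1 p2 p3.
  rewrite /pressure_form /ddot /uf /duf /= -!expr2.
  move: (g _) (g1 _) (h _) => G G1 H; congr (_ <= _).
  by field.
Qed.
End AmbientField.

(** * Profiles for width below pi and for width pi *)

Section Profiles.
Variable R : realType.

Lemma is_derive_scale (f df : R -> R) (l y : R) : (forall z : R, is_derive z 1 f (df z)) ->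
  is_derive y 1 (fun z => f (l * z)) (l * df (l * y)).
Proof.
move=> fd; have H : is_derive y 1 (fun z => l * z) l.
  by apply: is_derive_eq; rewrite /GRing.scale /= mulr1.
have := @is_derive1_comp R f (fun z => l * z) y _ _ (fd _) H.
by rewrite mulrC.
Qed.

Lemma is_derive_mulc (f : R -> R) (df s y : R) : is_derive y 1 f df ->
  is_derive y 1 (fun z => s * f z) (s * df).
Proof. by move=> H; exact: (is_deriveZ s). Qed.

Lemma cos_lower (z z0 : R) : `|z| <= z0 -> z0 < pi / 2 -> 0 < cos z0 <= cos z.
Proof.
move=> zz z0p; have p2 : pi / 2 < (pi : R) by have := pi_gt0 R; lra.
have zn := normr_ge0 z.
apply/andP; split.
  by apply: cos_gt0_pihalf; rewrite z0p andbT; have := pi_gt0 R; lra.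
rewrite -(cos_norm z) leNgt ltr_cos ?in_itv /= -?leNgt //; first by lra.
by apply/andP; split; lra.
Qed.

Lemma slab_center (a w x : R) : a < x < a + w -> `|x - (a + w / 2)| < w / 2.
Proof. by move=> /andP[h1 h2]; rewrite ltr_norml; apply/andP; split; lra. Qed.

(* The profile is [g y = cos (m y)] with [1 < m < pi / w], so that [h = m^2 g]. *)
Lemma ambient_narrow (a w : R) : 0 < w -> w < pi ->
  expanding_ambient 0 [set x | a < x < a + w].
Proof.
move=> w0 wp.
have [uf [duf [kappa [delta [B]]]]] : expanding_ambient 0 [set x | `|x - (a + w / 2)| < w / 2].
  pose m : R := (1 + pi / w) / 2.
  have wV : pi / w * w = pi by rewrite divfK // gt_eqF.
  have pw : 1 < pi / w by rewrite ltr_pdivlMr // mul1r.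
  have m1 : 1 < m by rewrite /m; lra.
  have m0 : 0 < m by lra.
  have mw : m * (w / 2) < pi / 2.
    have : m * w < pi / w * w by rewrite ltr_pM2r // /m; lra.
    by rewrite wV; lra.
  clearbody m.
  have mw0 : 0 < m * (w / 2) by rewrite mulr_gt0 // divr_gt0.
  have /andP[c0 _] : 0 < cos (m * (w / 2)) <= cos (m * (w / 2)).
    by apply: cos_lower => //; rewrite gtr0_norm.
  set cw := cos _ in c0.
  have low y : `|y| < w / 2 -> cw <= cos (m * y).
    move=> yw; have /andP[] // : 0 < cw <= cos (m * y).
    apply: cos_lower => //.
    by rewrite normrM gtr0_norm // ler_pM2l // ltW.
  have mm1 : 0 < m ^+ 2 - 1 by rewrite subr_gt0 exprn_egt1.
  (* All four quantities to be bounded below are increasing in the cosine, so their bounds come from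
     its value [cw] at the walls. *)
  pose eta := Num.min (Num.min cw ((m ^+ 2 - 1) * cw)) (m ^+ 2 * cw * ((m ^+ 2 - 1) * cw)).
  have m2 : 0 < m ^+ 2 by rewrite exprn_gt0.
  have mc : 0 < (m ^+ 2 - 1) * cw by exact: mulr_gt0.
  have mm : 0 < m ^+ 2 * cw * ((m ^+ 2 - 1) * cw) by apply: mulr_gt0 mc; exact: mulr_gt0.
  have e0 : 0 < eta by rewrite lt_min mm andbT lt_min c0 mc.
  apply: (@ambient_of_profile R (a + w / 2) 0 0 eta (m ^+ 2) (fun y => cos (m * y))
    (fun y => m * - sin (m * y)) (fun y => m ^+ 2 * cos (m * y)) [set y | `|y| < w / 2] e0) => //.
  - by apply: ltW; rewrite exprn_egt1.
  - by move=> y; apply: is_derive_scale.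
  - move=> y; have := is_derive_scale m y (fun z => is_deriveN (is_derive_sin z)).
    move=> /(is_derive_mulc m); rewrite (_ : m * (m * _) = - (m ^+ 2 * cos (m * y))) //.
    by ring.
  - move=> y; apply: differentiable_continuous; apply/derivable1_diffP.
    have H := is_derive_mulc (m ^+ 2) (is_derive_scale m y (fun z => is_derive_cos z)).
    exact: ex_derive.
  - move=> y /= _; have m3 : m <= m ^+ 2 by rewrite expr2 ler_peMr ?ltW.
    have m21 : 1 <= m ^+ 2 by apply: le_trans m3; exact: ltW.
    rewrite normrM normrN [`|m ^+ 2 * _|]normrM (gtr0_norm m0) (gtr0_norm m2); split.
    + exact: le_trans (cos_max _) m21.
    + by rewrite -[leRHS]mulr1; apply: ler_pM => //; [exact: ltW|exact: sin_max].
    + by rewrite -[leRHS]mulr1 ler_wpM2l ?sqr_ge0 ?cos_max.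
  - move=> y /= /low; set C := cos _ => cwC.
    have C0 : 0 < C by exact: lt_le_trans cwC.
    have E : m ^+ 2 * C - C = (m ^+ 2 - 1) * C by ring.
    have q : (m ^+ 2 - 1) * cw <= (m ^+ 2 - 1) * C by rewrite ler_pM2l.
    rewrite E mulr0 subr0 expr0n /= mul0r add0r /eta !ge_min; split.
    - by rewrite cwC.
    - by rewrite (le_trans cwC) // ler_peMl ?ltW // -subr_gt0.
    - by rewrite q orbT.
    - apply/orP; right; apply: ler_pM => //; try exact/ltW/mulr_gt0.
      by rewrite ler_pM2l.
move=> [k0 d0 s1 bd ps]; exists uf, duf, kappa, delta, B; split=> //.
- by move=> k x /= /slab_center; exact: bd.
- by move=> x m /= /slab_center; exact: ps.
Qed.

(* The profile is [g = A cos - E] with [E] a small multiple of [cosh (l y)] and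
   [K = - sgn beta]: then [h - g = (l^2 + 1) E] stays positive up to the
   boundary of the slab, where [cos] vanishes, and [- beta K = |beta|]
   compensates for the negativity of [g] there. *)
Lemma ambient_wide (a beta : R) : beta != 0 -> expanding_ambient beta [set x | a < x < a + pi].
Proof.
move=> b_neq0.
have [uf [duf [kappa [delta [B]]]]] : expanding_ambient beta [set x | `|x - (a + pi / 2)| < pi / 2].
  have bp : 0 < `|beta| by rewrite normr_gt0.
  have p1 : 1 <= pi / 2 :> R := pihalf_ge1 R.
  (* This gives [l ^+ 2 * (|beta| / 8) >= 1]. Below, [b0] is normalised so that each exponential in
     [E] contributes at most [|beta| / 4] in the slab: then [E <= |beta| / 2], and g + |beta| stays
     positive. *)
  pose l := 1 + 8 / `|beta|.
  have lV : l * `|beta| = `|beta| + 8 by rewrite /l mulrDl mul1r divfK // gt_eqF.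
  have l1 : 1 < l by rewrite ltrDl divr_gt0.
  clearbody l.
  have l0 : 0 < l by lra.
  have l2 : 1 <= l ^+ 2 * (`|beta| / 8).
    have : l * `|beta| <= l * (l * `|beta|) by rewrite ler_pM2l // lV lerDl.
    have e : l ^+ 2 * (`|beta| / 8) = (l * (l * `|beta|)) / 8 by rewrite expr2; ring.
    by rewrite e lV; lra.
  have ll : 1 <= l ^+ 2 by rewrite expr_ge1 // ltW.
  pose b0 := `|beta| / 4 * expR (- (l * (pi / 2))).
  have b00 : 0 < b0 by rewrite mulr_gt0 ?expR_gt0 // divr_gt0.
  have b0E : b0 * expR (l * (pi / 2)) = `|beta| / 4.
    by rewrite /b0 -mulrA -expRD addNr expR0 mulr1.
  clearbody b0.
  pose E (y : R) := b0 * (expR (l * y) + expR (- l * y)).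
  have E_low y : 2 * b0 <= E y.
    rewrite /E mulrC ler_pM2l // mulNr.
    by have := expR_ge1Dx (l * y); have := expR_ge1Dx (- (l * y)); lra.
  have E_norm y : b0 * expR (l * `|y|) <= E y.
    rewrite ler_pM2l // mulNr; have := expR_ge0 (l * y); have := expR_ge0 (- (l * y)).
    by have [_|_] := ger0P y; rewrite ?mulrN; lra.
  have E_up y : `|y| < pi / 2 -> E y <= `|beta| / 2.
    move=> yp; have h z : z <= `|y| -> b0 * expR (l * z) <= `|beta| / 4.
      move=> zy; rewrite -b0E ler_pM2l // ler_expR ler_pM2l //.
      by apply: le_trans zy _; exact: ltW.
    have := h y (ler_norm _); have := h (- y); rewrite -(normrN y) => /(_ (ler_norm _)).
    by rewrite /E mulrDr mulNr mulrN; lra.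
  have ln2 : ln 2 <= 1 :> R by have := @le_ln1Dx R 1; rewrite -[1 + 1]/2; apply; lra.
  (* Moving inwards from a wall by [ln 2 / l] halves [expR (l * |y|)]. Beyond [y0] one therefore
     still has [E y >= |beta| / 8], and [l ^+ 2 * E y >= 1] by the choice of [l]. *)
  pose y0 := pi / 2 - ln 2 / l.
  have y0p : 0 <= y0 < pi / 2.
    have : 0 < ln 2 / l by rewrite divr_gt0 // ln_gt0 // ltr1n.
    have : ln 2 / l <= 1 by rewrite ler_pdivrMr // mul1r (le_trans ln2) // ltW.
    by rewrite /y0 => ? ?; apply/andP; split; lra.
  have [y00 y0pi] := andP y0p.
  have /andP[c0 _] : 0 < cos y0 <= cos y0 by apply: cos_lower => //; rewrite ger0_norm.
  have far y : E y * l ^+ 2 < 1 -> `|y| <= y0.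
    move=> h; rewrite leNgt; apply/negP => yy; move: h; apply/negP; rewrite -leNgt.
    apply: le_trans (ler_wpM2r (sqr_ge0 l) (E_norm y)).
    have : `|beta| / 8 <= b0 * expR (l * `|y|).
      have : b0 * expR (l * y0) <= b0 * expR (l * `|y|).
        by rewrite ler_pM2l // ler_expR ler_pM2l // ltW.
      apply: le_trans.
      rewrite /y0 mulrBr expRD mulrA b0E (_ : l * (ln 2 / l) = ln 2); last first.
        by field; rewrite gt_eqF.
      rewrite expRN lnK ?posrE //; lra.
    move=> h; apply: le_trans l2 _; rewrite mulrC.
    by rewrite ler_wpM2r ?sqr_ge0.
  (* Up to [y0] the product h (h - g) is at least [A * cos y0 * (2 * b0) = 1]; beyond [y0] the terms
     with [l ^+ 2 * E] alone make it at least 1. This exceeds what is asked, since K^2 = 1 and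
     [eta <= 4^-1]. *)
  pose A := (cos y0 * (2 * b0))^-1.
  have A0 : 0 < A by rewrite invr_gt0 mulr_gt0 // mulr_gt0.
  have A1 : A * cos y0 * (2 * b0) = 1.
    by rewrite -mulrA mulVf // gt_eqF // mulr_gt0 // mulr_gt0.
  clearbody A.
  pose eta := Num.min (2 * b0) 4^-1.
  have e0 : 0 < eta by rewrite lt_min invr_gt0 andbC /= ltr0n mulr_gt0.
  pose E1 (y : R) := b0 * (l * expR (l * y) + - l * expR (- l * y)).
  have EX (m y : R) : is_derive y 1 (fun z => expR (m * z)) (m * expR (m * y)).
    by apply: is_derive_scale => z; exact: is_derive_expR.
  have EE (y : R) : is_derive y 1 E (E1 y).
    by apply: is_derive_mulc; apply: is_deriveD; exact: EX.
  have EE1 (y : R) : is_derive y 1 E1 (l ^+ 2 * E y).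
    rewrite (_ : l ^+ 2 * E y = b0 * (l * (l * expR (l * y)) + - l * (- l * expR (- l * y)))).
      by apply: is_derive_mulc; apply: is_deriveD; apply: is_derive_mulc; exact: EX.
    by rewrite /E; ring.
  have lE1 y : `|E1 y| <= l ^+ 2 * E y.
    rewrite normrM (gtr0_norm b00) /E mulrCA ler_pM2l //.
    apply: le_trans (ler_normD _ _) _.
    rewrite !normrM normrN (gtr0_norm l0) !(ger0_norm (expR_ge0 _)) -mulrDr.
    by rewrite ler_wpM2r ?addr_ge0 ?expR_ge0 // expr2 ler_peMr // ltW.
  clearbody E E1.
  apply: (@ambient_of_profile R (a + pi / 2) beta (- Num.sg beta) eta (1 + A + l ^+ 2 * `|beta|)
    (fun y => A * cos y - E y) (fun y => A * - sin y - E1 y) (fun y => A * cos y + l ^+ 2 * E y)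
    [set y | `|y| < pi / 2] e0).
  - by rewrite -addrA lerDl addr_ge0 ?mulr_ge0 ?sqr_ge0 // ltW.
  - by move=> y; rewrite opprD -mulrN; apply: is_deriveB.
  - move=> y; apply: differentiable_continuous; apply/derivable1_diffP.
    have H := is_deriveD (is_derive_mulc A (is_derive_cos y)) (is_derive_mulc (l ^+ 2) (EE y)).
    exact: ex_derive.
  - move=> y /= yp; have Eu := E_up y yp; have El := E_low y.
    have q : l ^+ 2 * E y <= l ^+ 2 * (`|beta| / 2) by rewrite ler_wpM2l // sqr_ge0.
    have E0 : 0 < E y by apply: lt_le_trans El; rewrite mulr_gt0.
    have q0 : E y <= l ^+ 2 * E y by rewrite ler_peMl // ltW.
    have q1 := lE1 y.
    have ca : `|A * cos y| <= A by rewrite normrM (gtr0_norm A0) ger_pMr // cos_max.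
    have sa : `|A * - sin y| <= A by rewrite normrM normrN (gtr0_norm A0) ger_pMr // sin_max.
    have h0 : 0 <= l ^+ 2 * `|beta| by rewrite mulr_ge0 ?sqr_ge0.
    rewrite [l ^+ 2 * (_ / 2)]mulrA in q; set T := l ^+ 2 * `|beta| in q h0 *.
    split; [apply: le_trans (ler_normB _ _) _|apply: le_trans (ler_normB _ _) _|
            apply: le_trans (ler_normD _ _) _].
    + by rewrite (gtr0_norm E0); move: ca q q0 h0; clear; lra.
    + by move: sa q1 q h0; clear; lra.
    + rewrite [`|l ^+ 2 * _|]ger0_norm; first by move: ca q h0; clear; lra.
      by rewrite mulr_ge0 ?sqr_ge0 // ltW.
  - move=> y /= yp; have Cy : 0 < cos y by apply: cos_gt0_pihalf; move: yp; rewrite ltr_norml.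
    have Eu := E_up y yp; have El := E_low y.
    have E0 : 0 < E y by apply: lt_le_trans El; rewrite mulr_gt0.
    have q0 : E y <= l ^+ 2 * E y by rewrite ler_peMl // ltW.
    have AC : 0 < A * cos y by rewrite mulr_gt0.
    have eb : eta <= 2 * b0 by rewrite ge_min lexx.
    have e4 : eta <= 4^-1 by rewrite ge_min lexx orbT.
    rewrite (_ : beta * - Num.sg beta = - `|beta|); last by rewrite mulrN mulrC -normrEsg.
    rewrite sqrrN sqr_sg b_neq0 /=.
    rewrite (_ : A * cos y + l ^+ 2 * E y - (A * cos y - E y) = l ^+ 2 * E y + E y); last by ring.
    split; [by move: Eu El eb AC; clear; lra|by move: q0 El eb AC; clear; lra|
      by move: q0 El eb E0; clear; lra|].
    have prod1 : 1 <= (A * cos y + l ^+ 2 * E y) * (l ^+ 2 * E y + E y).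
      have [h|h] := leP 1 (l ^+ 2 * E y).
        rewrite -[leLHS]mulr1; apply: ler_pM => //.
          by move: AC h; clear; lra.
        by move: E0 h; clear; lra.
      have yy : `|y| <= y0 by apply: far; rewrite mulrC.
      have /andP[_ cc] := cos_lower yy y0pi.
      have : A * cos y0 * (2 * b0) <= (A * cos y + l ^+ 2 * E y) * (l ^+ 2 * E y + E y).
        apply: ler_pM; try exact/ltW/mulr_gt0.
        - have : A * cos y0 <= A * cos y by rewrite ler_pM2l.
          by move: q0 E0; clear; lra.
        - by move: q0 El E0; clear; lra.
      by rewrite A1.
    by move: e4 prod1; clear; lra.
move=> [k0 d0 s1 bd ps]; exists uf, duf, kappa, delta, B; split=> //.
- by move=> k x /= /slab_center; exact: bd.
- by move=> x m /= /slab_center; exact: ps.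
Qed.
End Profiles.

(** * Flow lines on the surface *)

Section Transition.
Variables (R : realType) (S : immersed_surface R).

Definition img n : set S := par S n @` dom S n.

Lemma img_par n u : dom S n u -> img n (par S n u).
Proof. by move=> Uu; exists u. Qed.

Lemma dom_coord n p : img n p -> dom S n (Defs.coord S n p).
Proof. by move=> [u Uu <-]; rewrite coordK. Qed.

Lemma parK n p : img n p -> par S n (Defs.coord S n p) = p.
Proof. by move=> [u Uu <-]; rewrite coordK. Qed.

Lemma par_preimage_open n (V : set S) : open V -> open (dom S n `&` par S n @^-1` V).
Proof.
move=> oV; rewrite openE => u [Uu Vu]; apply: filterI.
  by apply: open_nbhs_nbhs; split => //; exact: dom_open.
by apply: (par_continuous Uu); apply: open_nbhs_nbhs.
Qed.

Lemma coord_preimage_open n (O : set (R * R)) : open O -> open (img n `&` Defs.coord S n @^-1` O).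
Proof.
move=> oO; rewrite openE => p [Ip Op]; apply: filterI.
  by apply: open_nbhs_nbhs; split => //; exact: img_open.
by apply: (Defs.coord_continuous Ip); apply: open_nbhs_nbhs.
Qed.

Lemma par_image_open n (O : set (R * R)) : open O -> O `<=` dom S n -> open (par S n @` O).
Proof.
move=> oO OD; have -> : par S n @` O = img n `&` Defs.coord S n @^-1` O.
  apply/seteqP; split=> [p [u Ou <-]|p [[u Uu <-]] /=].
    by split; [exact/img_par/OD|rewrite /= coordK //; exact: OD].
  by rewrite coordK // => Ou; exists u.
exact: coord_preimage_open.
Qed.

Lemma trans_sdiff m n u : dom S m u -> img n (par S m u) -> exists t0 t1,
  sdiff (fst \o (Defs.coord S n \o par S m)) u t0 /\ sdiff (snd \o (Defs.coord S n \o par S m)) u t1.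
Proof.
move=> Uu Iu; pose U := dom S m `&` par S m @^-1` img n.
have oU : open U by apply: par_preimage_open; exact: img_open.
have UU : U u by [].
have ck : Ck_on 1 U (Defs.coord S n \o par S m) by exact: transition_smooth.
have c0 : Ck_on 1 U (fst \o (Defs.coord S n \o par S m)).
  by apply: (@Ck_on_proj R _ fst) => // x; exact: cvg_fst.
have c1 : Ck_on 1 U (snd \o (Defs.coord S n \o par S m)).
  by apply: (@Ck_on_proj R _ snd) => // x; exact: cvg_snd.
by eexists; eexists; split; [exact: (Ck_on_sdiff oU UU c0)|exact: (Ck_on_sdiff oU UU c1)].
Qed.

Lemma comp_trans m n k u : dom S m u -> img n (par S m u) ->
  comp S m k u = comp S n k (Defs.coord S n (par S m u)).
Proof. by move=> Uu Iu; rewrite /comp /lpar /= parK. Qed.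

Lemma chart_change m n u t0 t1 : dom S m u -> img n (par S m u) ->
  sdiff (fst \o (Defs.coord S n \o par S m)) u t0 -> sdiff (snd \o (Defs.coord S n \o par S m)) u t1 ->
  let v := Defs.coord S n (par S m u) in
  Da S m u = (fun k => t0.1 * Da S n v k + t1.1 * Db S n v k) /\
  Db S m u = (fun k => t0.2 * Da S n v k + t1.2 * Db S n v k).
Proof.
move=> Uu Iu s0 s1 v; pose U := dom S m `&` par S m @^-1` img n.
have oU : open U by apply: par_preimage_open; exact: img_open.
have UU : U u by [].
have Uv : dom S n v by exact: dom_coord.
have key k : sdiff (comp S m k) u _ := sdiff_near
   (near_open oU UU (fun x (Ux : U x) => esym (comp_trans k Ux.1 Ux.2)))
   (sdiff_comp2 s0 s1 (comp_sdiff k Uv)).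
have key2 k := sdiff_unique (comp_sdiff k Uu) (key k).
split; apply/funext => k.
- by have /= -> := congr1 fst (key2 k); rewrite mulrC [X in _ + X]mulrC.
- by have /= -> := congr1 snd (key2 k); rewrite mulrC [X in _ + X]mulrC.
Qed.

Lemma trans_det m n u t0 t1 : dom S m u -> img n (par S m u) ->
  sdiff (fst \o (Defs.coord S n \o par S m)) u t0 -> sdiff (snd \o (Defs.coord S n \o par S m)) u t1 ->
  dg S m u = (t0.1 * t1.2 - t0.2 * t1.1) ^+ 2 * dg S n (Defs.coord S n (par S m u)).
Proof.
move=> Uu Iu s0 s1; have [/= ea eb] := chart_change Uu Iu s0 s1.
by rewrite /dg ea eb gdet_change; congr (_ ^+ 2 * _); ring.
Qed.

Variables (uf : 'I_3 -> R -> R) (kappa beta : R).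

Lemma rho_trans m n u t0 t1 : dom S m u -> img n (par S m u) ->
  sdiff (fst \o (Defs.coord S n \o par S m)) u t0 -> sdiff (snd \o (Defs.coord S n \o par S m)) u t1 ->
  rho S kappa beta m u =
    `|t0.1 * t1.2 - t0.2 * t1.1| * rho S kappa beta n (Defs.coord S n (par S m u)).
Proof.
move=> Uu Iu s0 s1; rewrite /rho -!comp_trans // mulrA; congr (_ * _).
by rewrite (trans_det Uu Iu s0 s1) sqrtrM ?sqr_ge0 // sqrtr_sqr.
Qed.

Lemma wf_trans m n u t0 t1 : dom S m u -> img n (par S m u) ->
  sdiff (fst \o (Defs.coord S n \o par S m)) u t0 -> sdiff (snd \o (Defs.coord S n \o par S m)) u t1 ->
  wf S uf n (Defs.coord S n (par S m u)) =
    (t0.1 * (wf S uf m u).1 + t0.2 * (wf S uf m u).2,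
     t1.1 * (wf S uf m u).1 + t1.2 * (wf S uf m u).2).
Proof.
move=> Uu Iu s0 s1; have [/= ea eb] := chart_change Uu Iu s0 s1.
have g0 : gdet (Da S m u) (Db S m u) != 0 by rewrite gt_eqF // dg_gt0.
rewrite /wf -(wfield_change _ ea eb g0); congr (wfield _ _ _).
by apply/funext => k; rewrite /UU (comp_trans 0 Uu Iu).
Qed.

End Transition.

Lemma cts_at (R : realType) (X : normedModType R) (T : topologicalType) (g : X -> T) (t : X) :
  {for t, continuous g} <->
  (forall V, open V -> V (g t) -> exists2 e : R, 0 < e & forall s : X, `|s - t| < e -> V (g s)).
Proof.
split=> [gc V oV Vt|h V].
  have /nbhs_normP[e /= e0 he] := gc V (open_nbhs_nbhs (conj oV Vt)).
  by exists e => // s st; apply: he; rewrite /= distrC.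
rewrite nbhsE => -[W [oW Wt] WV]; have [e e0 he] := h W oW Wt.
apply/nbhs_normP; exists e => // s /= st; apply/WV/he; by rewrite distrC.
Qed.

Lemma near_pair (R : realType) (t e p q : R) : p <= q -> t - e < p -> q < t + e ->
  `|p - t| < e /\ `|q - t| < e.
Proof. by move=> *; rewrite !ltr_norml; split; apply/andP; split; lra. Qed.

Lemma is_derive2_cts (R : realType) (c : R -> R * R) (t : R) v : is_derive2 t c v ->
  {for t, continuous c}.
Proof.
move=> [H0 H1]; apply: cts_pair; apply: differentiable_continuous; apply/derivable1_diffP;
  exact: ex_derive.
Qed.

Lemma is_derive2_near (R : realType) (c c' : R -> R * R) (t e : R) v : 0 < e ->
  (forall s : R, `|s - t| < e -> c s = c' s) -> is_derive2 t c v -> is_derive2 t c' v.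
Proof.
move=> e0 cc; have E h : `|h| < e -> c (t + h *: (1 : R)) = c' (t + h *: (1 : R)).
  by move=> he; apply: cc; rewrite /GRing.scale /= mulr1 addrC addKr.
have E0 : c t = c' t by apply: cc; rewrite subrr normr0.
move=> [/is_derive_eps H0 /is_derive_eps H1]; split; apply/is_derive_eps => d d0.
- have [r r0 hr] := H0 d d0; exists (Num.min r e) => [|h]; first by rewrite lt_min r0.
  by rewrite lt_min => /andP[/hr + he]; rewrite /= -E // -E0.
- have [r r0 hr] := H1 d d0; exists (Num.min r e) => [|h]; first by rewrite lt_min r0.
  by rewrite lt_min => /andP[/hr + he]; rewrite /= -E // -E0.
Qed.

Section Flowlines.
Variables (R : realType) (S : immersed_surface R) (uf : 'I_3 -> R -> R).
Local Notation co := (Defs.coord S).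
Local Notation w := (wf S uf).

Definition flows_at (g : R -> S) (t : R) := {for t, continuous g} /\
  forall n, img n (g t) -> is_derive2 t (co n \o g) (w n (co n (g t))).

Definition flowline (a b : R) (g : R -> S) := forall t, a < t < b -> flows_at g t.

(** One chart is enough: by [wf_trans] the components of the field transform under the differential
    of the transition map, as the velocity of the curve does. *)
Lemma flows_at_chart n (c : R -> R * R) (t : R) :
  dom S n (c t) -> is_derive2 t c (w n (c t)) -> flows_at (par S n \o c) t.
Proof.
move=> Ut ct; split.
  apply: continuous_comp; first exact: is_derive2_cts ct.
  exact: par_continuous.
move=> m Im; have [t0 [t1 [s0 s1]]] := trans_sdiff Ut Im.
rewrite /= (wf_trans uf Ut Im s0 s1); case: ct => ct0 ct1.
by split; [exact: (sdiff_along s0 ct0 ct1)|exact: (sdiff_along s1 ct0 ct1)].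
Qed.

Lemma flows_at_near (g g' : R -> S) (t e : R) : 0 < e ->
  (forall s : R, `|s - t| < e -> g s = g' s) -> flows_at g t -> flows_at g' t.
Proof.
move=> e0 gg [gc gd]; have E : g t = g' t by apply: gg; rewrite subrr normr0.
split.
  apply/cts_at => V oV; rewrite -E => Vt.
  have [d d0 hd] := (cts_at g t).1 gc V oV Vt.
  exists (Num.min d e) => [|s]; first by rewrite lt_min d0.
  by rewrite lt_min => /andP[/hd + se]; rewrite gg.
move=> n; rewrite -E => /gd; apply: is_derive2_near e0 _ => s se.
by rewrite /= gg.
Qed.

Lemma flowline_shift a b g (s : R) : flowline a b g ->
  flowline (a - s) (b - s) (fun t => g (t + s)).
Proof.
move=> gl t; rewrite ltrBlDr ltrBrDr => /gl[gc gd]; split.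
  apply: (@continuous_comp _ _ _ (fun t => t + s) g) => //.
  by apply: cvgD; [exact: cvg_id|exact: cvg_cst].
by move=> n /gd; exact: is_derive2_shift.
Qed.

Variables (kappa beta delta : R).
Local Notation rh := (rho S kappa beta).
Local Notation mu := (@lebesgue_measure R \x @lebesgue_measure R)%E.

(** The conclusion of [expanding_flow] for the field and the density of chart [n], packaged as the
    only local information used from here on. *)
Definition flow_box n (u0 : R * R) (r L tau : R) (phi : R -> R * R -> R * R) :=
  [/\ 0 < r, 0 < L, 0 < tau, L * tau <= 4^-1 &
  [/\ forall x, `|x - u0| < r -> dom S n x /\ rh n x <= rh n u0 + 1,
      forall x y, `|x - u0| < r -> `|y - u0| < r -> `|w n x - w n y| <= L * `|x - y|,
      forall x, `|x - u0| < r / 2 -> phi 0 x = x /\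
        forall t : R, `|t| < tau -> [/\ `|phi t x - u0| < r,
          `|x - u0| < r / 4 -> `|phi t x - u0| < r / 2 &
          is_derive2 t (phi^~ x) (w n (phi t x))] &
      forall (h : R) (C : set (R * R)), 0 <= h < tau -> open C -> (forall x, C x -> `|x - u0| < r / 4) ->
        ((expR (delta / 2 * h))%:E * \int[mu]_(u in C) (rh n u)%:E <=
         \int[mu]_(u in flow_image u0 r phi h C) (rh n u)%:E)%E]].

Hypothesis boxes : forall n u, dom S n u -> exists r L tau phi, flow_box n u r L tau phi.

Lemma flowline_unique_loc (g1 g2 : R -> S) (t : R) : flows_at g1 t ->
  (exists2 e, 0 < e & forall s : R, `|s - t| < e -> flows_at g1 s /\ flows_at g2 s) ->
  g1 t = g2 t -> exists2 e : R, 0 < e & forall s : R, `|s - t| < e -> g1 s = g2 s.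
Proof.
move=> [gc1 _] [e e0 he] E.
have e00 : `|t - t| < e by rewrite subrr normr0.
have [_ [gc2 _]] := he t e00.
have [n In] := par_cover (g1 t).
pose u0 := co n (g1 t); have Uu : dom S n u0 by exact: dom_coord.
have [r [L [tau [phi [r0 L0 _ _ [rD wL _ _]]]]]] := boxes Uu.
pose V := img n `&` co n @^-1` [set x | `|x - u0| < r].
have oV : open V by apply: coord_preimage_open; exact: ball_open.
have V1 : V (g1 t) by split => //=; rewrite subrr normr0.
have [d1 d10 h1] := (cts_at g1 t).1 gc1 V oV V1.
have V2 : V (g2 t) by rewrite -E.
have [d2 d20 h2] := (cts_at g2 t).1 gc2 V oV V2.
pose d := Num.min (Num.min d1 d2) (Num.min e (4 * L)^-1) / 2.
have L4 : 0 < (4 * L)^-1 by rewrite invr_gt0 mulr_gt0.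
have d0 : 0 < d by rewrite divr_gt0 // !lt_min d10 d20 e0.
have dd s : `|s - t| <= d -> [/\ `|s - t| < d1, `|s - t| < d2 & `|s - t| < e].
  move=> sd; have : `|s - t| < Num.min (Num.min d1 d2) (Num.min e (4 * L)^-1).
    by apply: le_lt_trans sd _; rewrite /d ltr_pdivrMr // mulr_natr mulr2n ltrDl !lt_min d10 d20 e0.
  by rewrite !lt_min => /andP[/andP[-> ->] /andP[-> _]].
have dL : L * ((t + d) - (t - d)) <= 2^-1.
  have dl : d <= (4 * L)^-1 / 2 by rewrite ler_pM2r // !ge_min lexx !orbT.
  have -> : t + d - (t - d) = 2 * d by ring.
  have : L * (2 * d) <= L * (4 * L)^-1.
    by rewrite ler_pM2l //; move: dl; clear; lra.
  rewrite (_ : L * (4 * L)^-1 = 4^-1); last by field; rewrite gt_eqF.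
  by clear; lra.
exists d => // s sd.
have ab (x : R) : t - d <= x <= t + d -> `|x - t| <= d.
  by rewrite ler_norml => /andP[p q]; apply/andP; split; move: p q; clear; lra.
have G : `|(co n \o g1) s - (co n \o g2) s| <= 2 * `|(co n \o g1) t - (co n \o g2) t|.
  apply: (flow_gronwall L0 wL (a := t - d) (b := t + d)) => //.
  - by move: d0; clear; lra.
  - by move: sd; rewrite ltr_norml => /andP[p q]; move: p q; clear => p q; apply/andP; split; lra.
  - move=> x /ab/dd[x1 x2 xe]; have [I1 B1] := h1 x x1.
    by split => //; have [[_ /(_ n I1)]] := he x xe.
  - move=> x /ab/dd[x1 x2 xe]; have [I1 B1] := h2 x x2.
    by split => //; have [_ [_ /(_ n I1)]] := he x xe.
have [s1 s2 _] := dd s (ltW sd).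
move: G; rewrite /= E subrr normr0 mulr0 normr_le0 subr_eq0 => /eqP G.
by rewrite -(parK (h1 s s1).1) G parK //; exact: (h2 s s2).1.
Qed.

(** Near a time of agreement the two curves agree by Gronwall in one chart; near a time of
    disagreement they stay apart because the surface is Hausdorff. [chain] is run on the equivalence
    between agreement at two times, which serves both directions of time. *)
Lemma flowline_unique (a b : R) (g1 g2 : R -> S) (s u : R) : flowline a b g1 -> flowline a b g2 ->
  a < s < b -> a < u < b -> g1 s = g2 s -> g1 u = g2 u.
Proof.
move=> f1 f2 sab uab.
suff H (x y : R) : a < x < b -> a < y < b -> x <= y -> (g1 x = g2 x <-> g1 y = g2 y).
  by have [/H h|/ltW/H h] := leP s u; [apply: (h _ _).1|apply: (h _ _).2].
move=> xab yab xy; apply: (@chain R (fun x y => g1 x = g2 x <-> g1 y = g2 y)) => //.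
  by move=> p q r [pq qp] [qr rq]; split; [move/pq/qr|move/rq/qp].
move=> t /andP[xt ty]; have tab : a < t < b.
  move: xab yab => /andP[ax _] /andP[_ yb].
  by rewrite (lt_le_trans ax xt) (le_lt_trans ty yb).
have [ta tb] := andP tab.
pose e1 := Num.min (t - a) (b - t).
have e10 : 0 < e1 by rewrite lt_min !subr_gt0 ta tb.
have in1 (s' : R) : `|s' - t| < e1 -> flows_at g1 s' /\ flows_at g2 s'.
  rewrite lt_min !ltr_norml => /andP[/andP[p _] /andP[_ q]].
  have sab' : a < s' < b by move: p q; clear -a; move=> p q; apply/andP; split; lra.
  by split; [exact: f1|exact: f2].
have conv (e : R) (P : R -> Prop) : 0 < e -> (forall s' : R, `|s' - t| < e -> P s') ->
    forall p q : R, p <= q -> t - e < p -> q < t + e -> P p /\ P q.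
  by move=> e0 h p q pq tp qt; have [pt qt'] := near_pair pq tp qt; split; exact: h.
have [E|NE] := pselect (g1 t = g2 t).
  have [e e0 he] := flowline_unique_loc (f1 t tab) (ex_intro2 _ _ e1 e10 in1) E.
  exists e => // p q _ pq _ tp qt.
  by have [-> ->] := conv e (fun s => g1 s = g2 s) e0 he p q pq tp qt.
have : (g1 t != g2 t) by apply/eqP.
have := @surf_hausdorff R S; rewrite open_hausdorff => /[apply].
move=> [[A B] /= [/set_mem At /set_mem Bt] [oA oB /eqP AB]].
have [d1 d10 h1] := (cts_at g1 t).1 (f1 t tab).1 A oA At.
have [d2 d20 h2] := (cts_at g2 t).1 (f2 t tab).1 B oB Bt.
exists (Num.min d1 d2) => [|p q _ pq _ tp qt]; first by rewrite lt_min d10.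
have hne (s' : R) : `|s' - t| < Num.min d1 d2 -> g1 s' <> g2 s'.
  rewrite lt_min => /andP[/h1 As /h2 Bs] ee.
  have : (A `&` B) (g1 s') by split => //; rewrite ee.
  by rewrite AB.
have dd0 : 0 < Num.min d1 d2 by rewrite lt_min d10.
have [np nq] := conv _ (fun s => g1 s <> g2 s) dd0 hne p q pq tp qt.
by split.
Qed.

End Flowlines.

(** * Length of curves and the topology of the induced distance *)

Section Curves.
Variables (R : realType) (S : immersed_surface R).
Local Notation co := (Defs.coord S).
Local Notation lam := (@lebesgue_measure R).

Lemma Da_cts n k u : dom S n u -> {for u, continuous (fun v => Da S n v k)}.
Proof. by move=> Uu; exact: sdiff_cts (Da_sdiff k Uu). Qed.

Lemma Db_cts n k u : dom S n u -> {for u, continuous (fun v => Db S n v k)}.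
Proof. by move=> Uu; exact: sdiff_cts (Db_sdiff k Uu). Qed.

Lemma cts_fst (f : R -> R * R) (t : R) : {for t, continuous f} -> {for t, continuous (fun s => (f s).1)}.
Proof.
move=> /cts_eps h; apply/cts_eps => e /h[r r0 hr]; exists r => // a /hr.
exact: le_trans (norm_fst (f a - f t)).
Qed.

Lemma cts_snd (f : R -> R * R) (t : R) : {for t, continuous f} -> {for t, continuous (fun s => (f s).2)}.
Proof.
move=> /cts_eps h; apply/cts_eps => e /h[r r0 hr]; exists r => // a /hr.
exact: le_trans (norm_snd (f a - f t)).
Qed.

Definition imm_comp (g : R -> S) (k : 'I_3) (s : R) : R := imm (g s) 0 k.

Lemma derive_pair (c : R -> R * R) (t : R) : derivable c t 1 -> is_derive2 t c ('D_1 c t).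
Proof.
move=> d; split.
- by apply: (@derive_proj R _ fst) => // x; exact: cvg_fst.
- by apply: (@derive_proj R _ snd) => // x; exact: cvg_snd.
Qed.

Lemma imm_comp_derive (g : R -> S) n (k : 'I_3) (t : R) v : {for t, continuous g} ->
  img n (g t) -> is_derive2 t (co n \o g) v ->
  is_derive t 1 (imm_comp g k) (Da S n (co n (g t)) k * v.1 + Db S n (co n (g t)) k * v.2).
Proof.
move=> gc In [d0 d1].
have H := sdiff_along (comp_sdiff k (dom_coord In)) d0 d1.
have [e e0 he] := (cts_at g t).1 gc _ (@img_open R S n) In.
apply/is_derive_eps => d dpos.
have [r r0 hr] := (is_derive_eps _ _ _ _).1 H d dpos.
exists (Num.min r e) => [|h]; first by rewrite lt_min r0.
rewrite lt_min => /andP[/hr + hE].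
have E0 : (comp S n k \o (co n \o g)) t = imm_comp g k t.
  by rewrite /= /comp /lpar /imm_comp /= parK.
have E1 : (comp S n k \o (co n \o g)) (t + h *: (1 : R)) = imm_comp g k (t + h *: (1 : R)).
  rewrite /= /comp /lpar /imm_comp /= parK //; apply: he.
  by rewrite /GRing.scale /= mulr1 addrC addKr.
by rewrite E0 E1.
Qed.

Lemma curve_derive (g : R -> S) n (k : 'I_3) (t : R) : C1_curve g -> img n (g t) ->
  let v := 'D_1 (co n \o g) t in
  is_derive t 1 (imm_comp g k) (Da S n (co n (g t)) k * v.1 + Db S n (co n (g t)) k * v.2).
Proof.
move=> [gc gd] In v; apply: (imm_comp_derive k _ In); first exact: gc.
by apply: derive_pair; exact: (gd n t In).1.
Qed.

Lemma curve_speed (g : R -> S) : C1_curve g -> exists df : 'I_3 -> R -> R,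
  [/\ forall k, continuous (df k), forall k (s : R), is_derive s 1 (imm_comp g k) (df k s) &
      forall s, eucl ('D_1 (imm \o g) s) = Num.sqrt (ddot (df ^~ s) (df ^~ s))].
Proof.
move=> Cg; have [gc gd] := Cg.
pose df (k : 'I_3) (s : R) := 'D_1 (imm_comp g k) s.
have dd k (s : R) : is_derive s 1 (imm_comp g k) (df k s).
  have [n In] := par_cover (g s).
  by have H := curve_derive k Cg In; apply: DeriveDef; [exact: ex_derive|].
exists df; split => //.
  move=> k t; have [n In] := par_cover (g t).
  have [e e0 he] := (cts_at g t).1 (gc t) _ (@img_open R S n) In.
  pose F s := Da S n (co n (g s)) k * ('D_1 (co n \o g) s).1 +
              Db S n (co n (g s)) k * ('D_1 (co n \o g) s).2.
  have Fc : {for t, continuous F}.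
    have cc : {for t, continuous (co n \o g)}.
      by apply: continuous_comp; [exact: gc|exact: Defs.coord_continuous].
    have vc := (gd n t In).2.
    apply: cvgD; apply: cvgM.
    - by apply: (@continuous_comp _ _ _ (co n \o g) (fun v => Da S n v k)) => //;
        exact/Da_cts/dom_coord.
    - by exact: (cts_fst vc).
    - by apply: (@continuous_comp _ _ _ (co n \o g) (fun v => Db S n v k)) => //;
        exact/Db_cts/dom_coord.
    - by exact: (cts_snd vc).
  have FE s : `|s - t| < e -> F s = df k s.
    by move=> /he Is; have H := curve_derive k Cg Is; rewrite /df (@derive_val _ _ _ _ _ _ _ H).
  apply/cts_eps => d d0; have [r r0 hr] := (cts_eps _ _).1 Fc d d0.
  exists (Num.min r e) => [|s]; first by rewrite lt_min r0.
  by rewrite lt_min => /andP[/hr + se]; rewrite !FE // subrr normr0.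
move=> s; rewrite /eucl /dot sum_ord3 /ddot.
have der : derivable (imm \o g) s 1.
  by apply/derivable_mxP => i k; rewrite ord1; have := dd k s => H; exact: ex_derive.
by rewrite (derive_mx der) !mxE.
Qed.

Lemma speed_measurable (df : 'I_3 -> R -> R) (A : set R) : (forall k, continuous (df k)) ->
  measurable A ->
  measurable_fun (A : set (measurableTypeR R)) (EFin \o fun s : R => Num.sqrt (ddot (df ^~ s) (df ^~ s))).
Proof.
move=> cdf mA; apply/measurable_EFinP.
apply: measurable_funTS; apply: continuous_measurable_fun => s.
apply: continuous_comp; last exact: sqrt_continuous.
by rewrite /ddot; apply: cvgD; [apply: cvgD|]; apply: cvgM; exact: cdf.
Qed.

Lemma length_le (g : R -> S) (M : R) : C1_curve g ->
  (forall s : R, 0 <= s <= 1 -> eucl ('D_1 (imm \o g) s) <= M) -> (curve_length g <= M%:E)%E.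
Proof.
move=> Cg h; have [df [cdf _ dE]] := curve_speed Cg.
have -> : M%:E = (\int[lam]_(t in `[0%R, 1%R]) M%:E)%E.
  by rewrite integral_cst //= lebesgue_measure_itv /= lte_fin ltr01 oppr0 adde0 mule1.
rewrite /curve_length; under eq_integral do rewrite dE.
apply: ge0_le_integral => //.
- exact: (speed_measurable cdf).
- by move=> s /=; rewrite in_itv /= lee_fin => sI; rewrite -dE h.
Qed.

Lemma length_ge (g : R -> S) (k : 'I_3) (a b : R) : C1_curve g -> 0 <= a -> a < b -> b <= 1 ->
  (`|imm_comp g k b - imm_comp g k a|%:E <= curve_length g)%E.
Proof.
move=> Cg a0 ab b1; have [df [cdf fd dE]] := curve_speed Cg.
have wc : {within `[a, b], continuous (df k)} by apply: continuous_subspaceT; exact: cdf.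
have FTC : (\int[lam]_(x in `[a, b]) (df k x)%:E = (imm_comp g k b)%:E - (imm_comp g k a)%:E)%E.
  have fc (s : R) : {for s, continuous (imm_comp g k)}.
    by apply: differentiable_continuous; apply/derivable1_diffP; have H := fd k s; exact: ex_derive.
  apply: continuous_FTC2 => //.
  - split.
    + by move=> s _; have H := fd k s; exact: ex_derive.
    + by apply: cvg_at_right_filter; exact: fc.
    + by apply: cvg_at_left_filter; exact: fc.
  - by move=> s _; rewrite derive1E; have H := fd k s; exact: derive_val.
have mk : measurable_fun (`[a, b]%classic : set (measurableTypeR R)) (EFin \o df k).
  apply/measurable_EFinP; apply: measurable_funTS; exact: continuous_measurable_fun.
have -> : `|imm_comp g k b - imm_comp g k a|%:E = `|\int[lam]_(x in `[a, b]) (df k x)%:E|%E.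
  by rewrite FTC.
apply: le_trans (le_abse_integral _ _ _) _ => //.
rewrite /curve_length; under [leRHS]eq_integral do rewrite dE.
have ms := speed_measurable cdf.
apply: (@le_trans _ _ (\int[lam]_(x in `[a, b]) (Num.sqrt (ddot (df ^~ x) (df ^~ x)))%:E)%E).
  apply: ge0_le_integral => //.
  - by apply: measurableT_comp.
  - exact: ms.
  - move=> x _; rewrite lee_fin -sqrtr_sqr ler_wsqrtr // /ddot.
    by have [-> | -> | ->] := ord3P k; rewrite -!expr2 ?lerDr ?lerDl ?addr_ge0 ?sqr_ge0 //;
      rewrite -addrA ?lerDl ?addr_ge0 ?sqr_ge0 // addrCA lerDl addr_ge0 ?sqr_ge0.
apply: ge0_subset_integral => //.
- exact: ms.
- by move=> x /=; rewrite !in_itv /= => /andP[ax xb]; rewrite (le_trans a0 ax) (le_trans xb b1).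
Qed.

End Curves.

Section InducedTopology.
Variable R : realType.

(** Pairing the combination with [a] and [b] gives a linear system with the Gram matrix, which is
    solved by Cramer's rule. *)
Lemma frame_bound (a b : 'I_3 -> R) : gdet a b != 0 -> exists2 C : R, 0 < C &
  forall x y e : R, (forall k, `|a k * x + b k * y| <= e) -> `|x| <= C * e /\ `|y| <= C * e.
Proof.
move=> D0; pose D := gdet a b.
pose P := ddot a a; pose Q := ddot a b; pose T := ddot b b.
have D1 : P * T - Q ^+ 2 != 0 by exact: D0.
pose N := (`|a 0| + `|a 1| + `|a ord_max|) + (`|b 0| + `|b 1| + `|b ord_max|).
exists (1 + `|(P * T - Q ^+ 2)^-1| * (`|P| + `|Q| + `|T|) * N).
  by rewrite ltr_pwDl // !mulr_ge0 ?addr_ge0.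
move=> x y e h; have e0 : 0 <= e := le_trans (normr_ge0 _) (h 0).
pose A k := a k * x + b k * y.
have EA : ddot a A = P * x + Q * y by rewrite /P /Q /A /ddot; clear; ring.
have EB : ddot b A = Q * x + T * y by rewrite /Q /T /A /ddot; clear; ring.
have bnd (f : 'I_3 -> R) : `|ddot f A| <= (`|f 0| + `|f 1| + `|f ord_max|) * e.
  apply: le_trans (ler_normD _ _) _; rewrite mulrDl; apply: lerD.
    by apply: le_trans (ler_normD _ _) _; rewrite mulrDl !normrM; apply: lerD; rewrite ler_wpM2l // h.
  by rewrite normrM ler_wpM2l // h.
have bA : `|ddot a A| <= N * e.
  by apply: le_trans (bnd a) _; rewrite ler_wpM2r // lerDl !addr_ge0.
have bB : `|ddot b A| <= N * e.
  by apply: le_trans (bnd b) _; rewrite ler_wpM2r // lerDr !addr_ge0.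
have key (s t z : R) : z = (P * T - Q ^+ 2)^-1 * (s * ddot a A - t * ddot b A) ->
    `|s| + `|t| <= `|P| + `|Q| + `|T| ->
    `|z| <= (1 + `|(P * T - Q ^+ 2)^-1| * (`|P| + `|Q| + `|T|) * N) * e.
  move=> -> st; move: (_^-1) => iD; rewrite normrM.
  have -> : (1 + `|iD| * (`|P| + `|Q| + `|T|) * N) * e =
    e + `|iD| * ((`|P| + `|Q| + `|T|) * (N * e)) by ring.
  apply: (@le_trans _ _ (`|iD| * ((`|P| + `|Q| + `|T|) * (N * e)))); last by rewrite lerDr.
  rewrite ler_wpM2l //; apply: le_trans (ler_normB _ _) _; rewrite !normrM.
  apply: (@le_trans _ _ ((`|s| + `|t|) * (N * e))).
    by rewrite mulrDl; apply: lerD; rewrite ler_wpM2l.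
  by rewrite ler_wpM2r // (le_trans _ bA).
have pq : 0 <= `|P| by []; have qq : 0 <= `|Q| by []; have tt : 0 <= `|T| by [].
split.
- apply: (key T Q); first by rewrite EA EB; field.
  by move: pq; clear; lra.
- apply: (key (- Q) (- P)); first by rewrite EA EB; field.
  by rewrite !normrN; move: tt; clear; lra.
Qed.

Variable S : immersed_surface R.
Local Notation co := (Defs.coord S).

(** If all coordinates changed by less than [m * |x - y|], the differential at [u] would move x - y
    by at most twice that amount in each coordinate. With [m = (4 * C)^-1], [frame_bound] would then
    give [|x - y| <= |x - y| / 2]. *)
Lemma comp_expand n u : dom S n u -> exists r m : R, [/\ 0 < r, 0 < m &
  forall x y, `|x - u| < r -> `|y - u| < r ->
    exists k, m * `|x - y| <= `|comp S n k x - comp S n k y|].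
Proof.
move=> Uu; have D0 : gdet (Da S n u) (Db S n u) != 0 by rewrite gt_eqF // dg_gt0.
have [C C0 hC] := frame_bound D0.
pose m := (4 * C)^-1; have m0 : 0 < m by rewrite invr_gt0 mulr_gt0.
have [r0 r00 h0] := comp_sdiff 0 Uu m0; have [r1 r10 h1] := comp_sdiff 1 Uu m0.
have [r2 r20 h2] := comp_sdiff ord_max Uu m0.
exists (Num.min (Num.min r0 r1) r2), m; split => //; first by rewrite !lt_min r00 r10.
move=> x y; rewrite !lt_min => /andP[/andP[x0 x1] x2] /andP[/andP[y0 y1] y2].
apply: contrapT => /forallNP ne.
have lt k : `|comp S n k x - comp S n k y| < m * `|x - y| by rewrite ltNge; apply/negP/ne.
have xy0 : 0 < `|x - y| by rewrite -(pmulr_rgt0 _ m0); apply: le_lt_trans (lt 0).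
have tri (s t z : R) : `|s - t| <= z -> `|s| <= z -> `|t| <= 2 * z.
  by rewrite !ler_norml => /andP[? ?] /andP[? ?]; apply/andP; split; lra.
have AB k : `|Da S n u k * (x.1 - y.1) + Db S n u k * (x.2 - y.2)| <= 2 * (m * `|x - y|).
  apply: tri (ltW (lt k)).
  by have [-> | -> | ->] := ord3P k; [exact: h0|exact: h1|exact: h2].
have [B1 B2] := hC _ _ _ AB.
have E : C * (2 * (m * `|x - y|)) = `|x - y| / 2 by rewrite /m; field; rewrite gt_eqF.
rewrite E in B1 B2.
have : `|x - y| <= `|x - y| / 2 by rewrite [leLHS]prod_normE ge_max B1.
by move: xy0; clear; lra.
Qed.

Lemma square_compact (u : R * R) (r : R) : compact [set x : R * R | `|x - u| <= r].
Proof.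
have -> : [set x : R * R | `|x - u| <= r] = `[u.1 - r, u.1 + r] `*` `[u.2 - r, u.2 + r].
  apply/seteqP; split=> x /=; rewrite !in_itv /= prod_normE ge_max !ler_norml.
    by move=> /andP[/andP[? ?] /andP[? ?]]; split; apply/andP; split; rewrite ?lerBlDl ?lerBlDr //= -?lerBlDl -?lerBrDl ?lerBrDr //; lra.
  by move=> [/andP[? ?] /andP[? ?]]; apply/andP; split; apply/andP; split; rewrite /=; lra.
by apply: compact_setX; exact: segment_compact.
Qed.

Lemma par_square_closed n u (r : R) : (forall x, `|x - u| <= r -> dom S n x) ->
  closed (par S n @` [set x | `|x - u| <= r]).
Proof.
move=> h; apply: compact_closed; first exact: surf_hausdorff.
apply: continuous_compact; last exact: square_compact.
apply: continuous_in_subspaceT => x /set_mem /h; exact: par_continuous.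
Qed.

(* A curve ending at [p] that leaves a small coordinate square around [p] has
   a last exit point on the boundary of the square, and covers from there on a
   length comparable to the side of the square. *)
Lemma dist_nbhs (p : S) (V : set S) : open V -> V p ->
  exists2 e : R, 0 < e & forall q, (induced_dist q p < e%:E)%E -> V q.
Proof.
move=> oV Vp; have [n Ip] := par_cover p; pose u0 := co n p.
have Uu : dom S n u0 by exact: dom_coord.
have pE : par S n u0 = p by exact: parK.
have Ou : (dom S n `&` par S n @^-1` V) u0 by split => //=; rewrite pE.
have [s0 s00 hs] := open_eps (par_preimage_open oV) Ou.
have [r0 [m [r00 m0 hm]]] := comp_expand Uu.
pose r := Num.min s0 r0 / 2.
have rm : 0 < Num.min s0 r0 by rewrite lt_min s00.
have rr : 0 < r by rewrite divr_gt0.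
have r2 : r < Num.min s0 r0 by rewrite /r; move: rm; clear; lra.
have [rs rr0] : r < s0 /\ r < r0 by move: r2; rewrite lt_min => /andP.
have inO x : `|x - u0| <= r -> dom S n x /\ V (par S n x).
  by move=> xr; apply: hs; exact: le_lt_trans xr rs.
pose B := par S n @` [set x | `|x - u0| < r].
pose K := par S n @` [set x | `|x - u0| <= r].
have oB : open B.
  by apply: par_image_open; [exact: ball_open|move=> x /ltW /inO[]].
have cK : closed K by apply: par_square_closed => x /inO[].
have Bp : B p by exists u0 => //=; rewrite subrr normr0.
exists (m * r) => [|q]; first exact: mulr_gt0.
move=> /ereal_inf_lt[_ [g [Cg g0 g1] <-] len].
have [[x /ltW /inO[_ Vx] <-] //|nB] := pselect (B q).
exfalso; pose Z := [set s : R | 0 <= s <= 1 /\ ~ B (g s)].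
have Z0 : Z 0 by rewrite /Z /= lexx ler01 g0.
have Z1 : has_sup Z by split; [exists 0|exists 1 => s [/andP[]]].
pose s := sup Z.
have s_ge0 : 0 <= s by exact: ub_le_sup Z1.2 _ Z0.
have s_le1 : s <= 1 by apply: ge_sup; [exists 0|move=> z [/andP[]]].
have [gc _] := Cg.
have nBs : ~ B (g s).
  move=> Bs; have [e e0 he] := (cts_at g s).1 (gc s) B oB Bs.
  have [z Zz sz] := sup_adherent e0 Z1.
  apply: (Zz.2); apply: he; rewrite ltr_norml.
  have zs : z <= s by exact: ub_le_sup Z1.2 _ Zz.
  by move: sz zs e0; rewrite -/s; clear => ? ? ?; apply/andP; split; lra.
have s_lt1 : s < 1 by rewrite lt_neqAle s_le1 andbT; apply/eqP => E; apply: nBs; rewrite E g1.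
have after z : s < z -> z <= 1 -> B (g z).
  move=> sz z1; apply: contrapT => nz.
  have : z <= s by apply: ub_le_sup Z1.2 _ _; split => //; rewrite (le_trans s_ge0 (ltW sz)).
  by rewrite leNgt sz.
have Ks : K (g s).
  apply: contrapT => nK.
  have [e e0 he] := (cts_at g s).1 (gc s) (~` K) (closed_openC cK) nK.
  pose z := Num.min 1 (s + e / 2).
  have sz : s < z by rewrite lt_min s_lt1 ltrDl divr_gt0.
  have [x xr E] := after z sz (ltac:(by rewrite ge_min lexx)).
  apply: (he z); last by exists x => //; exact: ltW.
  rewrite gtr0_norm ?subr_gt0 //.
  have : z <= s + e / 2 by rewrite ge_min lexx orbT.
  by move: e0; clear; lra.
have [x xr E] := Ks.
have xE : `|x - u0| = r.
  apply/eqP; rewrite eq_le xr leNgt; apply/negP => h; apply: nBs; exists x => //.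
have xr0 : `|x - u0| < r0 by rewrite xE.
have uu0 : `|u0 - u0| < r0 by rewrite subrr normr0.
have [k] := hm x u0 xr0 uu0; rewrite xE.
have -> : comp S n k x = imm_comp g k s by rewrite /comp /lpar /imm_comp /= E.
have -> : comp S n k u0 = imm_comp g k 1 by rewrite /comp /lpar /imm_comp /= pE g1.
move=> le; have := length_ge k Cg s_ge0 s_lt1 (lexx 1).
rewrite leNgt => /negP; apply; apply: lt_le_trans len _.
by rewrite lee_fin distrC.
Qed.

End InducedTopology.

Lemma sum3_le (R : realType) (x y z b : R) : 0 <= b -> x <= b -> y <= b -> z <= b ->
  x + y + z <= 2 ^+ 2 * b.
Proof. by lra. Qed.

Lemma is_derive_unique (R : realType) (f : R -> R) (t a b : R) :
  is_derive t 1 f a -> is_derive t 1 f b -> a = b.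
Proof. by move=> [_ <-] [_ <-]. Qed.

Lemma is_derive2_comp (R : realType) (c : R -> R * R) (tau : R -> R) (x s : R) v :
  is_derive2 (tau x) c v -> is_derive x 1 tau s -> is_derive2 x (c \o tau) (s * v.1, s * v.2).
Proof.
move=> [H0 H1] T; split; rewrite /= mulrC.
- exact: (is_derive1_comp H0 T).
- exact: (is_derive1_comp H1 T).
Qed.

Lemma ddot_scale (R : realType) (f g : 'I_3 -> R) (p : R) : (forall k, f k = p * g k) ->
  ddot f f = p ^+ 2 * ddot g g.
Proof. by move=> fE; rewrite /ddot !fE; ring. Qed.

(** * Speed of flow lines and their existence for all positive times *)

Section GlobalFlow.
Variables (R : realType) (S : immersed_surface R) (uf : 'I_3 -> R -> R) (kappa beta delta : R).
Local Notation co := (Defs.coord S).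
Local Notation w := (wf S uf).

Lemma is_derive2_val (c : R -> R * R) (t : R) v : is_derive2 t c v ->
  derivable c t 1 /\ 'D_1 c t = v.
Proof.
move=> [[d0 v0] [d1 v1]].
have C : h^-1 *: (c (h *: (1 : R) + t) - c t) @[h --> 0^'] --> v.
  have C1 : h^-1 *: ((fst \o c) (h *: (1 : R) + t) - (fst \o c) t) @[h --> 0^'] --> v.1.
    by rewrite -v0; exact: d0.
  have C2 : h^-1 *: ((snd \o c) (h *: (1 : R) + t) - (snd \o c) t) @[h --> 0^'] --> v.2.
    by rewrite -v1; exact: d1.
  by rewrite [v]surjective_pairing; exact: (cvg_pair C1 C2).
by split; [apply/cvg_ex; exists v|exact: cvg_lim C].
Qed.

(** A [C1_curve] has to be defined on all of the line, whereas a flow line may exist on an interval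
    only. This function takes its values between 0 and 1 everywhere and goes from 0 at 0 to 1 at 1,
    so reparametrising by it never leaves the interval. *)
Definition smooth_step (x : R) : R := sin (pi / 2 * x) ^+ 2.

Lemma smooth_step_derive (x : R) :
  is_derive x 1 smooth_step (pi * (sin (pi / 2 * x) * cos (pi / 2 * x))).
Proof.
have H : is_derive x 1 (fun x => sin (pi / 2 * x)) (pi / 2 * cos (pi / 2 * x)).
  by apply: is_derive_scale => z; exact: is_derive_sin.
have := is_deriveM H H; rewrite (_ : _ * _ = smooth_step); last by apply/funext => z; rewrite /smooth_step expr2.
by congr (is_derive _ _ _ _); rewrite /GRing.scale /=; field.
Qed.

Lemma smooth_step_itv x : 0 <= smooth_step x <= 1.
Proof. by rewrite /smooth_step sqr_ge0 -(real_normK (num_real (sin _))) expr_le1 ?sin_max. Qed.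

Variable B : R.
Hypothesis B0 : 0 < B.
Hypothesis ufB : forall n u k, dom S n u -> `|uf k (comp S n 0 u)| <= B.
Hypothesis boxes : forall n u, dom S n u ->
  exists r L tau phi, flow_box S uf kappa beta delta n u r L tau phi.

Lemma w_cts n u : dom S n u -> {for u, continuous (w n)}.
Proof.
move=> Uu; have [r [L [tau [phi [r0 L0 _ _ [_ wL _ _]]]]]] := boxes Uu.
apply/cts_eps => e e0; exists (Num.min r (e / L)) => [|x]; first by rewrite lt_min r0 divr_gt0.
rewrite lt_min => /andP[xr xe]; apply: le_trans (wL _ _ xr _) _; first by rewrite subrr normr0.
by rewrite mulrC -ler_pdivlMr // ltW.
Qed.

(** Projection to the tangent plane does not increase length; three coordinates bounded by [B] give
    squared length at most 3 B^2, rounded up to (2 B)^2. *)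
Lemma w_speed n u (v := w n u) (V := fun k => Da S n u k * v.1 + Db S n u k * v.2) :
  dom S n u -> ddot V V <= (2 * B) ^+ 2.
Proof.
move=> Uu; have g0 : gdet (Da S n u) (Db S n u) != 0 by rewrite gt_eqF // dg_gt0.
have := wfield_bound (UU S uf n u) g0; rewrite /= -/(w n u) -/v.
have -> : (fun k => v.1 * Da S n u k + v.2 * Db S n u k) = V.
  by apply/funext => k; congr (_ + _); exact: mulrC.
move=> /le_trans; apply.
have sq k : UU S uf n u k * UU S uf n u k <= B ^+ 2.
  by rewrite -expr2 -(real_normK (num_real (UU _ _ _ _ _))) ler_sqr ?nnegrE ?(ltW B0) // ufB.
by rewrite exprMn; apply: sum3_le; rewrite ?sqr_ge0.
Qed.

(** The factor 2 B bounds the speed of the flow and pi bounds the slope of [smooth_step]. What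
    matters is that [G] in [reach_total] becomes Lipschitz. *)
Lemma flowline_dist (g : R -> S) (a b s t : R) : flowline uf a b g -> a < s < b -> a < t < b ->
  (induced_dist (g s) (g t) <= (2 * pi * B * `|t - s|)%:E)%E.
Proof.
move=> gl sab tab.
pose tau x := s + (t - s) * smooth_step x.
have tau_in x : a < tau x < b.
  have /andP[h0 h1] := smooth_step_itv x.
  move: sab tab => /andP[as_ sb] /andP[at_ tb].
  have [st|ts] := leP s t.
    have d0 : 0 <= t - s by rewrite subr_ge0.
    have l1 : s <= tau x by rewrite lerDl mulr_ge0.
    have l2 : tau x <= t.
      by rewrite /tau -lerBrDl -[leRHS]mulr1; exact: ler_wpM2l.
    by rewrite (lt_le_trans as_ l1) (le_lt_trans l2 tb).
  have d0 : 0 <= s - t by rewrite subr_ge0 ltW.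
  have E : tau x = s - (s - t) * smooth_step x by rewrite /tau -(opprB s t) mulNr.
  have l1 : tau x <= s by rewrite E lerBlDr lerDl mulr_ge0.
  have l2 : t <= tau x.
    by rewrite E lerBrDr -lerBrDl -[leRHS]mulr1; exact: ler_wpM2l.
  by rewrite (lt_le_trans at_ l2) (le_lt_trans l1 sb).
pose sp (x : R) := (t - s) * (pi * (sin (pi / 2 * x) * cos (pi / 2 * x))).
have tau_d (x : R) : is_derive x 1 tau (sp x).
  have := is_deriveD (is_derive_cst s x (1 : R)) (is_derive_mulc (t - s) (smooth_step_derive x)).
  by rewrite add0r.
have tau_c : continuous tau.
  by move=> x; apply: differentiable_continuous; apply/derivable1_diffP; have H := tau_d x; exact: ex_derive.
have sp_c : continuous sp.
  have lc : continuous (fun x : R => pi / 2 * x).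
    by move=> x; apply: cvgM; [exact: cvg_cst|exact: cvg_id].
  move=> x; apply: cvgM; first exact: cvg_cst.
  apply: cvgM; first exact: cvg_cst.
  have sc : continuous (sin \o (fun x : R => pi / 2 * x)).
    by move=> y; apply: continuous_comp; [exact: lc|exact: continuous_sin].
  have cc : continuous (cos \o (fun x : R => pi / 2 * x)).
    by move=> y; apply: continuous_comp; [exact: lc|exact: continuous_cos].
  by apply: cvgM; [exact: sc|exact: cc].
pose h := g \o tau.
have hc : continuous h by move=> x; apply: continuous_comp; [exact: tau_c|exact: (gl _ (tau_in x)).1].
have hd n (x : R) : img n (h x) -> is_derive2 x (co n \o h)
    (sp x * (w n (co n (h x))).1, sp x * (w n (co n (h x))).2).
  by move=> /(gl _ (tau_in x)).2 H; exact: (is_derive2_comp H (tau_d x)).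
have hC1 : C1_curve h.
  split=> // n x Ih; have [d1 d2] := is_derive2_val (hd n x Ih); split => //.
  have [e e0 he] := (cts_at h x).1 (hc x) _ (@img_open R S n) Ih.
  have E (y : R) : `|y - x| < e ->
      'D_1 (co n \o h) y = (sp y * (w n (co n (h y))).1, sp y * (w n (co n (h y))).2).
    by move=> /he Iy; exact: (is_derive2_val (hd n y Iy)).2.
  have cw : {for x, continuous (fun y => w n (co n (h y)))}.
    apply: (@continuous_comp _ _ _ (co n \o h) (w n)); last exact/w_cts/dom_coord.
    by apply: continuous_comp; [exact: hc|exact: Defs.coord_continuous].
  have cF : {for x, continuous (fun y => (sp y * (w n (co n (h y))).1, sp y * (w n (co n (h y))).2))}.
    by apply: cts_pair; apply: cvgM; (try exact: sp_c); [exact: (cts_fst cw)|exact: (cts_snd cw)].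
  apply/cts_eps => d d0; have [r r0 hr] := (cts_eps _ _).1 cF d d0.
  exists (Num.min r e) => [|y]; first by rewrite lt_min r0.
  by rewrite lt_min => /andP[/hr + ye]; rewrite !E // subrr normr0.
have h0 : h 0 = g s.
  by rewrite /h /= /tau /smooth_step mulr0 sin0 expr0n /= mulr0 addr0.
have h1 : h 1 = g t.
  by rewrite /h /= /tau /smooth_step mulr1 sin_pihalf expr1n mulr1 addrC subrK.
have len : (curve_length h <= (2 * pi * B * `|t - s|)%:E)%E.
  apply: length_le => // x _; have [df [_ dfd ->]] := curve_speed hC1.
  have [n Ih] := par_cover (h x).
  set v := w n (co n (h x)).
  have fin (D E p q r : R) : D * (p * q) + E * (p * r) = p * (D * q + E * r) by ring.
  have E k : df k x = sp x * (Da S n (co n (h x)) k * v.1 + Db S n (co n (h x)) k * v.2).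
    have H := dfd k x; have H' := imm_comp_derive k (hc x) Ih (hd n x Ih).
    by rewrite (is_derive_unique H H'); exact: fin.
  have -> : ddot (df ^~ x) (df ^~ x) = sp x ^+ 2 *
     ddot (fun k => Da S n (co n (h x)) k * v.1 + Db S n (co n (h x)) k * v.2)
       (fun k => Da S n (co n (h x)) k * v.1 + Db S n (co n (h x)) k * v.2).
    exact: ddot_scale.
  have sB : `|sp x| <= pi * `|t - s|.
    rewrite /sp !normrM (ger0_norm (pi_ge0 R)) mulrC.
    rewrite ler_wpM2r // -[leRHS]mulr1 ler_wpM2l ?pi_ge0 //.
    by rewrite -[leRHS]mulr1 ler_pM ?sin_max ?cos_max.
  apply: le_trans (_ : Num.sqrt (sp x ^+ 2 * (2 * B) ^+ 2) <= _).
    by apply: ler_wsqrtr; rewrite ler_wpM2l ?sqr_ge0 // w_speed //; exact: dom_coord.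
  have B2 : 0 <= 2 * B by rewrite mulr_ge0 // ltW.
  rewrite -exprMn sqrtr_sqr normrM (ger0_norm B2).
  rewrite (_ : 2 * pi * B * `|t - s| = pi * `|t - s| * (2 * B)); last by ring.
  by rewrite ler_wpM2r.
by apply: le_trans len; apply: ereal_inf_lbound; exists h.
Qed.

End GlobalFlow.

Section Completeness.
Variables (R : realType) (S : immersed_surface R) (uf : 'I_3 -> R -> R) (kappa beta delta B : R).
Local Notation co := (Defs.coord S).
Local Notation w := (wf S uf).
Local Notation flowline := (@flowline R S uf).
Hypothesis B0 : 0 < B.
Hypothesis ufB : forall n u k, dom S n u -> `|uf k (comp S n 0 u)| <= B.
Hypothesis boxes : forall n u, dom S n u ->
  exists r L tau phi, flow_box S uf kappa beta delta n u r L tau phi.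

(** The flow line exists slightly before time 0 and slightly after time [t]. This makes both times
    interior, as uniqueness and gluing require. *)
Definition reach (p : S) (t : R) (q : S) := exists g a b,
  [/\ flowline a b g, a < 0, t < b, g 0 = p & g t = q].

Lemma flowline_sub (a b a' b' : R) g : flowline a b g -> a <= a' -> b' <= b -> flowline a' b' g.
Proof.
move=> gl aa bb t /andP[at_ tb]; apply: gl.
by rewrite (le_lt_trans aa at_) (lt_le_trans tb bb).
Qed.

Lemma reach_unique p q q' (t : R) : 0 <= t -> reach p t q -> reach p t q' -> q = q'.
Proof.
move=> t0 [g [a [b [gl a0 tb g0 <-]]]] [g' [a' [b' [gl' a0' tb' g0' <-]]]].
apply: (@flowline_unique R S uf kappa beta delta boxes (Num.max a a') (Num.min b b') g g' 0 t).
- by apply: flowline_sub gl _ _; rewrite ?le_max ?ge_min lexx.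
- by apply: flowline_sub gl' _ _; rewrite ?le_max ?ge_min lexx orbT.
- by rewrite gt_max lt_min a0 a0' (le_lt_trans t0 tb) (le_lt_trans t0 tb').
- by rewrite gt_max lt_min tb tb' (lt_le_trans a0 t0) (lt_le_trans a0' t0).
- by rewrite g0 g0'.
Qed.

Lemma reach_injective p p' q (t : R) : 0 <= t -> reach p t q -> reach p' t q -> p = p'.
Proof.
move=> t0 [g [a [b [gl a0 tb <- gt]]]] [g' [a' [b' [gl' a0' tb' <- gt']]]].
apply: (@flowline_unique R S uf kappa beta delta boxes (Num.max a a') (Num.min b b') g g' t 0).
- by apply: flowline_sub gl _ _; rewrite ?le_max ?ge_min lexx.
- by apply: flowline_sub gl' _ _; rewrite ?le_max ?ge_min lexx orbT.
- by rewrite gt_max lt_min tb tb' (lt_le_trans a0 t0) (lt_le_trans a0' t0).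
- by rewrite gt_max lt_min a0 a0' (le_lt_trans t0 tb) (le_lt_trans t0 tb').
- by rewrite gt gt'.
Qed.

Lemma flowline_glue (a b c d s : R) (g g' : R -> S) : flowline a b g -> flowline c d g' ->
  a < s < b -> c < s < d -> g s = g' s -> flowline a d (fun t => if t <= s then g t else g' t).
Proof.
move=> gl gl' sab scd E t /andP[at_ td].
have [as_ sb] := andP sab; have [cs sd] := andP scd.
have [ts|st|ts] := ltgtP t s.
- apply: (@flows_at_near R S uf g _ t (s - t)); first by rewrite subr_gt0.
    move=> z; rewrite ltr_norml => /andP[_ zt]; case: ifP => // /negbT; rewrite -ltNge => h.
    by exfalso; move: zt h; lra.
  by apply: gl; rewrite at_ (lt_trans ts sb).
- apply: (@flows_at_near R S uf g' _ t (t - s)); first by rewrite subr_gt0.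
    by move=> z; rewrite ltr_norml => /andP[zt _]; case: ifP => // h; exfalso; move: zt h; lra.
  by apply: gl'; rewrite td (lt_trans cs st).
- rewrite ts in at_ td *.
  pose e := Num.min (Num.min (s - a) (b - s)) (Num.min (s - c) (d - s)).
  have e0 : 0 < e by rewrite !lt_min !subr_gt0 as_ sb cs sd.
  apply: (@flows_at_near R S uf g _ s e) => // [z|]; last exact: gl.
  rewrite !lt_min !ltr_norml => /andP[/andP[/andP[z1 _] /andP[_ z2]] /andP[/andP[z3 _] /andP[_ z4]]].
  case: ifP => // _.
  apply: (@flowline_unique R S uf kappa beta delta boxes (Num.max a c) (Num.min b d) g g' s z) => //.
  + by apply: flowline_sub gl _ _; rewrite ?le_max ?ge_min lexx.
  + by apply: flowline_sub gl' _ _; rewrite ?le_max ?ge_min lexx orbT.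
  + by rewrite gt_max lt_min as_ sb cs sd.
  + rewrite gt_max lt_min -(subr_gt0 a) -(subr_gt0 c) -(subr_gt0 z) -(subr_gt0 z d).
    by apply/andP; split; apply/andP; split; move: z1 z2 z3 z4; lra.
Qed.

Lemma reach_trans p q z (s t : R) : 0 <= s -> 0 <= t -> reach p s q -> reach q t z -> reach p (s + t) z.
Proof.
move=> s0 t0 [g [a [b [gl a0 sb g0 gs]]]] [g' [a' [b' [gl' a0' tb' g0' gt']]]].
have gl2 := flowline_shift (s := - s) gl'; rewrite !opprK in gl2.
exists (fun t => if t <= s then g t else g' (t - s)), a, (b' + s); split => //.
- apply: (flowline_glue gl gl2); last by rewrite subrr g0'.
  + by rewrite (lt_le_trans a0 s0).
  + by apply/andP; split; [move: a0'; lra|move: t0 tb'; lra].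
- by rewrite addrC ltrD2r.
- by rewrite s0.
- case: ifP => [h|_]; last by rewrite addrAC subrr add0r.
  have t00 : t = 0 by apply/eqP; rewrite eq_le t0 andbT; move: h; lra.
  by rewrite t00 addr0 gs -g0' -gt' t00.
Qed.

Lemma box_flowline n u0 r L tau phi x : flow_box S uf kappa beta delta n u0 r L tau phi ->
  `|x - u0| < r / 2 -> flowline (- tau) tau (fun t => par S n (phi t x)).
Proof.
move=> [r0 L0 tau0 _ [rD _ fl _]] xr t; rewrite -ltr_norml => tt.
have [_ /(_ t tt)[h1 _ h2]] := fl x xr.
by apply: (@flows_at_chart R S uf n (phi^~ x)) => //; exact: (rD _ h1).1.
Qed.

Lemma reach_box n u0 r L tau phi x (t : R) : flow_box S uf kappa beta delta n u0 r L tau phi ->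
  `|x - u0| < r / 2 -> 0 <= t < tau -> reach (par S n x) t (par S n (phi t x)).
Proof.
move=> fb xr /andP[t0 tt]; exists (fun t => par S n (phi t x)), (- tau), tau; split => //.
- exact: box_flowline fb xr.
- by case: fb => _ _ tau0 _ _; rewrite oppr_lt0.
- by case: fb => _ _ _ _ [_ _ fl _]; rewrite (fl x xr).1.
Qed.

Hypothesis complete : complete_surface S.

(** Escape argument. If the attained times had a supremum [s] short of [T], the positions at times
    tending to [s] would form a Cauchy sequence, hence converge to some [q]. A flow box around [q]
    has a fixed lifetime [tau'], so it carries one of these positions past [s]. [dist_nbhs] is what
    turns convergence in the induced distance into entry in the box. *)
Lemma reach_total p (T : R) : 0 <= T -> exists q, reach p T q.
Proof.
move=> T0; apply: contrapT => nT.
pose A := [set t : R | 0 <= t /\ exists q, reach p t q].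
have down s t : A t -> 0 <= s -> s <= t -> A s.
  move=> [t0 [q [g [a [b [gl a0 tb g0 gt]]]]]] s0 st; split => //.
  by exists (g s), g, a, b; split => //; exact: le_lt_trans st tb.
have AT t : A t -> t < T.
  by move=> At; rewrite ltNge; apply/negP => Tt; have [_] := down T t At T0 Tt; exact: nT.
have [n Ip] := par_cover p; have Uu := dom_coord Ip.
have [r [L [tau [phi fb]]]] := boxes Uu.
have [r0 _ tau0 _ _] := fb.
have A1 : A (tau / 2).
  split; first by rewrite divr_ge0 // ltW.
  rewrite -(parK Ip); eexists; apply: (reach_box fb).
    by rewrite subrr normr0 divr_gt0.
  by apply/andP; split; move: tau0; lra.
have hsA : has_sup A by split; [exists (tau / 2)|exists T => t /AT /ltW].
pose s := sup A.
have s0 : 0 < s by apply: lt_le_trans (ub_le_sup hsA.2 A1); rewrite divr_gt0.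
have belowA t : 0 <= t -> t < s -> A t.
  move=> t0 ts; have [z Az] := sup_adherent (eps := s - t) (ltac:(by rewrite subr_gt0)) hsA.
  by rewrite -/s opprB addrC subrK => tz; exact: down Az t0 (ltW tz).
have /choice[G hG] : forall t, exists q, 0 <= t -> t < s -> reach p t q.
  move=> t; have [/andP[t0 ts]|h] := boolP ((0 <= t) && (t < s)).
    by have [_ [q hq]] := belowA t t0 ts; exists q.
  by exists p => t0 ts; move: h; rewrite t0 ts.
have Gd (t t' : R) : 0 <= t < s -> 0 <= t' < s ->
    (induced_dist (G t) (G t') <= (2 * pi * B * `|t' - t|)%:E)%E.
  move=> /andP[t0 ts] /andP[t0' ts'].
  pose m := Num.max t t'.
  have m0 : 0 <= m by rewrite le_max t0.
  have ms : m < s by rewrite gt_max ts ts'.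
  have [g [a [b [gl a0 mb g0 gm]]]] := hG m m0 ms.
  have val z : 0 <= z -> z <= m -> g z = G z.
    move=> z0 zm; apply: (@reach_unique p _ _ z z0).
      by exists g, a, b; split => //; exact: le_lt_trans zm mb.
    by apply: hG => //; exact: le_lt_trans zm ms.
  rewrite -!val ?le_max ?lexx ?orbT //.
  apply: (flowline_dist B0 ufB boxes gl).
  - by rewrite (lt_le_trans a0 t0) (le_lt_trans _ mb) // le_max lexx.
  - by rewrite (lt_le_trans a0 t0') (le_lt_trans _ mb) // le_max lexx orbT.
pose tn (k : nat) := s - s / k.+1%:R.
have sk (k : nat) : 0 < s / k.+1%:R by rewrite divr_gt0.
have tnI k : 0 <= tn k < s.
  rewrite /tn subr_ge0 gtrBl sk andbT ler_pdivrMr // ler_peMr ?(ltW s0) //.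
  by rewrite ler1n.
have small (e : R) : 0 < e -> exists N, forall k, (N <= k)%N -> s / k.+1%:R < e.
  move=> e0; exists (Num.truncn (s / e)).+1 => k Nk.
  rewrite ltr_pdivrMr // mulrC -ltr_pdivrMr //.
  apply: lt_trans (truncnS_gt _) _; rewrite ltr_nat; exact: leq_trans Nk _.
have C0 : 0 < 2 * pi * B by rewrite !mulr_gt0 // pi_gt0.
have [q cq] : exists q, induced_dist (G (tn k)) q @[k --> \oo] --> 0%E.
  apply: complete => e e0.
  have [N hN] := small (e / (2 * pi * B)) (ltac:(by rewrite divr_gt0)).
  exists N => m k Nm Nk; apply: le_lt_trans (Gd _ _ (tnI m) (tnI k)) _.
  rewrite lte_fin mulrC -ltr_pdivlMr //.
  have := hN m Nm; have := hN k Nk; have := sk m; have := sk k.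
  rewrite /tn ltr_norml; move: (s / _) (s / _) (e / _) => x y z.
  by move=> *; apply/andP; split; lra.
have [m Iq] := par_cover q; have Uq := dom_coord Iq.
have [r' [L' [tau' [phi' fb']]]] := boxes Uq.
have [r0' _ tau0' _ _] := fb'.
pose V := img m `&` co m @^-1` [set x | `|x - co m q| < r' / 2].
have oV : open V by apply: coord_preimage_open; exact: ball_open.
have Vq : V q by split => //=; rewrite subrr normr0 divr_gt0.
have [e e0 he] := dist_nbhs oV Vq.
have : \forall k \near \oo, (induced_dist (G (tn k)) q < e%:E)%E.
  apply: (cq [set x | (x < e%:E)%E]); apply: open_nbhs_nbhs; split; last by rewrite /= lte_fin.
  exact: open_ereal_lt_ereal.
move=> [N1 _ hN1]; have [N2 hN2] := small (tau' / 2) (ltac:(by rewrite divr_gt0)).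
pose k := maxn N1 N2.
have [Ig xg] : V (G (tn k)) by apply: he; apply: hN1; rewrite /= leq_maxl.
have tk : s / k.+1%:R < tau' / 2 by apply: hN2; exact: leq_maxr.
have /andP[t0 ts] := tnI k.
have R1 := hG (tn k) t0 ts.
have R2 := reach_box (t := tau' / 2) fb' xg (ltac:(by apply/andP; split; move: tau0'; lra)).
rewrite parK // in R2.
have h20 : 0 <= tau' / 2 by rewrite divr_ge0 // ltW.
have R3 := reach_trans t0 h20 R1 R2.
have : A (tn k + tau' / 2) by split; [rewrite addr_ge0|eexists; exact: R3].
move=> /(ub_le_sup hsA.2); rewrite -/s /tn leNgt => /negP; apply.
by move: tk; move: (s / k.+1%:R) => y; lra.
Qed.

End Completeness.

(** * Weighted area of the surface *)

Section ChartMeasure.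
Variables (R : realType) (S : immersed_surface R) (kappa beta : R).
Local Notation co := (Defs.coord S).
Local Notation rh := (rho S kappa beta).
Local Notation mu := (@lebesgue_measure R \x @lebesgue_measure R)%E.

(** Lets the loss [theta] in [distortion] tend to 1. *)
Lemma le_theta (X Y : \bar R) : (0 <= X)%E -> (0 <= Y)%E ->
  (forall theta : R, 1 < theta -> (X <= theta%:E * Y)%E) -> (X <= Y)%E.
Proof.
move=> X0; case: Y => [y| |] //; last by move=> _ _; rewrite leey.
rewrite lee_fin => y0 h; case: X X0 h => [x| |] // X0 h; last first.
  by have := h 2 (ltac:(by rewrite ltr1n)); rewrite -EFinM leNgt ltry.
rewrite lee_fin; apply/ler_addgt0Pr => e e0.
have := h (1 + e / (y + 1)); rewrite ltrDl divr_gt0 ?ltr_wpDl // => /(_ isT).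
rewrite -EFinM lee_fin mulrDl mul1r => /le_trans; apply.
by rewrite lerD2l mulrAC ler_pdivrMr ?ltr_wpDl // ler_wpM2l ?(ltW e0) // lerDl.
Qed.

Lemma rho_cts n u : dom S n u -> {for u, continuous (rh n)}.
Proof. by move=> Uu; exact: sdiff_cts (rho_sdiff kappa beta Uu (dg_sdiff Uu)). Qed.

Definition nu n (V : set S) : \bar R :=
  (\int[mu]_(u in dom S n `&` par S n @^-1` V) (rh n u)%:E)%E.

Lemma trans_approx m n x (t0 t1 : R * R) (e : R) :
  sdiff (fst \o (co n \o par S m)) x t0 -> sdiff (snd \o (co n \o par S m)) x t1 ->
  let d := t0.1 * t1.2 - t0.2 * t1.1 in d != 0 -> 0 < e ->
  let T := co n \o par S m in
  exists2 r, 0 < r & forall y, `|y - x| < r ->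
    `|(t1.2 / d * ((T y).1 - (T x).1) + - t0.2 / d * ((T y).2 - (T x).2),
       - t1.1 / d * ((T y).1 - (T x).1) + t0.1 / d * ((T y).2 - (T x).2)) - (y - x)|
      <= e * `|y - x|.
Proof.
move=> s0 s1 d d0 e0 T.
pose K := 1 + (`|t1.2 / d| + `|- t0.2 / d|) + (`|- t1.1 / d| + `|t0.1 / d|).
have K0 : 0 < K by rewrite /K -addrA ltr_pwDl // !addr_ge0.
have eK : 0 < e / K by rewrite divr_gt0.
have [r0 r00 h0] := s0 _ eK; have [r1 r10 h1] := s1 _ eK.
exists (Num.min r0 r1) => [|y]; first by rewrite lt_min r00.
rewrite lt_min => /andP[y0 y1].
have xx r : 0 < r -> `|x - x| < r by rewrite subrr normr0.
have := h0 y x y0 (xx _ r00); have := h1 y x y1 (xx _ r10).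
rewrite /comp /=; set z := `|y - x|.
set A := (T y).1 - (T x).1; set B := (T y).2 - (T x).2 => hB hA.
set E0 := A - _ in hA; set E1 := B - _ in hB.
have z0 : 0 <= z by exact: normr_ge0.
have lin (p q : R) : `|p| + `|q| <= K -> `|p * E0 + q * E1| <= e * z.
  move=> pq; apply: le_trans (ler_normD _ _) _; rewrite !normrM.
  apply: (@le_trans _ _ ((`|p| + `|q|) * (e / K * z))).
    by rewrite mulrDl; apply: lerD; rewrite ler_wpM2l.
  rewrite mulrA ler_wpM2r // mulrCA ler_piMr ?(ltW e0) //.
  by rewrite ler_pdivrMr // mul1r.
have n0 (x0 y' : R) : 0 <= `|x0| + `|y'| by rewrite addr_ge0.
rewrite prod_normE ge_max /=; apply/andP; split.
- have -> : t1.2 / d * A + - t0.2 / d * B - (y - x).1 = t1.2 / d * E0 + - t0.2 / d * E1.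
    by rewrite /E0 /E1 /= /d in d0 *; field.
  apply: lin; rewrite /K addrAC lerDr addr_ge0 //.
- have -> : - t1.1 / d * A + t0.1 / d * B - (y - x).2 = - t1.1 / d * E0 + t0.1 / d * E1.
    by rewrite /E0 /E1 /= /d in d0 *; field.
  by apply: lin; rewrite /K lerDr addr_ge0.
Qed.

(** As [e <= 1], the square is at most 1 + 8 e, which is below 1 + 9 e and thus below [theta]. *)
Lemma theta_bound (q d theta e : R) : 0 < q -> d != 0 -> 0 < e -> 1 < theta -> e <= 1 ->
  e <= (theta - 1) / 9 -> q * (1 + 2 * e) ^+ 2 < theta * (`|d| * q) * `|d^-1|.
Proof.
move=> q0 d0 e0 th1 e1 e2.
have -> : theta * (`|d| * q) * `|d^-1| = q * theta.
  by rewrite normfV; field; rewrite normr_eq0.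
rewrite ltr_pM2l //; have ee : e * e <= e by rewrite -[leRHS]mulr1 ler_pM2l.
have -> : (1 + 2 * e) ^+ 2 = 1 + 4 * e + 4 * (e * e) by ring.
by move: (e * e) ee => z; lra.
Qed.

(** [distortion] for the transition map, with every [theta > 1]: by [rho_trans] the densities differ
    exactly by the Jacobian. Exchanging the charts gives the reverse inequality. *)
Lemma nu_trans_le m n (O : set S) : open O -> O `<=` img m -> O `<=` img n -> (nu n O <= nu m O)%E.
Proof.
move=> oO Om On; apply: le_theta.
- by apply: integral_ge0 => u [Uu _]; rewrite lee_fin ltW // rho_gt0.
- by apply: integral_ge0 => u [Uu _]; rewrite lee_fin ltW // rho_gt0.
move=> theta th1; have th0 : 0 < theta by exact: lt_trans th1.
apply: (@distortion R (dom S m `&` par S m @^-1` O) (dom S n `&` par S n @^-1` O)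
  (co n \o par S m) (co m \o par S n) (rh m) (rh n) theta) => //.
- exact: par_preimage_open.
- exact: par_preimage_open.
- by move=> x [Ux Ox]; split => /=; [exact/dom_coord/On|rewrite parK //; exact: On].
- by move=> x [Ux Ox]; split => /=; [exact/dom_coord/Om|rewrite parK //; exact: Om].
- by move=> x [Ux Ox] /=; rewrite parK ?coordK //; exact: Om.
- by move=> x [Ux Ox]; apply: continuous_comp; [exact: par_continuous|exact/Defs.coord_continuous/On].
- by move=> x [Ux Ox]; apply: continuous_comp; [exact: par_continuous|exact/Defs.coord_continuous/Om].
- by move=> x [Ux _]; exact: rho_cts.
- by move=> x [Ux _]; exact: rho_cts.
- by move=> x [Ux _]; rewrite ltW // rho_gt0.
- by move=> x [Ux _]; rewrite ltW // rho_gt0.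
move=> x [Ux Ox]; have Ix := On _ Ox.
have [t0 [t1 [s0 s1]]] := trans_sdiff Ux Ix.
set d := t0.1 * t1.2 - t0.2 * t1.1.
have rE := rho_trans kappa beta Ux Ix s0 s1; rewrite -/d in rE.
have rm : 0 < rh m x by exact: rho_gt0.
have rn : 0 < rh n (co n (par S m x)) by apply: rho_gt0; exact: dom_coord.
have d0 : d != 0 by apply: contraTneq rm => d0; rewrite rE d0 normr0 mul0r ltxx.
pose e := Num.min 1 ((theta - 1) / 9).
have e0 : 0 < e by rewrite lt_min ltr01 divr_gt0 // subr_gt0.
have e1 : e <= 1 by rewrite ge_min lexx.
have e2 : e <= (theta - 1) / 9 by rewrite ge_min lexx orbT.
exists (t1.2 / d), (- t0.2 / d), (- t1.1 / d), (t0.1 / d), e.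
have dE : t1.2 / d * (t0.1 / d) - - t0.2 / d * (- t1.1 / d) = d^-1.
  by rewrite /d in d0 *; field.
split; last 1 first.
- have [r r0 hr] := trans_approx s0 s1 d0 e0.
  by exists r => // y _; exact: hr.
- by rewrite dE invr_neq0.
- exact: ltW.
- by rewrite dE rE; exact: theta_bound.
Qed.

Lemma nu_trans m n (O : set S) : open O -> O `<=` img m -> O `<=` img n -> nu n O = nu m O.
Proof. by move=> oO Om On; apply/eqP; rewrite eq_le !nu_trans_le. Qed.

End ChartMeasure.

(** * Transport of weighted area along the global flow *)

Section Expansion.
Variables (R : realType) (S : immersed_surface R) (uf : 'I_3 -> R -> R) (kappa beta delta : R).
Local Notation co := (Defs.coord S).
Local Notation w := (wf S uf).
Local Notation rh := (rho S kappa beta).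
Local Notation mu := (@lebesgue_measure R \x @lebesgue_measure R)%E.
Local Notation T1 := (measurableTypeR R).
Local Notation nu := (nu kappa beta).
Hypothesis boxes : forall n u, dom S n u ->
  exists r L tau phi, flow_box S uf kappa beta delta n u r L tau phi.
Variable Phi : R -> S -> S.
Hypothesis PhiP : forall t p, 0 <= t -> reach uf p t (Phi t p).

Lemma Phi_eq t p q : 0 <= t -> reach uf p t q -> Phi t p = q.
Proof. by move=> t0; apply: (reach_unique boxes t0); exact: PhiP. Qed.

Lemma Phi_add s t p : 0 <= s -> 0 <= t -> Phi (s + t) p = Phi t (Phi s p).
Proof.
move=> s0 t0; apply: Phi_eq; first exact: addr_ge0.
by apply: (reach_trans boxes s0 t0); exact: PhiP.
Qed.

Lemma Phi_box n u0 r L tau phi x (t : R) : flow_box S uf kappa beta delta n u0 r L tau phi ->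
  `|x - u0| < r / 2 -> 0 <= t < tau -> Phi t (par S n x) = par S n (phi t x).
Proof.
by move=> fb xr tt; apply: Phi_eq; [case/andP: tt|exact: reach_box fb xr tt].
Qed.

Lemma Phi_path_cts (p : S) (t : R) (V : set S) : 0 <= t -> open V -> V (Phi t p) ->
  exists2 e : R, 0 < e & forall s, 0 <= s -> `|s - t| < e -> V (Phi s p).
Proof.
move=> t0 oV; have [g [a [b [gl a0 tb g0 <-]]]] := PhiP p t0 => Vt.
have tab : a < t < b by rewrite (lt_le_trans a0 t0).
have [e e0 he] := (cts_at g t).1 (gl t tab).1 V oV Vt.
exists (Num.min e (b - t)) => [|s s0]; first by rewrite lt_min e0 subr_gt0.
rewrite lt_min => /andP[/he Vs]; rewrite ltr_norml => /andP[_].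
rewrite ltrD2r => sb; suff -> : Phi s p = g s by [].
by apply: Phi_eq => //; exists g, a, b.
Qed.

Lemma rho_measurable n (D : set (R * R)) : open D -> D `<=` dom S n ->
  measurable_fun (D : set (T1 * T1)) (EFin \o rh n).
Proof.
move=> oD DU; apply/measurable_EFinP; apply: continuous_measurable2 => //.
by move=> u /DU; exact: rho_cts.
Qed.

Lemma nu_mono n (V W : set S) : open V -> open W -> V `<=` W -> (nu n V <= nu n W)%E.
Proof.
move=> oV oW VW; apply: ge0_subset_integral => //.
- by apply: open_measurable2; exact: par_preimage_open.
- by apply: open_measurable2; exact: par_preimage_open.
- by apply: rho_measurable => [|u []//]; exact: par_preimage_open.
- by move=> u [Uu _]; rewrite lee_fin ltW // rho_gt0.
- by move=> u [Uu /VW].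
Qed.

Lemma nu_par n (C : set (R * R)) : C `<=` dom S n ->
  nu n (par S n @` C) = (\int[mu]_(u in C) (rh n u)%:E)%E.
Proof.
move=> CD; rewrite /nu; congr (integral _ _ _); apply/seteqP; split=> u.
  by move=> [Uu [v Cv]] /= /(congr1 (co n)); rewrite !coordK // => [<-|]; last exact: CD.
by move=> Cu; split; [exact: CD|exists u].
Qed.

(* Near [Phi s p], the flow from time [s] to time [u] takes place between two
   charts and expands the weighted area of open sets. *)
Definition expands (p : S) (s u : R) := [/\ 0 <= s, s <= u &
  exists A m m', [/\ open A, A (Phi s p), A `<=` img m &
    [/\ forall q, A q -> img m' (Phi (u - s) q),
        forall V, open V -> open (A `&` Phi (u - s) @^-1` V),
        (nu m' (Phi (u - s) @` A) < +oo)%E &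
        forall O, open O -> O `<=` A -> open (Phi (u - s) @` O) /\
          ((expR (delta / 2 * (u - s)))%:E * nu m O <= nu m' (Phi (u - s) @` O))%E]]].

(** The first neighbourhood shrinks to the points that the first flow brings into the second one, an
    open set by the preimage clause of [expands]. In between, [nu_trans] passes from the arrival
    chart of the first step to the departure chart of the second, and the exponentials multiply. *)
Lemma expands_trans p (s t u : R) : expands p s t -> expands p t u -> expands p s u.
Proof.
move=> [s0 st [A [m [m' [oA Ap Am [Am' ctsA finA exA]]]]]].
move=> [t0 tu [C [k [k' [oC Cp Ck [Ck' ctsC finC exC]]]]]].
have h1 : 0 <= t - s by rewrite subr_ge0.
have h2 : 0 <= u - t by rewrite subr_ge0.
have E q : Phi (u - s) q = Phi (u - t) (Phi (t - s) q).
  by rewrite -Phi_add //; congr (Phi _ q); ring.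
have EI (O : set S) : Phi (u - s) @` O = Phi (u - t) @` (Phi (t - s) @` O).
  by rewrite image_comp; apply: eq_imagel => q _; rewrite E.
split => //; first exact: le_trans tu.
pose D := A `&` Phi (t - s) @^-1` C.
have oD : open D by exact: ctsA.
have DA : D `<=` A by move=> q [].
have imC (O : set S) : O `<=` D -> Phi (t - s) @` O `<=` C by move=> OD q [z /OD[_ Cz] <-].
have Dp : D (Phi s p).
  by split; [exact: Ap|rewrite /= -Phi_add // addrC subrK; exact: Cp].
exists D, m, k'; split; [exact: oD|exact: Dp|by move=> q /DA /Am|split].
- by move=> q [Aq Cq]; rewrite E; exact: Ck'.
- move=> V oV; have -> : D `&` Phi (u - s) @^-1` V =
      A `&` Phi (t - s) @^-1` (C `&` Phi (u - t) @^-1` V).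
    apply/seteqP; split=> q.
      by move=> [[Aq Cq] Vq]; split => //; split => //=; rewrite -E.
    by move=> [Aq [Cq Vq]]; split => //=; rewrite E.
  by apply: ctsA; exact: ctsC.
- apply: le_lt_trans finC; rewrite EI.
  have oP := (exA D oD DA).1.
  by apply: nu_mono (exC _ oP (imC D (fun q x => x))).1 (exC C oC (fun q x => x)).1 _;
    move=> q [z Dz <-]; exists z => //; exact: (imC D (fun q x => x)).
- move=> O oO OD; have OA : O `<=` A by move=> q /OD[].
  have [oP leP] := exA O oO OA; have PC := imC O OD.
  have [oQ leQ] := exC _ oP PC.
  rewrite EI; split; [exact: oQ|apply: le_trans leQ].
  have -> : delta / 2 * (u - s) = delta / 2 * (u - t) + delta / 2 * (t - s) by ring.
  rewrite expRD EFinM -muleA; apply: lee_wpmul2l; first by rewrite lee_fin expR_ge0.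
  rewrite (@nu_trans R S kappa beta m' k _ oP); first exact: leP.
    by move=> q [z /OA /Am' Iz <-].
  by move=> q /PC /Ck.
Qed.

Lemma expands_local p (t : R) : 0 <= t -> exists2 e : R, 0 < e &
  forall s u, 0 <= s -> s <= u -> t - e < s -> u < t + e -> expands p s u.
Proof.
move=> t0; have [n In] := par_cover (Phi t p); have Uu := dom_coord In.
set u0 := co n (Phi t p) in Uu.
have [r [L [tau [phi fb]]]] := boxes Uu.
have [r0 L0 tau0 tL [rD wL fl ex]] := fb.
have r4 : 0 < r / 4 by rewrite divr_gt0.
have r42 : r / 4 < r / 2 by move: r0; lra.
have r2r : r / 2 < r by move: r0; lra.
pose A := par S n @` [set x | `|x - u0| < r / 4].
have ADom x : `|x - u0| < r / 2 -> dom S n x.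
  by move=> xr; exact: (rD _ (lt_trans xr r2r)).1.
have oA : open A.
  apply: par_image_open; first exact: ball_open.
  by move=> x /= xr; apply: ADom; exact: lt_trans xr r42.
have At : A (Phi t p) by exists u0; [rewrite /= subrr normr0|exact: parK].
have [e1 e10 he1] := Phi_path_cts t0 oA At.
(* Then [u - s] is below [2 * e], hence below the lifetime [tau] of the box, while the position at
   time [s] lies in its inner square. *)
pose e := Num.min e1 (tau / 2).
exists e; first by rewrite lt_min e10 divr_gt0.
move=> s u s0 su ts ut; have [st ut'] := near_pair su ts ut.
have se1 : `|s - t| < e1 by move: st; rewrite lt_min => /andP[].
have hh : 0 <= u - s < tau.
  have : e <= tau / 2 by rewrite ge_min lexx orbT.
  by rewrite subr_ge0 su /=; move: ts ut; lra.
have [h0 ht] := andP hh.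
have hn : `|u - s| < tau by rewrite ger0_norm.
set h := u - s in h0 ht hh hn *.
have PA x : `|x - u0| < r / 4 -> Phi h (par S n x) = par S n (phi h x) /\ `|phi h x - u0| < r / 2.
  move=> xr; have xr2 := lt_trans xr r42; split; first exact: (Phi_box fb).
  by have [_ /(_ h hn)[_ /(_ xr)]] := fl x xr2.
have imE (C : set (R * R)) : (forall x, C x -> `|x - u0| < r / 4) ->
    Phi h @` (par S n @` C) = par S n @` flow_image u0 r phi h C.
  move=> Cr; rewrite -(flow_imageE r0 L0 tL wL fl Cr hn) !image_comp.
  by apply: eq_imagel => x /Cr /PA[].
have fD (C : set (R * R)) : flow_image u0 r phi h C `<=` dom S n.
  by move=> x [xr _]; exact: ADom.
split => //; exists A, n, n; split => //.
- exact: he1.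
- by move=> q [x xr <-]; exists x => //; apply: ADom; exact: lt_trans xr r42.
split.
- by move=> q [x xr <-]; have [-> pr] := PA x xr; exists (phi h x) => //; exact: ADom.
- move=> V oV.
  have -> : A `&` Phi h @^-1` V =
      par S n @` [set x | `|x - u0| < r / 4 /\ (dom S n `&` par S n @^-1` V) (phi h x)].
    apply/seteqP; split=> q.
      move=> [[x xr <-]] /=; have [-> pr] := PA x xr => Vx.
      by exists x => //; split => //; split => //; exact: ADom.
    move=> [x [xr [_ Vx]] <-]; split; first by exists x.
    by rewrite /= (PA x xr).1.
  apply: par_image_open; last by move=> x [xr _]; apply: ADom; exact: lt_trans xr r42.
  rewrite openE => x [xr Wx]; apply: filterI.
    by apply: open_nbhs_nbhs; split; [exact: ball_open|].
  apply: (flow_cts L0 tL wL fl (lt_trans xr r42) hn).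
  by apply: open_nbhs_nbhs; split => //; exact: par_preimage_open.
- rewrite imE // nu_par //.
  set C := flow_image _ _ _ _ _.
  have oC : open C by apply: (flow_image_open L0 tL wL fl) => //; exact: ball_open.
  pose Bx : set (T1 * T1) := `[u0.1 - r, u0.1 - r + 2 * r] `*` `[u0.2 - r, u0.2 - r + 2 * r].
  have mB : measurable Bx by apply: measurableX; exact: measurable_itv.
  have r20 : 0 <= 2 * r by rewrite mulr_ge0 // ltW.
  have CB : C `<=` Bx.
    move=> x [xr _]; have := lt_trans xr r2r.
    rewrite prod_normE gt_max !ltr_norml => /andP[/andP[/= a1 a2] /andP[/= a3 a4]].
    by split; rewrite /= in_itv /=; apply/andP; split; move: a1 a2 a3 a4; clear; lra.
  have c0 : 0 <= rh n u0 + 1 by rewrite addr_ge0 // ltW // rho_gt0.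
  apply: (@le_lt_trans _ _ (\int[mu]_(x in C) (rh n u0 + 1)%:E)%E).
    apply: ge0_le_integral => //.
    + exact: open_measurable2.
    + by move=> x /fD Ux; rewrite lee_fin ltW // rho_gt0.
    + by apply: (@rho_measurable n C oC); exact: fD.
    + by move=> x [xr _]; rewrite lee_fin; exact: (rD _ (lt_trans xr r2r)).2.
  rewrite integral_cst; last exact: open_measurable2.
  rewrite lte_mul_pinfty // ?lee_fin //.
  apply: (@le_lt_trans _ _ (mu Bx)).
    by apply: le_measure => //; rewrite inE //; exact: open_measurable2.
  by rewrite box_measure // ltry.
- move=> O oO OA; pose C := dom S n `&` par S n @^-1` O.
  have oC : open C by exact: par_preimage_open.
  have CD : C `<=` dom S n by move=> x [].
  have Cr x : C x -> `|x - u0| < r / 4.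
    move=> [Ux /OA [y yr]] /(congr1 (co n)); rewrite !coordK // => [<- //|].
    by apply: ADom; exact: lt_trans yr r42.
  have OE : O = par S n @` C.
    apply/seteqP; split=> q; last by move=> [x [Ux Ox] <-].
    move=> Oq; have [x xr xq] := OA q Oq; exists x => //; split; last by rewrite /= xq.
    by apply: ADom; exact: lt_trans xr r42.
  rewrite OE imE // !nu_par //; split; last exact: ex.
  apply: par_image_open => //.
  exact: (flow_image_open L0 tL wL fl).
Qed.

(** Here [chain] stands for the compactness of the time interval: finitely many flow boxes suffice,
    and their number never has to be named. *)
Lemma expands_all p (T : R) : 0 <= T -> expands p 0 T.
Proof.
move=> T0; apply: chain => //.
  by move=> s t u; exact: expands_trans.
move=> t /andP[t0 _]; have [e e0 he] := expands_local p t0.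
by exists e => // s u s0 su _; exact: he.
Qed.

End Expansion.

(** * From the area in one chart to the area of the whole surface *)

Section TotalMeasure.
Variables (R : realType) (S : immersed_surface R) (kappa beta : R).
Local Notation co := (Defs.coord S).
Local Notation rh := (rho S kappa beta).
Local Notation mu := (@lebesgue_measure R \x @lebesgue_measure R)%E.
Local Notation T1 := (measurableTypeR R).
Local Notation nu := (nu kappa beta).

(** Area is transported only for open sets, so each half-open cell is to be replaced by an open core
    of full measure. *)
Lemma cell_interior k (x : R * R) : exists C : set (R * R),
  [/\ open C, C `<=` cellof k x & mu C = mu (cellof k x)].
Proof.
rewrite cell_measure cellof_box; set a := _ / _; set b := (X in _ `*` `[X, _[); set l := _ ^-1.
have l0 : 0 < l by rewrite invr_gt0 exprn_gt0.
exists (`]a, a + l[ `*` `]b, b + l[); split.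
- rewrite openE => y [y1 y2]; exists (`]a, a + l[%classic, `]b, b + l[%classic) => //=.
  by split; apply: open_nbhs_nbhs; split => //; exact: interval_open.
- by move=> y [/= y1 y2]; split; [move: y1|move: y2]; rewrite /= !in_itv /= =>
    /andP[/ltW h1 h2]; apply/andP; split.
have := @product_measure1E _ _ T1 T1 R (@lebesgue_measure R) (@lebesgue_measure R) _ _
  (measurable_itv `]a, a + l[) (measurable_itv `]b, b + l[).
move=> /= ->; rewrite !lebesgue_measure_itv /= !lte_fin !ltrDl l0.
by rewrite -!EFinD -EFinM expr2; congr EFin; ring.
Qed.

Definition before (n : nat) : set S := \bigcup_(m in [set m | (m < n)%N]) img m.

Lemma before_open n : open (before n).
Proof. by apply: bigcup_open => m _; exact: img_open. Qed.

Lemma freshE n : fresh S n = dom S n `\` par S n @^-1` before n.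
Proof.
by apply/seteqP; split=> u [Uu nu]; split => //; apply: contra_not nu => -[m mn Im]; exists m.
Qed.

Lemma fresh_measurable n (V : set S) : open V ->
  measurable (fresh S n `&` par S n @^-1` V : set (T1 * T1)).
Proof.
move=> oV; rewrite freshE.
have -> : (dom S n `\` par S n @^-1` before n) `&` par S n @^-1` V =
    (dom S n `&` par S n @^-1` V) `\` (dom S n `&` par S n @^-1` before n).
  apply/seteqP; split=> u [].
  - by move=> [Uu nb] Vu; split => // -[].
  - by move=> [Uu Vu] nb; split => //; split => // bu; apply: nb.
by apply: measurableD; apply: open_measurable2; apply: par_preimage_open => //; exact: before_open.
Qed.

Lemma rho_measurable_sub n (D : set (R * R)) : D `<=` dom S n ->
  measurable_fun (D : set (T1 * T1)) (EFin \o rh n).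
Proof.
move=> DU; have mU : measurable (dom S n : set (T1 * T1)) by apply: open_measurable2; exact: dom_open.
apply: (measurable_funS mU DU).
by apply: rho_measurable => //; exact: dom_open.
Qed.

(* The weighted area, computed as [surface_integral] is. *)
Definition nustar (V : set S) : \bar R :=
  (\sum_(0 <= n <oo) \int[mu]_(u in fresh S n `&` par S n @^-1` V) (rh n u)%:E)%E.

Lemma rho_int_ge0 n (D : set (R * R)) : D `<=` dom S n -> (0 <= \int[mu]_(u in D) (rh n u)%:E)%E.
Proof. by move=> DU; apply: integral_ge0 => u /DU Uu; rewrite lee_fin ltW // rho_gt0. Qed.

Lemma fresh_dom n : fresh S n `<=` dom S n. Proof. by move=> u []. Qed.

Lemma nustar_ge0 V : (0 <= nustar V)%E.
Proof. by apply: nneseries_ge0 => n _ _; apply: rho_int_ge0 => u [/fresh_dom]. Qed.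

Lemma nustarU V W : open V -> open W -> V `&` W = set0 ->
  nustar (V `|` W) = (nustar V + nustar W)%E.
Proof.
move=> oV oW VW.
rewrite /nustar -nneseriesD; last 2 first.
- by move=> n _ _; apply: rho_int_ge0 => u [/fresh_dom].
- by move=> n _ _; apply: rho_int_ge0 => u [/fresh_dom].
apply: eq_eseriesr => n _.
rewrite preimage_setU setIUr; apply: ge0_integral_setU.
- exact: fresh_measurable.
- exact: fresh_measurable.
- by apply: rho_measurable_sub => u [|] [/fresh_dom].
- by move=> u [|] [/fresh_dom Uu _]; rewrite lee_fin ltW // rho_gt0.
- apply/disj_setPS => u [[_ Vu] [_ Wu]].
  by have : (V `&` W) (par S n u) by []; rewrite VW.
Qed.

Lemma nustar_bigU (V : nat -> set S) N : (forall i, open (V i)) -> trivIset setT V ->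
  nustar (\bigcup_(i in [set i | (i < N)%N]) V i) = (\sum_(i < N) nustar (V i))%E.
Proof.
move=> oV tV; elim: N => [|N IH].
  rewrite big_ord0 bigcup0; last by move=> i.
  rewrite /nustar eseries0 // => n _ _.
  by rewrite preimage_set0 setI0 integral_set0.
rewrite big_ord_recr /= -IH -nustarU //.
- congr nustar; apply/seteqP; split=> q.
    move=> [i /= iN Vi]; move: iN; rewrite ltnS leq_eqVlt => /orP[/eqP <-|iN]; first by right.
    by left; exists i.
  by move=> [[i /= iN Vi]|VN]; [exists i => //=; rewrite ltnS ltnW|exists N => //=].
- by apply: bigcup_open => i _.
- apply/seteqP; split=> q // -[[i /= iN Vi] VN].
  have := tV i N I I (ex_intro _ q (conj Vi VN)) => E.
  by rewrite E ltnn in iN.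
Qed.

Lemma nu_setD m (P Q : set S) : open P -> open Q -> Q `<=` P -> (nu m Q < +oo)%E ->
  (\int[mu]_(u in dom S m `&` par S m @^-1` (P `\` Q)) (rh m u)%:E = nu m P - nu m Q)%E.
Proof.
move=> oP oQ QP fQ.
have mP : measurable (dom S m `&` par S m @^-1` P : set (T1 * T1)).
  by apply: open_measurable2; exact: par_preimage_open.
have mQ : measurable (dom S m `&` par S m @^-1` Q : set (T1 * T1)).
  by apply: open_measurable2; exact: par_preimage_open.
have E : dom S m `&` par S m @^-1` (P `\` Q) =
    (dom S m `&` par S m @^-1` P) `\` (dom S m `&` par S m @^-1` Q).
  apply/seteqP; split=> u [].
    by move=> Uu [Pu nQ]; split => // -[].
  by move=> [Uu Pu] nQ; split => //; split => // Qu; apply: nQ.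
have -> : nu m P = (\int[mu]_(u in dom S m `&` par S m @^-1` (P `\` Q)) (rh m u)%:E + nu m Q)%E.
  rewrite E /nu -ge0_integral_setU //.
  - congr (integral _ _ _); apply/seteqP; split=> u.
      move=> [Uu Pu]; have [Qu|nQ] := pselect (Q (par S m u)); first by right.
      by left; split => // -[].
    by move=> [[]//|[Uu Qu]]; split => //; exact: QP.
  - exact: measurableD.
  - by apply: rho_measurable_sub => u [[[]]|[]].
  - by move=> u [[[Uu _] _]|[Uu _]]; rewrite lee_fin ltW // rho_gt0.
  - by apply/disj_setPS => u [[_ nQ] Qu]; exact: nQ.
rewrite addeK // ge0_fin_numE //; by apply: rho_int_ge0 => u [].
Qed.

(** Invariance under change of chart is known for open sets; subtraction extends it to differences
    of open sets, which is where finiteness enters. *)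
Lemma nu_setD_trans m n (P Q : set S) : open P -> open Q -> Q `<=` P -> P `<=` img m -> P `<=` img n ->
  (nu m P < +oo)%E ->
  (\int[mu]_(u in dom S m `&` par S m @^-1` (P `\` Q)) (rh m u)%:E =
   \int[mu]_(u in dom S n `&` par S n @^-1` (P `\` Q)) (rh n u)%:E)%E.
Proof.
move=> oP oQ QP Pm Pn fP.
have Qm : Q `<=` img m by move=> q /QP /Pm.
have Qn : Q `<=` img n by move=> q /QP /Pn.
have fQ : (nu m Q < +oo)%E by apply: le_lt_trans fP; exact: nu_mono.
have cP : nu n P = nu m P by exact: nu_trans.
have cQ : nu n Q = nu m Q by exact: nu_trans.
have fQn : (nu n Q < +oo)%E by rewrite cQ.
rewrite (nu_setD oP oQ QP fQ) (nu_setD oP oQ QP fQn).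
by rewrite cP cQ.
Qed.

(** [V] is partitioned according to the first chart that contains a point, as in [surface_integral].
    The pieces are differences of open sets, so [nu_setD_trans] moves each of them from chart [m] to
    its own chart. *)
Lemma nu_le_nustar m (V : set S) : open V -> V `<=` img m -> (nu m V < +oo)%E -> (nu m V <= nustar V)%E.
Proof.
move=> oV Vm fV.
pose F (n : nat) : set (R * R) :=
  dom S m `&` par S m @^-1` ((V `&` img n) `\` (V `&` img n `&` before n)).
have oP n : open (V `&` img n) by apply: openI => //; exact: img_open.
have oQ n : open (V `&` img n `&` before n) by apply: openI => //; exact: before_open.
have mF n : measurable (F n : set (T1 * T1)).
  rewrite /F; have -> : dom S m `&` par S m @^-1` ((V `&` img n) `\` (V `&` img n `&` before n)) =
    (dom S m `&` par S m @^-1` (V `&` img n)) `\` (dom S m `&` par S m @^-1` (V `&` img n `&` before n)).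
    apply/seteqP; split=> u [].
      by move=> Uu [Pu nQ]; split => // -[].
    by move=> [Uu Pu] nQ; split => //; split => // Qu; apply: nQ.
  by apply: measurableD; apply: open_measurable2; exact: par_preimage_open.
have FU : \bigcup_n F n = dom S m `&` par S m @^-1` V.
  apply/seteqP; split=> [u [n _ [Uu [[Vu _] _]]] //|u [Uu Vu]].
  have ex : exists n, `[< img n (par S m u) >] by have [n In] := par_cover (par S m u); exists n; exact/asboolP.
  case: (ex_minnP ex) => n /asboolP In' minn; exists n => //; split => //; split => // -[_ [k /= kn Ik]].
  by have := minn k (introT (asboolP _) Ik); rewrite leqNgt kn.
have tF : trivIset setT F.
  have key i j u : F i u -> F j u -> (i < j)%N -> False.
    by move=> [_ [[Vu Ii] _]] [_ [[_ Ij] nQ]] ij; apply: nQ; split => //; exists i.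
  move=> i j _ _ [u [Fi Fj]]; have [ij|ji|//] := ltngtP i j.
    by case: (key i j u).
  by case: (key j i u).
have D0 u : (\bigcup_n F n) u -> (0 <= (rh m u)%:E)%E.
  by rewrite FU => -[Uu _]; rewrite lee_fin ltW // rho_gt0.
have mD : measurable_fun (\bigcup_n F n : set (T1 * T1)) (EFin \o rh m).
  by apply: rho_measurable_sub; rewrite FU => u [].
have := ge0_integral_bigcup mu mF mD D0 tF; rewrite FU => E.
rewrite /nu E le_eqVlt; apply/orP; left; apply/eqP; apply: eq_eseriesr => n _.
have QV : V `&` img n `&` before n `<=` V `&` img n by move=> q [].
have fP : (nu m (V `&` img n) < +oo)%E.
  by apply: le_lt_trans fV; apply: nu_mono => // q [].
have Pm : V `&` img n `<=` img m by move=> q [/Vm].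
have Pn : V `&` img n `<=` img n by move=> q [].
apply: (etrans (nu_setD_trans (oP n) (oQ n) QV Pm Pn fP)).
congr (integral _ _ _); rewrite freshE; apply/seteqP; split=> u.
- move=> [Uu [[Vu In] nQ]]; split => //; split => // bu; exact: nQ.
- move=> [[Uu nb] Vu]; split => //; split; first by split => //; exact: img_par.
  by move=> [].
Qed.

End TotalMeasure.

(** The cubic term of the exponential series wins. As [T >= 1], one has 1 + c T <= (1 + c) T, and
    [T] is such that (a T)^3 m / 6 exceeds K (1 + c)^2 T^2. *)
Lemma exp_beats_square (R : realType) (a m K c : R) : 0 < a -> 0 < m -> 0 <= K -> 0 <= c ->
  exists T : R, 0 <= T /\ K * (1 + c * T) ^+ 2 < expR (a * T) * m.
Proof.
move=> a0 m0 K0 c0; pose T := 1 + 6 * K * (1 + c) ^+ 2 / (m * a ^+ 3).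
have TE : T = 1 + 6 * K * (1 + c) ^+ 2 / (m * a ^+ 3) by [].
have ma : 0 < m * a ^+ 3 by rewrite mulr_gt0 // exprn_gt0.
have q0 : 0 <= 6 * K * (1 + c) ^+ 2 by rewrite mulr_ge0 ?sqr_ge0 // mulr_ge0.
have T1 : 1 <= T by rewrite lerDl divr_ge0 // ltW.
have T0 : 0 <= T by exact: le_trans T1.
clearbody T.
exists T; split => //.
have aT : 0 <= a * T by rewrite mulr_ge0 // ltW.
have e3 : (a * T) ^+ 3 / 6 < expR (a * T).
  by apply: lt_le_trans (expR_ge1Dxn 2 aT); rewrite ltr_pwDl.
have cT : (1 + c * T) ^+ 2 <= (1 + c) ^+ 2 * T ^+ 2.
  rewrite -exprMn ler_sqr ?nnegrE ?addr_ge0 ?mulr_ge0 ?addr_ge0 //.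
  by rewrite mulrDl mul1r lerD2r.
apply: (@le_lt_trans _ _ (K * ((1 + c) ^+ 2 * T ^+ 2))); first by rewrite ler_wpM2l.
apply: (@lt_trans _ _ ((a * T) ^+ 3 / 6 * m)); last by rewrite ltr_pM2r.
have E : 6 * K * (1 + c) ^+ 2 = (T - 1) * (m * a ^+ 3).
  by rewrite TE addrAC subrr add0r divfK // gt_eqF.
have -> : K * ((1 + c) ^+ 2 * T ^+ 2) = (6 * K * (1 + c) ^+ 2) * (T ^+ 2 / 6) by field.
rewrite E.
have -> : (a * T) ^+ 3 / 6 * m = T * (m * a ^+ 3) * (T ^+ 2 / 6) by field.
rewrite ltr_pM2r ?ltr_pM2r ?divr_gt0 ?exprn_gt0 //; last by apply: lt_le_trans T1.
by rewrite ltrBlDr ltrDl.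
Qed.

Lemma sqr_le_ddot (R : realType) (V : 'I_3 -> R) k : V k ^+ 2 <= ddot V V.
Proof.
rewrite /ddot -!expr2; have := sqr_ge0 (V 0); have := sqr_ge0 (V 1); have := sqr_ge0 (V ord_max).
by have [-> | -> | ->] := ord3P k; move: (_ ^+ 2) (_ ^+ 2) (_ ^+ 2) => x y z; lra.
Qed.

Lemma integral_le_scale d (T : measurableType d) (R : realType) (m : {measure set T -> \bar R})
    (D E : set T) (f g : T -> R) (M : R) : measurable E -> measurable D -> E `<=` D -> 0 <= M ->
  measurable_fun E (EFin \o f) -> measurable_fun D (EFin \o g) ->
  (forall x, E x -> 0 <= f x <= M * g x) -> (forall x, 0 <= g x) ->
  (\int[m]_(x in E) (f x)%:E <= M%:E * \int[m]_(x in D) (g x)%:E)%E.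
Proof.
move=> mE mD ED M0 mf mg fg g0.
rewrite -ge0_integralZl //; last by move=> x _; rewrite lee_fin.
have mMg : measurable_fun D (fun x => M%:E * (g x)%:E)%E by exact: measurable_funeM.
apply: (@le_trans _ _ (\int[m]_(x in E) (M%:E * (g x)%:E))%E).
  apply: ge0_le_integral => //.
  - by move=> x /fg /andP[f0 _]; rewrite lee_fin.
  - exact: measurable_funS mMg.
  - by move=> x /fg /andP[_ h]; rewrite -EFinM lee_fin.
by apply: ge0_subset_integral => // x _; rewrite -EFinM lee_fin mulr_ge0.
Qed.

(** * Quadratic upper bound and exponential lower bound for the weighted area *)

Section Growth.
Variables (R : realType) (S : immersed_surface R) (uf : 'I_3 -> R -> R) (kappa beta delta B c : R).
Local Notation co := (Defs.coord S).
Local Notation rh := (rho S kappa beta).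
Local Notation mu := (@lebesgue_measure R \x @lebesgue_measure R)%E.
Local Notation T1 := (measurableTypeR R).
Local Notation nu := (nu kappa beta).
Local Notation nustar := (nustar kappa beta).
Hypotheses (kappa0 : 0 < kappa) (delta0 : 0 < delta) (B0 : 0 < B).
Hypothesis ufB : forall n u k, dom S n u -> `|uf k (comp S n 0 u)| <= B.
Hypothesis boxes : forall n u, dom S n u ->
  exists r L tau phi, flow_box S uf kappa beta delta n u r L tau phi.
Hypothesis above : forall p : S, c <= x3 (imm p) + beta * x2 (imm p).

Lemma displacement (p q : S) (T : R) k : 0 <= T -> reach uf p T q ->
  `|imm q 0 k - imm p 0 k| <= 2 * B * T.
Proof.
move=> T0 [g [a [b [gl a0 Tb <- <-]]]].
pose df (t : R) := 'D_1 (imm_comp g k) t.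
have key (t : R) : 0 <= t <= T -> is_derive t 1 (imm_comp g k) (df t) /\ `|df t| <= 2 * B.
  move=> /andP[t0 tT]; have tab : a < t < b by rewrite (lt_le_trans a0 t0) (le_lt_trans tT Tb).
  have [gc gd] := gl t tab; have [n In] := par_cover (g t).
  have H := imm_comp_derive k gc In (gd n In).
  have dE : df t = _ := derive_val.
  split; first by apply: DeriveDef; [exact: ex_derive|].
  rewrite dE; set V := fun k => Da S n (co n (g t)) k * (wf S uf n (co n (g t))).1 +
    Db S n (co n (g t)) k * (wf S uf n (co n (g t))).2.
  have sp : ddot V V <= (2 * B) ^+ 2 by apply: (w_speed B0 ufB); exact: dom_coord.
  have B2 : 0 <= 2 * B by rewrite mulr_ge0 // ltW.
  rewrite -/(V k) -(ler_sqr (x := `|V k|)) ?nnegrE // real_normK ?num_real //.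
  exact: le_trans (sqr_le_ddot V k) sp.
have I0 : 0 <= (0 : R) <= T by rewrite lexx.
have IT : 0 <= T <= T by rewrite T0 lexx.
have := mvt_bound I0 IT (fun t h => (key t h).1) (fun t h => (key t h).2).
by rewrite subr0 (ger0_norm T0).
Qed.

Lemma eucl_sqr (v : 'rV[R]_3) : eucl v ^+ 2 = v 0 0 ^+ 2 + v 0 1 ^+ 2 + v 0 ord_max ^+ 2.
Proof.
by rewrite /eucl sqr_sqrtr /dot sum_ord3 -!expr2 // !addr_ge0 // sqr_ge0.
Qed.

Definition gauss n (y : 'rV[R]_3) (t : R) (u : R * R) : R :=
  expR (- ((comp S n 0 u - y 0 0) ^+ 2 + (comp S n 1 u - y 0 1) ^+ 2
    + (comp S n ord_max u - y 0 ord_max) ^+ 2) / (4 * t)) * Num.sqrt (dg S n u).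

Lemma gaussE n y t u : dom S n u ->
  expR (- (eucl (imm (par S n u) - y) ^+ 2 / (4 * t))) * Num.sqrt (\det (gram S n u)) = gauss n y t u.
Proof.
by move=> Uu; rewrite det_gram // eucl_sqr !mxE /gauss mulNr.
Qed.

Lemma gauss_cts n y t u : dom S n u -> {for u, continuous (gauss n y t)}.
Proof.
move=> Uu; have D := dg_sdiff Uu.
have sc k : exists d, sdiff (fun u => (comp S n k u - y 0 k) ^+ 2) u d.
  have s1 := sdiffD (comp_sdiff k Uu) (sdiff_cst (- y 0 k) u).
  by eexists; exact: (sdiffM s1 s1).
have [d0 s0] := sc 0; have [d1 s1] := sc 1; have [d2 s2] := sc ord_max.
apply: sdiff_cts; apply: sdiffM; last exact: (sdiff_comp1 D (sdiff1_sqrt (dg_gt0 Uu))).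
apply: (sdiff_comp1 _ (sdiff1_exp _)); apply: sdiffM; last exact: sdiff_cst.
by apply: sdiffN; exact: (sdiffD (sdiffD s0 s1) s2).
Qed.

Lemma gauss_measurable n y t (D : set (R * R)) : D `<=` dom S n ->
  measurable_fun (D : set (T1 * T1)) (EFin \o gauss n y t).
Proof.
move=> DU; have mU : measurable (dom S n : set (T1 * T1)) by apply: open_measurable2; exact: dom_open.
apply: (measurable_funS mU DU); apply/measurable_EFinP; apply: continuous_measurable2.
  exact: dom_open.
by move=> u Uu; exact: gauss_cts.
Qed.

Lemma gauss_ge0 n y t u : 0 <= gauss n y t u.
Proof. by rewrite mulr_ge0 ?expR_ge0 ?sqrtr_ge0. Qed.

(** At scale [t = r ^+ 2] the Gaussian exponent is at most 3/4 on the cube in question, so the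
    Gaussian is at least e^-1 there; [above] bounds the weight by e^(- kappa c). *)
Lemma rho_le_gauss n (y : 'rV[R]_3) (r : R) u : dom S n u -> 0 < r ->
  (forall k, `|comp S n k u - y 0 k| <= r) ->
  rh n u <= expR (1 - kappa * c) * gauss n y (r ^+ 2) u.
Proof.
move=> Uu r0 h; rewrite /rho /gauss mulrA mulrC ler_wpM2r ?sqrtr_ge0 // -expRD ler_expR.
have sq k : (comp S n k u - y 0 k) ^+ 2 <= r ^+ 2.
  by rewrite -(real_normK (num_real (comp S n k u - y 0 k))) ler_sqr ?nnegrE ?(ltW r0).
have ab : c <= comp S n ord_max u + beta * comp S n 1 u by exact: above.
have h1 : - kappa * (comp S n ord_max u + beta * comp S n 1 u) <= - (kappa * c).
  by rewrite mulNr lerN2 ler_pM2l.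
have := sq 0; have := sq 1; have := sq ord_max.
set X := (_ - _) ^+ 2; set Y := (_ - _) ^+ 2; set Z := (_ - _) ^+ 2 => hX hY hZ.
have r2 : 0 < r ^+ 2 by rewrite exprn_gt0.
have h2 : - 1 <= - (Z + Y + X) / (4 * r ^+ 2).
  rewrite mulNr lerN2 ler_pdivrMr ?mulr_gt0 // mul1r.
  rewrite (_ : 4 = 2 ^+ 2); last by ring.
  by apply: sum3_le => //; exact: ltW.
apply: (le_trans h1); rewrite addrAC lerDr -lerBlDl sub0r; exact: h2.
Qed.

(** One Gaussian, centred at [y] and of scale [r ^+ 2], dominates the weight on the whole cube. Its
    normalising factor is the source of the quadratic growth in [r]. *)
Lemma nustar_upper (W : set S) (y : 'rV[R]_3) (r l : R) : 0 < r -> open W ->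
  (forall q k, W q -> `|imm q 0 k - y 0 k| <= r) -> (gaussian_area S y (r ^+ 2) <= l%:E)%E ->
  (nustar W <= (expR (1 - kappa * c) * (4 * pi * r ^+ 2 * l))%:E)%E.
Proof.
move=> r0 oW Wr ga; set M := expR _.
have M0 : 0 <= M by exact: expR_ge0.
have p0 : 0 < 4 * pi * r ^+ 2 by rewrite !mulr_gt0 ?pi_gt0 ?exprn_gt0.
have FD n : fresh S n `<=` dom S n by move=> u [].
have mF n : measurable (fresh S n : set (T1 * T1)).
  have := @fresh_measurable R S n setT openT.
  by rewrite preimage_setT setIT.
have sumE : surface_integral (fun p : S => expR (- (eucl (imm p - y) ^+ 2 / (4 * r ^+ 2)))) =
    (\sum_(0 <= n <oo) \int[mu]_(u in fresh S n) (gauss n y (r ^+ 2) u)%:E)%E.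
  apply: eq_eseriesr => n _; apply: eq_integral => u; rewrite inE => /FD Uu.
  by rewrite gaussE.
have sumB : (\sum_(0 <= n <oo) \int[mu]_(u in fresh S n) (gauss n y (r ^+ 2) u)%:E <=
    (4 * pi * r ^+ 2 * l)%:E)%E.
  rewrite -sumE; move: ga; rewrite /gaussian_area => ga.
  by rewrite EFinM -lee_pdivrMl.
apply: (@le_trans _ _ (\sum_(0 <= n <oo) M%:E * \int[mu]_(u in fresh S n) (gauss n y (r ^+ 2) u)%:E)%E).
  apply: lee_nneseries => n _.
    by move=> _; apply: rho_int_ge0 => u [/FD].
  have mW := fresh_measurable n oW.
  apply: (@integral_le_scale _ (T1 * T1)%type R mu (fresh S n) _ (rh n) (gauss n y (r ^+ 2)) M mW (mF n)).
  - by move=> u [].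
  - exact: M0.
  - by apply: rho_measurable_sub => u [/FD].
  - by apply: gauss_measurable; exact: FD.
  - move=> u [/FD Uu Wu]; apply/andP; split; first by apply: ltW; exact: rho_gt0.
    by apply: (rho_le_gauss Uu r0) => k; exact: (Wr (par S n u) k Wu).
  - by move=> u; exact: gauss_ge0.
rewrite nneseriesZl; last by move=> n _; apply: integral_ge0 => u _; rewrite lee_fin gauss_ge0.
by rewrite EFinM lee_wpmul2l // lee_fin.
Qed.

End Growth.

Section Contradiction.
Variables (R : realType) (S : immersed_surface R) (uf : 'I_3 -> R -> R) (kappa beta delta B c : R).
Local Notation co := (Defs.coord S).
Local Notation rh := (rho S kappa beta).
Local Notation mu := (@lebesgue_measure R \x @lebesgue_measure R)%E.
Local Notation T1 := (measurableTypeR R).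
Local Notation nu := (nu kappa beta).
Local Notation nustar := (nustar kappa beta).
Hypotheses (kappa0 : 0 < kappa) (delta0 : 0 < delta) (B0 : 0 < B).
Hypothesis ufB : forall n u k, dom S n u -> `|uf k (comp S n 0 u)| <= B.
Hypothesis boxes : forall n u, dom S n u ->
  exists r L tau phi, flow_box S uf kappa beta delta n u r L tau phi.
Hypothesis above : forall p : S, c <= x3 (imm p) + beta * x2 (imm p).
Variable Phi : R -> S -> S.
Hypothesis PhiP : forall t p, 0 <= t -> reach uf p t (Phi t p).

(** [C'] is the open core of the cell [C]. The initial weighted area enters only through the lower
    bound [m0] of the density, so that summing over cells involves nothing but the Lebesgue measure
    of the plane. *)
Definition cell_expands n (m0 T : R) (C C' : set (R * R)) :=
  [/\ open C', C' `<=` C, mu C' = mu C, open (Phi T @` (par S n @` C')) &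
      ((expR (delta / 2 * T) * m0)%:E * mu C <= nustar (Phi T @` (par S n @` C')))%E].

(** A small enough cell lies in the neighbourhood provided by [expands_all] at its point; up to time
    [T], its core is then carried from one chart to one chart. *)
Lemma cell_expands_small n (m0 T : R) x : 0 <= T -> 0 < m0 -> dom S n x ->
  exists2 r : R, 0 < r & forall k, 2 ^- k < r -> (forall y, cellof k x y -> m0 <= rh n y) ->
    exists C', cell_expands n m0 T (cellof k x) C'.
Proof.
move=> T0 m00 Ux.
have [_ _ [A [m [m' [oA Ap Am [Am' _ finA exA]]]]]] := expands_all boxes PhiP (par S n x) T0.
have P0 : Phi 0 (par S n x) = par S n x.
  apply: (Phi_eq boxes PhiP) => //.
  by have [g [a [b [gl a0 b0 g0 _]]]] := PhiP (par S n x) (lexx 0); exists g, a, b.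
rewrite P0 in Ap; rewrite subr0 in Am' finA exA.
pose W := dom S n `&` par S n @^-1` A.
have [r r0 hr] := open_eps (par_preimage_open oA) (conj Ux Ap : W x).
exists r => // k kr low; have [C [oC Cc muC]] := cell_interior k x.
have CW : C `<=` W by move=> y /Cc /cellof_small yx; apply: hr; exact: lt_trans kr.
have CD : C `<=` dom S n by move=> y /CW[].
pose O := par S n @` C.
have oO : open O by exact: par_image_open.
have OA : O `<=` A by move=> q [y /CW[_ Ay] <-].
have On : O `<=` img n by move=> q [y /CD Uy <-]; exists y.
have Om : O `<=` img m by move=> q /OA /Am.
have [oP leP] := exA O oO OA.
exists C; split => //.
have fP : (nu m' (Phi T @` O) < +oo)%E.
  apply: le_lt_trans finA; apply: nu_mono => //; first exact: (exA A oA (fun q x => x)).1.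
  by move=> q [z /OA Az <-]; exists z.
have Pm' : Phi T @` O `<=` img m' by move=> q [z /OA /Am' Iz <-].
apply: le_trans (nu_le_nustar oP Pm' fP); apply: le_trans leP.
rewrite EFinM -muleA; apply: lee_wpmul2l; first by rewrite lee_fin expR_ge0.
rewrite (nu_trans kappa beta oO On Om) nu_par // -muC.
have mC : measurable (C : set (T1 * T1)) by exact: open_measurable2.
rewrite -integral_cst //; apply: ge0_le_integral => //.
- by move=> y _; rewrite lee_fin ltW.
- by apply: rho_measurable_sub.
- by move=> y Cy; rewrite lee_fin low //; exact: Cc.
Qed.

(** The neighbourhoods of [expands_all] depend on the point, so the square is cut into dyadic cells.
    By [reach_injective] the images of their cores are disjoint, hence their areas add up; finite
    unions are estimated first, then their number tends to infinity. *)
Lemma growth n (u0 : R * R) (r m0 : R) (l T : R) : 0 < r -> 0 < m0 -> 0 <= T ->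
  (forall x, `|x - u0| < r -> [/\ dom S n x, m0 <= rh n x &
     forall k, `|comp S n k x - comp S n k u0| <= 1]) ->
  (forall y (t : R), 0 < t -> (gaussian_area S y t <= l%:E)%E) ->
  ((expR (delta / 2 * T) * m0)%:E * mu [set x : R * R | (`|x - u0| < r)%R] <=
   (expR (1 - kappa * c) * (4 * pi * (1 + 2 * B * T) ^+ 2 * l))%:E)%E.
Proof.
move=> r0 m00 T0 box ga; set O := [set x | _]; pose RHS := expR (1 - kappa * c) * (4 * pi * (1 + 2 * B * T) ^+ 2 * l).
rewrite -/RHS.
have oO : open O by exact: ball_open.
have OD : O `<=` dom S n by move=> x /box[].
have [F [tF FU Fg]] : exists F : nat -> set (R * R), [/\ trivIset setT F, \bigcup_n F n = O &
    forall i, F i = set0 \/ exists k x, F i = cellof k x /\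
      exists C', cell_expands n m0 T (F i) C'].
  apply: (@dyadic_open R O (fun C => exists C', cell_expands n m0 T C C')) => // x Ox.
  have [s s0 hs] := cell_expands_small T0 m00 (OD x Ox).
  by exists s => // k ks kO; apply: hs => // y /kO /box[].
have /choice[C hC] : forall i, exists C', cell_expands n m0 T (F i) C'.
  move=> i; have [E|[k [x [_ //]]]] := Fg i; exists set0; rewrite E.
  by split => //; rewrite ?image_set0 ?measure0 ?mule0 ?nustar_ge0 //; exact: open0.
pose V i := Phi T @` (par S n @` C i).
have oV i : open (V i) by have [] := hC i.
have CO i : C i `<=` O.
  by move=> x Cx; rewrite -FU; exists i => //; have [_ h _ _ _] := hC i; exact: h.
have tV : trivIset setT V.
  move=> i j _ _ [q [[p [x Cx xp] pq] [p' [x' Cx' xp'] pq']]].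
  have pp : p = p'.
    apply: (reach_injective boxes T0 (q := q)); [rewrite -pq|rewrite -pq']; exact: PhiP.
  have xx : x = x'.
    rewrite -(coordK (OD _ (CO i x Cx))) -(coordK (OD _ (CO j x' Cx'))).
    by rewrite xp xp' pp.
  apply: tF => //; exists x; split; first by have [_ h _ _ _] := hC i; exact: h.
  by have [_ h _ _ _] := hC j; apply: h; rewrite xx.
pose a := expR (delta / 2 * T) * m0.
have a0 : 0 < a by rewrite mulr_gt0 ?expR_gt0.
have part N : (\sum_(i < N) mu (F i) <= (a^-1 * RHS)%:E)%E.
  rewrite EFinM lee_pdivlMl // ge0_sume_distrr; last by move=> i _; exact: measure_ge0.
  apply: (@le_trans _ _ (\sum_(i < N) nustar (V i))%E).
    by apply: lee_sum => i _; have [] := hC i.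
  rewrite -nustar_bigU //.
  have T1' : 0 < 1 + 2 * B * T by rewrite ltr_pwDl // !mulr_ge0 // ltW.
  apply: (nustar_upper kappa0 above (y := imm (par S n u0)) T1').
  - by apply: bigcup_open => i _; exact: oV.
  - move=> q k [i _ [p [x Cx <-] <-]].
    have [_ _ h] := box x (CO i x Cx).
    have d := displacement B0 ufB k T0 (PhiP (par S n x) T0).
    have := le_trans (ler_normD _ _) (lerD d (h k)).
    by rewrite [2 * B * T + 1]addrC -[comp S n k x]/(imm (par S n x) 0 k) subrKA.
  - by apply: ga; rewrite exprn_gt0.
have mF i : measurable (F i : set (T1 * T1)).
  by have [->|[k [x [-> _]]]] := Fg i; [exact: measurable0|exact: measurable_cellof].
have muO : mu O = (\sum_(0 <= i <oo) mu (F i))%E.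
  by rewrite -FU; apply/esym/cvg_lim => //; exact: measure_sigma_additive.
have : (mu O <= (a^-1 * RHS)%:E)%E.
  rewrite muO; apply: lime_le; first by apply: is_cvg_nneseries => i _ _; exact: measure_ge0.
  by near=> N; rewrite big_mkord.
by rewrite EFinM lee_pdivlMl.
Unshelve. all: by end_near.
Qed.

End Contradiction.

Lemma no_expanding_translator (R : realType) (S : immersed_surface R) (slab : set R) (beta c : R) :
  translator S -> (entropy S < +oo)%E -> (forall p : S, slab (x1 (imm p))) ->
  (forall p : S, c <= x3 (imm p) + beta * x2 (imm p)) -> ~ expanding_ambient beta slab.
Proof.
move=> [[p0 _] _ complete mc] ent inslab above.
move=> [uf [duf [kappa [delta [B1 [kappa0 delta0 uf1 ufB1 pos]]]]]].
pose B := 1 + `|B1|; have B0 : 0 < B by rewrite ltr_pwDl.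
have sl n u : slab (comp S n 0 u) by exact: inslab.
have ufB n u k : dom S n u -> `|uf k (comp S n 0 u)| <= B.
  move=> _; apply: le_trans (ufB1 k _ (sl n u)) _; apply: le_trans (ler_norm _) _.
  by rewrite lerDr.
have boxes n u : dom S n u -> exists r L tau phi, flow_box S uf kappa beta delta n u r L tau phi.
  move=> Uu; have [a0 [a1 [d [s0 s1 sd]]]] := wf_rho_sdiff kappa beta uf1 Uu.
  exact: (expanding_flow (@dom_open R S n) Uu s0 s1 sd (@rho_cts R S kappa beta n)
    (@rho_gt0 R S kappa beta n) delta0 (div_ge mc uf1 pos Uu (sl n u) s0 s1 sd)).
have /choice[Phi PhiP] : forall t : R, exists f : S -> S, forall p, 0 <= t -> reach uf p t (f p).
  move=> t; have E (p : S) : exists q, 0 <= t -> reach uf p t q.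
    have [t0|nt] := boolP (0 <= t); last by exists p.
    by have [q hq] := reach_total B0 ufB boxes complete p t0; exists q.
  by have [f hf] := choice E; exists f.
have [l ga] : exists l : R, forall y (t : R), 0 < t -> (gaussian_area S y t <= l%:E)%E.
  have ub y (t : R) : 0 < t -> (gaussian_area S y t <= entropy S)%E.
    by move=> t0; apply: ereal_sup_ubound; exists y, t.
  move: ent ub; case: (entropy S) => [l| |] // _ ub; first by exists l.
  by exists 0 => y t /ub /le_trans; apply; rewrite leNye.
have [n In] := par_cover p0; have Uu := dom_coord In; set u0 := Defs.coord S n p0 in Uu.
(* The set that is transported is a coordinate square around one point. It is so small that the
   density keeps half of its central value and the space coordinates vary by at most 1. *)
pose m0 := rho S kappa beta n u0 / 2.
have rho0 := rho_gt0 kappa beta Uu.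
have m00 : 0 < m0 by rewrite divr_gt0.
have [r1 r10 h1] := open_eps (@dom_open R S n) Uu.
have [r2 r20 h2] := (cts_eps _ _).1 (rho_cts (kappa := kappa) (beta := beta) Uu) m0 m00.
have cc k := (cts_eps _ _).1 (sdiff_cts (comp_sdiff k Uu)) 1 ltr01.
have [q0 q00 k0] := cc 0; have [q1 q10 k1] := cc 1; have [q2 q20 k2] := cc ord_max.
pose r := Num.min (Num.min r1 r2) (Num.min (Num.min q0 q1) q2).
have r0 : 0 < r by rewrite !lt_min r10 r20 q00 q10 q20.
have box x : `|x - u0| < r -> [/\ dom S n x, m0 <= rho S kappa beta n x &
    forall k, `|comp S n k x - comp S n k u0| <= 1].
  rewrite !lt_min => /andP[/andP[/h1 Ux /h2 rx] /andP[/andP[/k0 c0 /k1 c1] /k2 c2]].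
  split => //; last by move=> k; have [-> | -> | ->] := ord3P k.
  move: rx; rewrite ler_norml => /andP[rx _].
  have E : rho S kappa beta n u0 = m0 + m0 by rewrite /m0; field.
  by move: rx; rewrite E lerBrDl addrK.
set M := expR (1 - kappa * c) * (4 * pi * `|l|).
have M0 : 0 <= M by rewrite mulr_ge0 ?expR_ge0 // !mulr_ge0 // pi_ge0.
have d2 : 0 < delta / 2 by rewrite divr_gt0.
have mm : 0 < m0 * (r / 2) ^+ 2 by rewrite mulr_gt0 // exprn_gt0 // divr_gt0.
have B2 : 0 <= 2 * B by rewrite mulr_ge0 // ltW.
have [T [T0]] := exp_beats_square d2 mm M0 B2.
apply/negP; rewrite -leNgt.
have G := growth kappa0 B0 ufB boxes above PhiP r0 m00 T0 box ga.
have low : (((r / 2) ^+ 2)%:E <= (@lebesgue_measure R \x @lebesgue_measure R)%E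
    [set x : R * R | (`|x - u0| < r)%R])%E.
  rewrite -(box_measure u0.1 u0.2); last by rewrite divr_ge0 // ltW.
  apply: le_measure; rewrite ?inE.
  - by apply: measurableX; exact: measurable_itv.
  - by apply: open_measurable2; exact: ball_open.
  - move=> x [/=]; rewrite !in_itv /= => /andP[a1 a2] /andP[a3 a4].
    rewrite prod_normE gt_max !ger0_norm ?subr_ge0 //=.
    by apply/andP; split; move: a2 a4 r0; lra.
have a0 : 0 <= expR (delta / 2 * T) * m0 by rewrite mulr_ge0 ?expR_ge0 // ltW.
have : ((expR (delta / 2 * T) * m0)%:E * ((r / 2) ^+ 2)%:E <=
    (expR (1 - kappa * c) * (4 * pi * (1 + 2 * B * T) ^+ 2 * l))%:E)%E.
  by apply: le_trans G; apply: lee_wpmul2l; rewrite ?lee_fin.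
rewrite -EFinM lee_fin -[_ * m0 * _]mulrA => h; apply: (le_trans h).
have -> : M * (1 + 2 * B * T) ^+ 2 = expR (1 - kappa * c) * (4 * pi * (1 + 2 * B * T) ^+ 2 * `|l|).
  by rewrite /M; ring.
rewrite ler_wpM2l ?expR_ge0 // ler_wpM2l ?ler_norm //.
by rewrite mulr_ge0 ?sqr_ge0 // mulr_ge0 // pi_ge0.
Qed.

Theorem corollary1p6 (R : realType) :
  ~ exists (S : immersed_surface R) (a omega : R),
      [/\ translator S,
          (entropy S < +oo)%E,
          0 < omega,
          (forall p : S, a < x1 (imm p) < a + omega) &
          (omega < pi /\
             exists c : R, forall p : S, c <= x3 (imm p))
          \/
          (omega = pi /\
             exists c beta : R, beta != 0 /\
               forall p : S, c <= x3 (imm p) + beta * x2 (imm p))].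
Proof.
move=> [S [a [omega [tr ent w0 slab]]]] [[wpi [c above]]|[wpi [c [beta [b0 above]]]]].
- apply: (no_expanding_translator (c := c) tr ent slab _ (ambient_narrow a w0 wpi)).
  by move=> p; rewrite mul0r addr0.
- rewrite wpi in slab.
  exact: (no_expanding_translator tr ent slab above (ambient_wide a b0)).
Qed.
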